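(* For every $p\in(1,\infty)$, $$\ker\Lambda_p=\mathscr{WCG}(\mathcal{J}_p(\omega_1))=\mathscr{G}_{\mathfrak{G}_p}(\mathcal{J}_p(\omega_1))=\mathscr{C}(\mathcal{J}_p(\omega_1))=\mathscr{M}_{\mathcal{J}_p(\omega_1)},$$ and this is the unique maximal ideal of $\mathscr{B}(\mathcal{J}_p(\omega_1))$. Moreover, an operator $T\in\mathscr{B}(\mathcal{J}_p(\omega_1))$ belongs to this ideal if and only if it is $\mathcal{J}_p(\omega_1)$-singular, that is, $T$ does not fix a copy of $\mathcal{J}_p(\omega_1)$ (there is no closed subspace $W\subseteq\mathcal{J}_p(\omega_1)$ isomorphic to $\mathcal{J}_p(\omega_1)$ such that $T|_W$ is bounded below).
   Context: Scalars: $\mathbb{K}=\mathbb{R}$ or $\mathbb{C}$. Ideals are two-sided; $\mathscr{B}(X)$ is the algebra of bounded linear operators on $X$. Long James space. For $p\in(1,\infty)$ and $x\colon[0,\omega_1)\to\mathbb{K}$ put $\|x\|_{p,0}=\sup\big(\sum_{j=1}^n|x(\alpha_j)-x(\alpha_{j-1})|^p\big)^{1/p}$, the supremum over $n\in\mathbb{N}$ and $0\leqslant\alpha_0<\alpha_1<\dots<\alpha_n<\omega_1$. $\mathcal{J}_p(\omega_1)$ is the Banach space of continuous (order topology) functions $x\colon[0,\omega_1)\to\mathbb{K}$ with $\lim_{\alpha\to\omega_1}x(\alpha)=0$ and $\|x\|_{p,0}<\infty$, with the norm $\|\cdot\|_{p,0}$ or the equivalent norm $\|x\|_{\mathcal{J}_p}=2^{-1/p}\sup\big(|x(\alpha_n)-x(\alpha_0)|^p+\sum_{j=1}^n|x(\alpha_j)-x(\alpha_{j-1})|^p\big)^{1/p}$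 (same supremum). For $\alpha<\omega_1$, $e_\alpha^*(x)=x(\alpha)$. $\Lambda_p$. For each $T\in\mathscr{B}(\mathcal{J}_p(\omega_1))$ there is a unique scalar $\Lambda_p(T)=\lambda\in\mathbb{K}$ such that for some closed unbounded set $D\subseteq\omega_1$ one has $e_\alpha^*(Tx)=\lambda e_\alpha^*(x)$ for all $x\in\mathcal{J}_p(\omega_1)$ and $\alpha\in D$. The map $\Lambda_p\colon\mathscr{B}(\mathcal{J}_p(\omega_1))\to\mathbb{K}$ is a nonzero linear multiplicative functional. $\mathscr{WCG}(X)$: a Banach space is weakly compactly generated (WCG) if it contains a weakly compact subset with dense linear span; $\mathscr{WCG}(X)$ is the set of $T\in\mathscr{B}(X)$ whose range is contained in a closed subspace of $X$ that is a WCG Banach space. $\mathfrak{G}_p$: for an ordinal $0<\alpha<\omega_1$ let $\mathcal{J}_p(\alpha)=\overline{\mathrm{span}}\{\mathbf{1}_{[0,\beta]}\colon 0\leqslant\beta<\alpha\}\subseteq\mathcal{J}_p(\omega_1)$; let $L(\omega_1)$ be the set of nonzero limit ordinals below $\omega_1$; and $\mathfrak{G}_p=\big(\bigoplus_{\alpha\in L(\omega_1)}\mathcal{J}_p(\alpha)\big)_{\ell_p}$. $\mathscr{G}_Y(X)=\mathrm{span}\{ST\colon T\in\mathscr{B}(X,Y),\ S\in\mathscr{B}(Y,X)\}$. $\mathscr{C}(X)$ is the set of compressible operators: $T\in\mathscr{B}(X)$ is compressible if there are $n\in\mathbb{N}$ and a sequence $(Q_k)_{k=1}^\infty$ of bounded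 projections on $X^n$ with $Q_kQ_\ell=0$ for $k\neq\ell$ such that $T$ factors through $Q_k$ for each $k$ (i.e. $T=A_kQ_kB_k$ for some $B_k\in\mathscr{B}(X,X^n)$, $A_k\in\mathscr{B}(X^n,X)$). $\mathscr{M}_X=\{T\in\mathscr{B}(X)\colon I\neq ATB\text{ for all }A,B\in\mathscr{B}(X)\}$. *)

(* Defs.v *)
From HB Require Import structures.
From mathcomp Require Import all_boot all_order all_algebra.
From mathcomp Require Import finmap complex.
From mathcomp Require Import all_classical all_reals all_analysis.
From mathcomp Require Import ring lra.
From mathcomp Require wochoice.

Set Implicit Arguments.
Unset Strict Implicit.
Unset Printing Implicit Defensive.

Import Order.TTheory GRing.Theory Num.Theory.
Import numFieldNormedType.Exports.

Local Open Scope classical_set_scope.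
Local Open Scope ring_scope.

(* [omega1] consists of the elements of a
   well-ordered uncountable type whose initial segments are countable; it is
   well-ordered and uncountable with countable initial segments
   ([omega1_min], [omega1_uncountable], [omega1_countable_below]), hence it is
   the ordered set [0, omega_1). *)

Definition wo_rel : rel (set nat) :=
  sval (wochoice.well_ordering_principle (set nat)).

Definition omega1 : Type := {t : set nat | countable [set s | wo_rel s t]}.

HB.instance Definition _ := Choice.on omega1.

Definition le_omega1 (a b : omega1) : bool := wo_rel (\val a) (\val b).

Lemma wo_relP : wochoice.well_order wo_rel.
Proof. exact: (svalP (wochoice.well_ordering_principle (set nat))). Qed.

Lemma wo_rel_chain : wochoice.wo_chain wo_rel predT.
Proof. by move=> A _; exact: wo_relP. Qed.

Lemma wo_rel_refl : reflexive wo_rel.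
Proof. by move=> x; exact: (wochoice.wo_chain_reflexive wo_rel_chain). Qed.

Lemma wo_rel_anti : antisymmetric wo_rel.
Proof.
by move=> x y; exact: (wochoice.wo_chain_antisymmetric wo_rel_chain).
Qed.

Lemma wo_rel_total : total wo_rel.
Proof. by move=> x y; exact: (wochoice.wo_chainW wo_rel_chain). Qed.

Lemma wo_rel_trans : transitive wo_rel.
Proof.
move=> y x z xy yz.
have [|m [[/= + mlb] _]] := wo_relP (A := [pred t | t \in [:: x; y; z]]).
  by exists x; rewrite inE /= inE eqxx.
have lbx : wo_rel m x by apply: mlb; rewrite inE /= !inE eqxx.
have lby : wo_rel m y by apply: mlb; rewrite inE /= !inE eqxx orbT.
have lbz : wo_rel m z by apply: mlb; rewrite inE /= !inE eqxx !orbT.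
rewrite inE !inE => /or3P[] /eqP mE; subst m => //.
  by rewrite (wo_rel_anti (x := x) (y := y)) ?xy.
have <- : y = z by apply: wo_rel_anti; rewrite yz lby.
by [].
Qed.

Lemma le_omega1_refl : reflexive le_omega1.
Proof. by move=> x; exact: wo_rel_refl. Qed.

Lemma le_omega1_anti : antisymmetric le_omega1.
Proof. by move=> x y /wo_rel_anti /val_inj. Qed.

Lemma le_omega1_trans : transitive le_omega1.
Proof. by move=> y x z; exact: wo_rel_trans. Qed.

Lemma le_omega1_total : total le_omega1.
Proof. by move=> x y; exact: wo_rel_total. Qed.

HB.instance Definition _ := @Order.Le_isPOrder.Build (Order.default_display) omega1
  le_omega1 le_omega1_refl le_omega1_anti le_omega1_trans.
HB.instance Definition _ :=
  Order.POrder_isTotal.Build _ omega1 le_omega1_total.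
HB.instance Definition _ := Topological.copy omega1 (order_topology omega1).
HB.instance Definition _ := OrderTopological.copy omega1 (order_topology omega1).

Lemma omega1_min (A : set omega1) :
  A !=set0 -> exists2 a, A a & forall b, A b -> (a <= b)%O.
Proof.
move=> [a0 Aa0].
pose B : {pred set nat} := [pred t | `[< exists2 a, A a & \val a = t >]].
have [|m [[/= Bm mlb] _]] := wo_relP (A := B).
  by exists (\val a0); rewrite inE; exists a0.
move: Bm; rewrite inE => -[a Aa aE]; exists a => // b Ab.
rewrite /Order.le /= /le_omega1 aE; apply: mlb; rewrite inE.
by exists b.
Qed.

Lemma omega1_countable_below (a : omega1) : countable [set b | (b <= a)%O].
Proof.
have /countable_injP[f finj] := svalP a.
apply/countable_injP; exists (fun b => f (\val b)) => b c; rewrite !inE /= => ba ca.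
by move/finj; rewrite !inE => /(_ ba ca) /val_inj.
Qed.

Lemma omega1_uncountable : ~ countable [set: omega1].
Proof.
move=> cW.
pose S := [set t : set nat | countable [set s | wo_rel s t]].
have cS : countable S.
  have /countable_injP[f finj] := cW.
  apply/countable_injP.
  exists (fun t => match insub t : option omega1 with
                   | Some a => f a | None => 0%N end) => s t.
  rewrite !inE => Ss St; rewrite !insubT /= => /finj.
  by rewrite !inE => /(_ I I) /(congr1 val).
have [ST|] := pselect (S = setT).
  move: cS; rewrite ST => /countable_injP[f finj].
  pose D := [set n | exists2 t : set nat, f t = n & ~ t n].
  have DD : ~ D (f D).
    move=> [t /finj]; rewrite !inE => /(_ I I) -> h; apply: (h).
    by exists D.
  by apply: (DD); exists D.
move=> SnT; have [t nSt] : exists t, ~ S t.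
  by apply/existsNP => h; apply: SnT; apply/seteqP; split.
pose B : {pred set nat} := [pred t | `[< ~ S t >]].
have [|m [[/= Bm mlb] _]] := wo_relP (A := B).
  by exists t; rewrite inE.
move: Bm; rewrite inE; apply.
rewrite /S /=; apply: (@sub_countable _ _ _ (S `|` [set m])); last first.
  by rewrite -bigcup2E; apply: bigcup_countable => // -[|[|i]] _ /=.
apply: subset_card_le => s /= sm.
have [Ss|nSs] := pselect (S s); first by left.
right => /=; apply: wo_rel_anti; rewrite sm /=; apply: mlb.
by rewrite inE.
Qed.

Inductive scalar_kind := RealScalars | ComplexScalars.

Definition scalarField (R : realType) (k : scalar_kind) : numFieldType :=
  match k with RealScalars => R | ComplexScalars => R[i] end.

Definition ofReal (R : realType) (k : scalar_kind) : R -> scalarField R k :=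
  match k return R -> scalarField R k with
  | RealScalars => fun r : R => r
  | ComplexScalars => fun r : R => Complex r 0
  end.

Definition toReal (R : realType) (k : scalar_kind) : scalarField R k -> R :=
  match k return scalarField R k -> R with
  | RealScalars => fun z : R => z
  | ComplexScalars => fun z : R[i] => complex.Re z
  end.

Section scalars.
Context (R : realType) (k : scalar_kind).
Local Notation K := (scalarField R k).

Lemma ofRealK : cancel (@ofReal R k) (@toReal R k).
Proof. by case: k. Qed.

Lemma toRealK (z : K) : 0 <= z -> ofReal k (toReal z) = z.
Proof. by case: k z => //= z z0; exact: (RRe_real (ger0_real z0)). Qed.

Lemma ler_ofReal (a b : R) : (ofReal k a <= ofReal k b) = (a <= b).
Proof. by case: k => //=; rewrite lecR. Qed.

Lemma ofReal0 : ofReal k (0 : R) = 0.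
Proof. by case: k. Qed.

Lemma ofRealD (a b : R) : ofReal k (a + b) = ofReal k a + ofReal k b.
Proof. by case: k => //=; exact: (rmorphD (real_complex R)). Qed.

Lemma ofRealM (a b : R) : ofReal k (a * b) = ofReal k a * ofReal k b.
Proof. by case: k => //=; exact: (rmorphM (real_complex R)). Qed.

(* Library norms take values in the scalar field; [rnorm] is the same norm as
   an element of R. *)
Definition rnorm (V : normedModType K) (v : V) : R := toReal `|v|.

Lemma rnormE (V : normedModType K) (v : V) : ofReal k (rnorm v) = `|v|.
Proof. by rewrite toRealK. Qed.

Lemma rnorm_ge0 (V : normedModType K) (v : V) : 0 <= rnorm v.
Proof. by rewrite -ler_ofReal rnormE ofReal0. Qed.

Lemma ler_rnormD (V : normedModType K) (v w : V) :
  rnorm (v + w) <= rnorm v + rnorm w.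
Proof. by rewrite -ler_ofReal ofRealD !rnormE ler_normD. Qed.

Lemma rnormZ (V : normedModType K) (a : K) (v : V) :
  rnorm (a *: v) = rnorm (a : K^o) * rnorm v.
Proof.
by apply: (can_inj ofRealK); rewrite ofRealM !rnormE normrZ.
Qed.

Lemma rnorm_eq0 (V : normedModType K) (v : V) : rnorm v = 0 -> v = 0.
Proof.
by move=> /(congr1 (ofReal k)); rewrite rnormE ofReal0 => /normr0_eq0.
Qed.

End scalars.

(* Minkowski's inequality for sup_(t in D) (\sum_(i <- r t) q_{t,i}(x)^p)^(1/p),
   where the q_{t,i} are seminorms; it yields the norms of [lp_sum] and
   [long_james]. *)
Section sup_pnorm.
Context (R : realType) (k : scalar_kind) (V : lmodType (scalarField R k)).
Context (p : R) (T I : Type) (D : set T) (r : T -> seq I).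
Context (q : T -> I -> V -> R).
Local Notation K := (scalarField R k).
Hypothesis p1 : 1 < p.
Hypothesis D0 : D !=set0.
Hypothesis q_ge0 : forall t i x, 0 <= q t i x.
Hypothesis qD : forall t i x y, q t i (x + y) <= q t i x + q t i y.
Hypothesis qZ : forall t i a x, q t i (a *: x) = rnorm (a : K^o) * q t i x.

Let psum t x : R := \sum_(i <- r t) q t i x `^ p.
Let pvar x : \bar R := ereal_sup [set (psum t x)%:E | t in D].
Let pnorm x : R := fine (pvar x) `^ p^-1.

Let p_gt0 : 0 < p. Proof. exact: lt_trans p1. Qed.

Let psum_ge0 t x : 0 <= psum t x.
Proof. by apply: sumr_ge0 => i _; exact: powR_ge0. Qed.

Let pvar_ge0 x : (0 <= pvar x)%E.
Proof.
have [t Dt] := D0; apply: le_trans (ereal_sup_ubound _); last by exists t.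
by rewrite lee_fin psum_ge0.
Qed.

Let psum_le t x : (pvar x < +oo)%E -> D t -> psum t x <= pnorm x `^ p.
Proof.
move=> xoo Dt; rewrite /pnorm -powRrM mulVf ?gt_eqF// powRr1 ?fine_ge0//.
rewrite -lee_fin fineK ?ge0_fin_numE//.
by apply: ereal_sup_ubound; exists t.
Qed.

Let pnorm_le x N : 0 <= N -> (forall t, D t -> psum t x <= N `^ p) ->
  (pvar x < +oo)%E /\ pnorm x <= N.
Proof.
move=> N0 h; have vle : (pvar x <= (N `^ p)%:E)%E.
  by apply: ge_ereal_sup => _ [t Dt <-]; rewrite lee_fin h.
have vlt : (pvar x < +oo)%E by apply: le_lt_trans vle (ltry _).
split=> //; rewrite -[leRHS](powRr1 N0) -(divff (x := p)) ?gt_eqF//.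
rewrite powRrM ge0_ler_powR ?nnegrE ?fine_ge0 ?powR_ge0 ?invr_ge0 ?(ltW p_gt0)//.
by rewrite -lee_fin fineK ?ge0_fin_numE.
Qed.

Let minkowski_pt (a b A B : R) : 0 <= a -> 0 <= b -> 0 < A -> 0 < B ->
  (a + b) `^ p <= (A + B) `^ p *
    (A / (A + B) * (a `^ p / A `^ p) + B / (A + B) * (b `^ p / B `^ p)).
Proof.
move=> a0 b0 A0 B0; have AB0 : 0 < A + B by rewrite addr_gt0.
have t01 : 0 <= A / (A + B) <= 1.
  by rewrite divr_ge0 ?(ltW A0) ?(ltW AB0)//= ler_pdivrMr// mul1r lerDl ltW.
pose t := Itv01 (andP t01).1 (andP t01).2.
have powd (c C : R) : 0 <= c -> 0 < C -> (c / C) `^ p = c `^ p / C `^ p.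
  move=> c0 C0; rewrite powRM ?invr_ge0 ?(ltW C0)//; congr (_ * _).
  by rewrite -powR_inv1 ?(ltW C0)// -powRrM mulN1r powRN.
have := @convex_powR R p (ltW p1) t (a / A) (b / B).
rewrite !inE /= !in_itv /= !andbT !divr_ge0 ?(ltW A0) ?(ltW B0)// => /(_ isT isT).
rewrite convRE [X in X `^ _ <= _ -> _]convRE /= /unstable.onem.
have -> : 1 - A / (A + B) = B / (A + B).
  by field; rewrite gt_eqF.
have -> : A / (A + B) * (a / A) + B / (A + B) * (b / B) = (a + b) / (A + B).
  by field; rewrite !gt_eqF.
rewrite !powd ?addr_ge0//.
by rewrite ler_pdivrMr ?powR_gt0// mulrC.
Qed.

Let minkowski (A B : R) t x y : 0 < A -> 0 < B ->
  psum t x <= A `^ p -> psum t y <= B `^ p -> psum t (x + y) <= (A + B) `^ p.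
Proof.
move=> A0 B0 xA yB; have AB0 : 0 < A + B by rewrite addr_gt0.
apply: (@le_trans _ _ (\sum_(i <- r t) (A + B) `^ p *
    (A / (A + B) * (q t i x `^ p / A `^ p) +
     B / (A + B) * (q t i y `^ p / B `^ p)))).
  apply: ler_sum => i _; apply: le_trans (minkowski_pt _ _ A0 B0) => //.
  by rewrite ge0_ler_powR ?nnegrE ?addr_ge0 ?(ltW p_gt0).
rewrite -big_distrr /= -[leRHS]mulr1 ler_wpM2l ?powR_ge0//.
rewrite big_split /= -!big_distrr /= -!big_distrl /=.
apply: (@le_trans _ _ (A / (A + B) * 1 + B / (A + B) * 1)).
  by rewrite lerD// ler_wpM2l ?divr_ge0 ?(ltW AB0) ?(ltW A0) ?(ltW B0)//
    ler_pdivrMr ?powR_gt0// mul1r.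
by rewrite !mulr1 -mulrDl divff// gt_eqF.
Qed.

Lemma sup_pnorm0 : (pvar 0 < +oo)%E.
Proof.
have [] // := @pnorm_le 0 0 => t Dt.
rewrite /psum big1 ?powR_ge0// => i _.
have := qZ t i 0 0; rewrite scale0r => ->.
have -> : rnorm (0 : K^o) = 0.
  by apply: (can_inj (@ofRealK R k)); rewrite rnormE normr0 ofReal0.
by rewrite mul0r powR0// gt_eqF.
Qed.

Lemma sup_pnormD x y : (pvar x < +oo)%E -> (pvar y < +oo)%E ->
  (pvar (x + y)%R < +oo)%E /\ pnorm (x + y) <= pnorm x + pnorm y.
Proof.
move=> xoo yoo.
have key e : 0 < e ->
    (pvar (x + y)%R < +oo)%E /\ pnorm (x + y) <= pnorm x + pnorm y + e.
  move=> e0; have e20 : 0 < e / 2 by rewrite divr_gt0.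
  have nx : 0 <= pnorm x by exact: powR_ge0.
  have ny : 0 <= pnorm y by exact: powR_ge0.
  have -> : pnorm x + pnorm y + e = (pnorm x + e / 2) + (pnorm y + e / 2).
    by rewrite addrACA -splitr.
  apply: (@pnorm_le (x + y)); first exact: addr_ge0 (addr_ge0 nx (ltW e20)) (addr_ge0 ny (ltW e20)).
  have step N : 0 <= N -> 0 < N + e / 2 /\ N `^ p <= (N + e / 2) `^ p.
    move=> N0; have N1 : 0 < N + e / 2 by rewrite ltr_wpDl.
    split=> //; apply: ge0_ler_powR; rewrite ?nnegrE ?(ltW p_gt0) ?(ltW N1)//.
    by rewrite lerDl ltW.
  have [x1 x2] := step _ nx; have [y1 y2] := step _ ny.
  move=> t Dt; apply: (minkowski x1 y1).
    exact: le_trans (psum_le xoo Dt) x2.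
  exact: le_trans (psum_le yoo Dt) y2.
split; first by have [] := key 1 ltr01.
by apply/ler_addgt0Pr => e e0; have [] := key e e0.
Qed.

Lemma sup_pnormZ_le a x : (pvar x < +oo)%E ->
  (pvar (a *: x)%R < +oo)%E /\ pnorm (a *: x) <= rnorm (a : K^o) * pnorm x.
Proof.
move=> xoo; apply: (@pnorm_le (a *: x)); first exact: mulr_ge0 (rnorm_ge0 _) (powR_ge0 _ _).
move=> t Dt; rewrite (powRM _ (rnorm_ge0 _) (powR_ge0 _ _)).
apply: le_trans (ler_wpM2l _ (psum_le xoo Dt)); last exact: powR_ge0.
rewrite /psum big_distrr /= ler_sum// => i _.
by rewrite qZ powRM ?rnorm_ge0.
Qed.

Lemma sup_pnormZ a x : (pvar x < +oo)%E ->
  pnorm (a *: x) = rnorm (a : K^o) * pnorm x.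
Proof.
move=> xoo; have [axoo le1] := sup_pnormZ_le a xoo.
apply: le_anti; rewrite le1 /=.
have [->|a0] := eqVneq a 0.
  have -> : rnorm (0 : K^o) = 0.
    by apply: (can_inj (@ofRealK R k)); rewrite rnormE normr0 ofReal0.
  by rewrite mul0r powR_ge0.
have [_] := sup_pnormZ_le a^-1 axoo; rewrite scalerA mulVf// scale1r.
have Ma : rnorm (a : K^o) * rnorm (a^-1 : K^o) = 1.
  rewrite -(@rnormZ R k K^o); apply: (can_inj (@ofRealK R k)).
  rewrite rnormE /GRing.scale /= mulfV// normr1; by case: k.
move=> /(ler_wpM2l (rnorm_ge0 (a : K^o))).
by rewrite mulrA Ma mul1r.
Qed.

Lemma sup_pnorm_eq0 x : (pvar x < +oo)%E -> pnorm x = 0 ->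
  forall t, D t -> \sum_(i <- r t) q t i x `^ p = 0.
Proof.
move=> xoo n0 t Dt; apply: le_anti; rewrite psum_ge0 andbT.
by have := psum_le xoo Dt; rewrite n0 powR0// gt_eqF.
Qed.

End sup_pnorm.

Section operators.
Context (K : numFieldType).

Definition bounded_operator (X Y : normedModType K) : set (X -> Y) :=
  [set T | linear T /\ exists M : K, forall x, `|T x| <= M * `|x|].

Definition lspan (V : lmodType K) (A : set V) : set V :=
  [set v | exists n (c : 'I_n -> K) (a : 'I_n -> V),
     (forall i, A (a i)) /\ v = \sum_(i < n) c i *: a i].

Record closedSubspace (X : normedModType K) := ClosedSubspace {
  subspace_set :> set X;
  subspace_submod : submod_closed (mem subspace_set);
  subspace_closed : closed subspace_set
}.

Definition subspace_pred (X : normedModType K) (W : closedSubspace X) :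
  {pred X} := mem (subspace_set W).

HB.instance Definition _ (X : normedModType K) (W : closedSubspace X) :=
  GRing.isSubmodClosed.Build K X (subspace_pred W) (subspace_submod W).

Record subspaceType (X : normedModType K) (W : closedSubspace X) :=
  SubspaceType { subspace_val :> X; _ : subspace_val \in subspace_pred W }.

HB.instance Definition _ (X : normedModType K) (W : closedSubspace X) :=
  [isSub for @subspace_val X W].
HB.instance Definition _ (X : normedModType K) (W : closedSubspace X) :=
  [Choice of subspaceType W by <:].
HB.instance Definition _ (X : normedModType K) (W : closedSubspace X) :=
  [SubChoice_isSubLmodule of subspaceType W by <:].

Section subspace_norm.
Context (X : normedModType K) (W : closedSubspace X).
Let nrm (w : subspaceType W) : K := `|subspace_val w|.

Let nrmD v w : nrm (v + w) <= nrm v + nrm w.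
Proof. exact: ler_normD. Qed.

Let nrmZ a w : nrm (a *: w) = `|a| * nrm w.
Proof. exact: normrZ. Qed.

Let nrm_eq0 w : nrm w = 0 -> w = 0.
Proof. by move=> /normr0_eq0 w0; exact: val_inj. Qed.

HB.instance Definition _ :=
  @Lmodule_isNormed.Build K (subspaceType W) nrm nrmD nrmZ nrm_eq0.
End subspace_norm.

Lemma lspan_submod (V : lmodType K) (A : set V) : submod_closed (mem (lspan A)).
Proof.
split=> [|c u v]; rewrite !inE.
  exists 0%N, (fun=> 0), (fun=> 0); split; first by case.
  by rewrite big_ord0.
move=> [n [b [a [Aa ->]]]] [m [d [e [Ae ->]]]].
exists (n + m)%N.
exists (fun i : 'I_(n + m) => match fintype.split i with inl j => c * b j | inr j => d j end).
exists (fun i : 'I_(n + m) => match fintype.split i with inl j => a j | inr j => e j end).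
split; first by move=> i; case: (fintype.split i).
rewrite big_split_ord /= scaler_sumr; congr (_ + _); apply: eq_bigr => i _.
  by rewrite (unsplitK (inl i)) scalerA.
by rewrite (unsplitK (inr i)).
Qed.

Lemma closed_span_submod (X : normedModType K) (A : set X) :
  submod_closed (mem (closure (lspan A))).
Proof.
have [+ L] := lspan_submod A; rewrite inE => L0.
split=> [|c u v]; rewrite !inE; first exact: subset_closure.
move=> clu clv B cB.
have : {for (u, v), continuous (fun z : X * X => c *: z.1 + z.2)}.
  apply: cvgD; last exact: cvg_snd.
  by apply: cvgZl_tmp; exact: cvg_fst.
move=> /(_ B cB) [/= [U V] [/= nU nV] UVB].
have [u' [su Uu]] := clu U nU; have [v' [sv Vv]] := clv V nV.
exists (c *: u' + v'); split; last exact: (UVB (u', v')).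
by have := L c u' v'; rewrite !inE; apply.
Qed.

Definition closed_span (X : normedModType K) (A : set X) : closedSubspace X :=
  ClosedSubspace (closed_span_submod A) (@closed_closure _ (lspan A)).

(* The weak topology of X is the initial topology of the evaluation map from X
   to the product of copies of K indexed by the dual. *)
Definition dual (X : normedModType K) : Type := @bounded_operator X K.

Definition weak_eval (X : normedModType K) (x : X) : {ptws dual X -> K} :=
  fun f => \val f x.

Definition weak_topology (X : normedModType K) : Type :=
  initial_topology (@weak_eval X).

HB.instance Definition _ (X : normedModType K) :=
  Topological.copy (weak_topology X) (initial_topology (@weak_eval X)).

Definition weakly_compact (X : normedModType K) (A : set X) : Prop :=
  compact (A : set (weak_topology X)).

Definition weakly_compactly_generated (X : normedModType K) : Prop :=
  exists2 A : set X, weakly_compact A & closure (lspan A) = setT.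

Definition isomorphic (X Y : normedModType K) : Prop :=
  exists (U : X -> Y) (V : Y -> X),
    [/\ bounded_operator U, bounded_operator V, cancel U V & cancel V U].

Definition fixes_copy (X Y : normedModType K) (T : X -> X) : Prop :=
  exists W : closedSubspace X, isomorphic (subspaceType W) Y /\
    exists2 c : K, 0 < c & forall w, subspace_set W w -> c * `|w| <= `|T w|.

Definition two_sided_ideal (X : normedModType K) (I : set (X -> X)) : Prop :=
  [/\ I `<=` @bounded_operator X X,
      I 0,
      forall a S T, I S -> I T -> I (a *: S + T) &
      forall S T, bounded_operator S -> I T -> I (S \o T) /\ I (T \o S)].

Definition maximal_ideal (X : normedModType K) (I : set (X -> X)) : Prop :=
  [/\ two_sided_ideal I, I <> @bounded_operator X X &
      forall J, two_sided_ideal J -> I `<=` J -> J = I \/ J = @bounded_operator X X].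

(* X^n carries the norm \sum_i |x_i|. *)
Definition power (X : normedModType K) (n : nat) : Type := 'I_n -> X.

HB.instance Definition _ (X : normedModType K) (n : nat) :=
  GRing.Lmodule.copy (power X n) ('I_n -> X).

Section power_norm.
Context (X : normedModType K) (n : nat).
Let nrm (x : power X n) : K := \sum_(i < n) `|x i|.

Let nrmD x y : nrm (x + y) <= nrm x + nrm y.
Proof. by rewrite -big_split /=; apply: ler_sum => i _; exact: ler_normD. Qed.

Let nrmZ a x : nrm (a *: x) = `|a| * nrm x.
Proof. by rewrite big_distrr /=; apply: eq_bigr => i _; exact: normrZ. Qed.

Let nrm_eq0 x : nrm x = 0 -> x = 0.
Proof.
move=> x0; apply/funext => i.
have xi : `|x i| = 0.
  by apply: (psumr_eq0P (fun j _ => normr_ge0 (x j)) x0).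
exact: (normr0_eq0 xi).
Qed.

HB.instance Definition _ :=
  @Lmodule_isNormed.Build K (power X n) nrm nrmD nrmZ nrm_eq0.
End power_norm.

Definition compressible (X : normedModType K) : set (X -> X) :=
  [set T | bounded_operator T /\ exists (n : nat) (Q : nat -> power X n -> power X n),
     [/\ forall k, bounded_operator (Q k) /\ Q k \o Q k = Q k,
         forall k l, k <> l -> Q k \o Q l = 0 &
         forall k, exists (A : power X n -> X) (B : X -> power X n),
           [/\ bounded_operator A, bounded_operator B & T = A \o Q k \o B]]].

Definition wcg_operators (X : normedModType K) : set (X -> X) :=
  [set T | bounded_operator T /\ exists W : closedSubspace X,
     weakly_compactly_generated (subspaceType W) /\ range T `<=` W].

Definition factoring_span (X Y : normedModType K) : set (X -> X) :=
  lspan [set S \o T | S in @bounded_operator Y X & T in @bounded_operator X Y].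

Definition not_factoring_identity (X : normedModType K) : set (X -> X) :=
  [set T | bounded_operator T /\ forall A B,
     bounded_operator A -> bounded_operator B -> idfun <> A \o T \o B :> (X -> X)].

End operators.

Arguments bounded_operator {K X Y} T.
Arguments fixes_copy {K X} Y T.
Arguments wcg_operators {K} X T.
Arguments factoring_span {K} X Y T.
Arguments not_factoring_identity {K} X T.
Arguments compressible {K} X T.

Section lp_sum.
Context (R : realType) (k : scalar_kind) (p : R) (p1 : 1 < p).
Local Notation K := (scalarField R k).
Context (I : choiceType) (E : I -> normedModType K).

Definition product : Type := forall i, E i.

HB.instance Definition _ := Choice.copy product (forall i, E i).

Let padd (f g : product) : product := fun i => f i + g i.
Let popp (f : product) : product := fun i => - f i.
Let pscale (a : K) (f : product) : product := fun i => a *: f i.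

Let paddA : associative padd.
Proof. by move=> f g h; apply/functional_extensionality_dep => i; exact: addrA. Qed.
Let paddC : commutative padd.
Proof. by move=> f g; apply/functional_extensionality_dep => i; exact: addrC. Qed.
Let padd0 : left_id (fun i => 0) padd.
Proof. by move=> f; apply/functional_extensionality_dep => i; exact: add0r. Qed.
Let paddN : left_inverse (fun i => 0) popp padd.
Proof. by move=> f; apply/functional_extensionality_dep => i; exact: addNr. Qed.

HB.instance Definition _ :=
  GRing.isZmodule.Build product paddA paddC padd0 paddN.

Let pscaleA a b f : pscale a (pscale b f) = pscale (a * b) f.
Proof. by apply/functional_extensionality_dep => i; exact: scalerA. Qed.
Let pscale1 : left_id 1 pscale.
Proof. by move=> f; apply/functional_extensionality_dep => i; exact: scale1r. Qed.
Let pscaleDr : right_distributive pscale +%R.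
Proof. by move=> a f g; apply/functional_extensionality_dep => i; exact: scalerDr. Qed.
Let pscaleDl f : {morph pscale^~ f : a b / a + b}.
Proof. by move=> a b; apply/functional_extensionality_dep => i; exact: scalerDl. Qed.

HB.instance Definition _ :=
  GRing.Zmodule_isLmodule.Build K product pscaleA pscale1 pscaleDr pscaleDl.

Definition lp_total (f : product) : \bar R :=
  \esum_(i in [set: I]) (rnorm (f i) `^ p)%:E.

Definition lp_sum_pred of 1 < p : {pred product} :=
  [pred f | `[< (lp_total f < +oo)%E >]].

Let D : set (set I) := fsets setT.
Let r (A : set I) : seq I := fset_set A.
Let q (_ : set I) (i : I) (f : product) : R := rnorm (f i).

Let D0 : D !=set0. Proof. by exists set0; exact: fsets_set0. Qed.
Let q_ge0 A i f : 0 <= q A i f. Proof. exact: rnorm_ge0. Qed.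
Let qD A i f g : q A i (f + g) <= q A i f + q A i g.
Proof. exact: ler_rnormD. Qed.
Let qZ A i a f : q A i (a *: f) = rnorm (a : K^o) * q A i f.
Proof. exact: rnormZ. Qed.

Let lp_totalE f : lp_total f =
  ereal_sup [set (\sum_(i <- r A) q A i f `^ p)%:E | A in D].
Proof.
rewrite /lp_total /esum; congr ereal_sup; apply: eq_imagel => A [finA _].
by rewrite fsbig_finite //= sumEFin.
Qed.

Lemma lp_sum_submod : submod_closed (lp_sum_pred p1).
Proof.
split=> [|a f g]; rewrite !inE !lp_totalE; first exact: sup_pnorm0.
move=> foo goo.
have [afoo _] := sup_pnormZ_le p1 D0 q_ge0 qZ a foo.
by have [] := sup_pnormD p1 D0 q_ge0 qD afoo goo.
Qed.

HB.instance Definition _ :=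
  GRing.isSubmodClosed.Build K product (lp_sum_pred p1) lp_sum_submod.

Record lp_sum := LpSum { lp_fun :> product; _ : lp_fun \in lp_sum_pred p1 }.

HB.instance Definition _ := [isSub for lp_fun].
HB.instance Definition _ := [Choice of lp_sum by <:].
HB.instance Definition _ := [SubChoice_isSubLmodule of lp_sum by <:].

Definition lp_norm (f : lp_sum) : K := ofReal k (fine (lp_total f) `^ p^-1).

Let lp_fin (f : lp_sum) : (lp_total f < +oo)%E.
Proof. by case: f => f /=; rewrite inE. Qed.

Let lp_normD f g : lp_norm (f + g) <= lp_norm f + lp_norm g.
Proof.
rewrite -ofRealD ler_ofReal; have := lp_fin f; have := lp_fin g.
rewrite !lp_totalE => goo foo.
by have [] := sup_pnormD p1 D0 q_ge0 qD foo goo.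
Qed.

Let lp_normZ a f : lp_norm (a *: f) = `|a| * lp_norm f.
Proof.
rewrite -(@rnormE R k K^o) -ofRealM; congr ofReal; have := lp_fin f.
by rewrite !lp_totalE => foo; exact: (sup_pnormZ p1 D0 q_ge0 qZ a foo).
Qed.

Let lp_norm_eq0 f : lp_norm f = 0 -> f = 0.
Proof.
rewrite -ofReal0 => /(can_inj (@ofRealK R k)); have := lp_fin f.
rewrite !lp_totalE => foo n0; apply: val_inj.
apply/functional_extensionality_dep => i.
have Di : D [set i] by split.
have := sup_pnorm_eq0 p1 D0 foo n0 Di.
rewrite /r fset_set1 big_seq_fset1 => /powR_eq0_eq0.
exact: rnorm_eq0.
Qed.

HB.instance Definition _ :=
  @Lmodule_isNormed.Build K lp_sum lp_norm lp_normD lp_normZ lp_norm_eq0.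

End lp_sum.

(* The filter x --> omega_1 on [0, omega_1). *)
Definition near_omega1 : set_system omega1 :=
  filter_from setT (fun a => [set b | (a <= b)%O]).

Lemma omega1_inhabited : exists a : omega1, True.
Proof.
apply/not_existsP => h; apply: omega1_uncountable.
have -> : [set: omega1] = set0 by apply/seteqP; split=> // a _; apply: (h a).
exact: countable0.
Qed.

#[global] Instance near_omega1_proper : ProperFilter near_omega1.
Proof.
apply: filter_from_proper => [|a _]; last by exists a => /=.
apply: filter_from_filter; first by have [a _] := omega1_inhabited; exists a.
move=> a b _ _; exists (Order.max a b) => // c /=.
by rewrite ge_max => /andP[].
Qed.

Section long_james.
Context (R : realType) (k : scalar_kind) (p : R) (p1 : 1 < p).
Local Notation K := (scalarField R k).

(* (n, a) stands for the tuple a 0 < a 1 < ... < a n; the values of a beyond n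
   are irrelevant. *)
Definition chain : set (nat * (nat -> omega1)) :=
  [set c | forall j, (j < c.1)%N -> (c.2 j < c.2 j.+1)%O].

Definition variation (x : omega1 -> K) : \bar R :=
  ereal_sup [set (\sum_(0 <= j < c.1)
    rnorm (x (c.2 j.+1) - x (c.2 j) : K^o) `^ p)%:E | c in chain].

(* p > 1 is an argument because closure under sums depends on it. *)
Definition long_james_pred of 1 < p : {pred omega1 -> K} :=
  [pred x | `[< [/\ continuous x, x @ near_omega1 --> (0 : K) &
                   (variation x < +oo)%E] >]].

Let r (c : nat * (nat -> omega1)) : seq nat := index_iota 0 c.1.
Let q (c : nat * (nat -> omega1)) (j : nat) (x : omega1 -> K) : R :=
  rnorm (x (c.2 j.+1) - x (c.2 j) : K^o).

Let D0 : chain !=set0.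
Proof.
by have [a _] := omega1_inhabited; exists (0%N, fun=> a) => j; rewrite ltn0.
Qed.
Let q_ge0 c j x : 0 <= q c j x. Proof. exact: rnorm_ge0. Qed.
Let qD c j x y : q c j (x + y) <= q c j x + q c j y.
Proof. by rewrite /q /= opprD addrACA; exact: (@ler_rnormD R k K^o). Qed.
Let qZ c j a x : q c j (a *: x) = rnorm (a : K^o) * q c j x.
Proof. by rewrite /q /= -scalerBr; exact: (@rnormZ R k K^o). Qed.

Lemma long_james_submod : submod_closed (long_james_pred p1).
Proof.
split=> [|a x y]; rewrite !inE.
  split; [exact: cst_continuous | exact: cvg_cst | exact: (@sup_pnorm0 _ _ _ _ _ _ _ r q p1 D0 qZ)].
move=> [cx lx vx] [cy ly vy]; split.
- move=> t.
  exact: (@cvgD _ K^o _ _ _ _ _ _ _ (@cvgZl_tmp _ K^o _ _ _ a _ _ (cx t)) (cy t)).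
- have := @cvgD _ K^o _ _ _ _ _ _ _ (@cvgZl_tmp _ K^o _ _ _ a _ _ lx) ly.
  by rewrite scaler0 addr0 => h; exact: h.
- have [axoo _] := sup_pnormZ_le p1 D0 q_ge0 qZ a vx.
  by have [] := sup_pnormD p1 D0 q_ge0 qD axoo vy.
Qed.

HB.instance Definition _ :=
  GRing.isSubmodClosed.Build K (omega1 -> K) (long_james_pred p1)
    long_james_submod.

Record long_james :=
  LongJames { lj_fun :> omega1 -> K; _ : lj_fun \in long_james_pred p1 }.

HB.instance Definition _ := [isSub for lj_fun].
HB.instance Definition _ := [Choice of long_james by <:].
HB.instance Definition _ := [SubChoice_isSubLmodule of long_james by <:].

(* the norm |x|_{p,0} *)
Definition lj_norm (x : long_james) : K := ofReal k (fine (variation x) `^ p^-1).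

Let lj_fin (x : long_james) : (variation x < +oo)%E.
Proof. by case: x => x /=; rewrite inE => -[]. Qed.

Let lj_normD x y : lj_norm (x + y) <= lj_norm x + lj_norm y.
Proof.
rewrite -ofRealD ler_ofReal.
by have [] := sup_pnormD p1 D0 q_ge0 qD (lj_fin x) (lj_fin y).
Qed.

Let lj_normZ a x : lj_norm (a *: x) = `|a| * lj_norm x.
Proof.
rewrite -(@rnormE R k K^o) -ofRealM; congr ofReal.
exact: (sup_pnormZ p1 D0 q_ge0 qZ a (lj_fin x)).
Qed.

Let lj_norm_eq0 x : lj_norm x = 0 -> x = 0.
Proof.
rewrite -ofReal0 => /(can_inj (@ofRealK R k)) n0; apply: val_inj.
have xlt a b : (a < b)%O -> x a = x b.
  move=> ab; have Dab : chain (1%N, fun j => if j is 0 then a else b).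
    by case.
  have := @sup_pnorm_eq0 _ _ _ _ _ _ _ r q p1 D0 x (lj_fin x) n0 _ Dab.
  rewrite /r /index_iota /= big_seq1 => /powR_eq0_eq0 /rnorm_eq0 /subr0_eq.
  by [].
have xcst a b : x a = x b.
  by have [/xlt|/xlt|->] := ltgtP a b.
apply/funext => a.
have : x @ near_omega1 --> (0 : K) by case: (x) => y /=; rewrite inE => -[].
have -> : (x : omega1 -> K) = cst (x a) by apply/funext => b; exact: xcst.
by move=> /(cvg_unique (@norm_hausdorff _ K^o) (cvg_cst (x a : K^o))).
Qed.

HB.instance Definition _ :=
  @Lmodule_isNormed.Build K long_james lj_norm lj_normD lj_normZ lj_norm_eq0.

Section initial_indicator.
Variable b : omega1.
Let ind : omega1 -> K := \1_[set c | (c <= b)%O].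

Let ind_le c : (c <= b)%O -> ind c = 1.
Proof. by move=> cb; rewrite /ind indicE mem_set. Qed.

Let ind_gt c : (b < c)%O -> ind c = 0.
Proof.
by move=> bc; rewrite /ind indicE memNset//= => cb; move: bc; rewrite ltNge cb.
Qed.

Let succ : exists2 s, (b < s)%O & forall c, (b < c)%O -> (s <= c)%O.
Proof.
apply: (@omega1_min [set c | (b < c)%O]).
apply: contrapT => h; apply: omega1_uncountable.
apply: sub_countable (omega1_countable_below b); apply: subset_card_le => c _.
by rewrite /= leNgt; apply/negP => bc; apply: h; exists c.
Qed.

Let ind_continuous : continuous ind.
Proof.
have [s bs smin] := succ.
move=> t; case: (leP t b) => tb.
  rewrite /continuous_at (ind_le tb); apply: (@cvg_near_cst _ _ _ _ (nbhs t) _).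
  have : nbhs t `]-oo, s[%classic.
    apply: open_nbhs_nbhs; split; first exact: lray_open.
    by rewrite /= in_itv /=; exact: le_lt_trans bs.
  apply: (@filterS _ (nbhs t) _) => c; rewrite /= in_itv /= => cs; apply: ind_le.
  by rewrite leNgt; apply/negP => bc; move: cs; rewrite ltNge smin.
rewrite /continuous_at (ind_gt tb); apply: (@cvg_near_cst _ _ _ _ (nbhs t) _).
have : nbhs t `]b, +oo[%classic.
  apply: open_nbhs_nbhs; split; first exact: rray_open.
  by rewrite /= in_itv /= andbT.
by apply: (@filterS _ (nbhs t) _) => c; rewrite /= in_itv /= andbT; exact: ind_gt.
Qed.

Let ind_lim : ind @ near_omega1 --> (0 : K).
Proof.
have [s bs _] := succ; apply: cvg_near_cst.
by exists s => // c /= sc; apply: ind_gt; exact: lt_le_trans sc.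
Qed.

Let ind_variation : (variation ind < +oo)%E.
Proof.
have r0 : rnorm (0 : K^o) = 0.
  by apply: (can_inj (@ofRealK R k)); rewrite rnormE normr0 ofReal0.
have r1 : rnorm (-1 : K^o) = 1.
  by apply: (can_inj (@ofRealK R k)); rewrite rnormE normrN1; case: (k).
apply: (@le_lt_trans _ _ 1%E); last exact: ltry.
apply: ge_ereal_sup => _ [[n a] /= ca <-]; rewrite lee_fin.
pose u j : R := (a j <= b)%O%:R.
rewrite (@eq_big_nat _ _ _ _ _ _ (fun j => u j - u j.+1)); last first.
  move=> j /andP[_ jn]; have := ca j jn => /= ajj; rewrite /u.
  case: (leP (a j.+1) b) => h1.
    have h0 := le_trans (ltW ajj) h1.
    by rewrite h0 !ind_le// !subrr r0 powR0// gt_eqF// (lt_trans ltr01).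
  rewrite (ind_gt h1); case: (leP (a j) b) => h0.
    by rewrite ind_le// sub0r r1 powR1 subr0.
  by rewrite ind_gt// !subrr r0 powR0// gt_eqF// (lt_trans ltr01).
have -> : \sum_(0 <= j < n) (u j - u j.+1) = u 0%N - u n.
  elim: n {ca} => [|n IH]; first by rewrite big_geq// subrr.
  by rewrite big_nat_recr//= IH addrA subrK.
by rewrite /u; case: (_ <= b)%O; case: (_ <= b)%O => /=; lra.
Qed.

Lemma initial_indicator_subproof : ind \in long_james_pred p1.
Proof. by rewrite inE; split. Qed.

Definition initial_indicator : long_james := LongJames initial_indicator_subproof.

End initial_indicator.

Definition club (D : set omega1) : Prop :=
  closed D /\ forall a, exists2 b, D b & (a <= b)%O.

Definition eventual_eigenvalue (T : long_james -> long_james) (l : K) : Prop :=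
  exists2 D : set omega1, club D & forall x a, D a -> T x a = l * x a.

(* Each bounded T has exactly one eventual eigenvalue. The default value 0 of
   [xget] is not used. *)
Definition Lambda (T : long_james -> long_james) : K :=
  xget 0 [set l | eventual_eigenvalue T l].

Definition ker_Lambda : set (long_james -> long_james) :=
  [set T | bounded_operator T /\ Lambda T = 0].

Definition james (a : omega1) : closedSubspace long_james :=
  closed_span [set initial_indicator b | b in [set b | (b < a)%O]].

Definition limit_ordinal : set omega1 :=
  [set a | (exists b, (b < a)%O) /\
           forall b, (b < a)%O -> exists2 c, (b < c)%O & (c < a)%O].

Definition G_space : Type :=
  lp_sum p1 (fun a : limit_ordinal => subspaceType (james (\val a))).

HB.instance Definition _ := NormedModule.on G_space.

End long_james.

Arguments long_james {R} k {p} p1.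
Arguments G_space {R} k {p} p1.
Arguments ker_Lambda {R} k {p} p1 T.

(* Main.v *)
(* Write 1_b for the indicator of [0, b] and t(a, b) = (T 1_b)(a). For fixed b the
   column t(-, b) is eventually 0; for fixed a the row t(a, -) is eventually a constant
   l(a), since b |-> f(1_b) has only finitely many jumps of size >= e for a bounded
   functional f. On the club of ordinals closed under both rates this gives
   T x (a) = l(a) x(a), because the 1_b span a dense subspace; l has bounded
   p-variation, hence is eventually constant, with value Lambda T.

   If Lambda T <> 0, composing with the increasing enumeration of the club and with its
   monotone left inverse factors the identity through T. This yields everything about
   maximality, and that T fixes a copy of the whole space.

   If Lambda T = 0, all T x vanish on a club of limit ordinals, so T x is an l_p-sum of
   pieces living on the gaps of the club; this factors T through the space G. Infinitely
   many mutually orthogonal complemented copies of G sit on disjoint long gaps of a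
   suitable club, so T is compressible. Conversely, orthogonal idempotents on J^n go
   under Lambda to orthogonal idempotent n x n matrices, and one of them is 0. G is
   generated by a set on which every functional is null, hence weakly compact; on a
   weakly compact set finitely many evaluations suffice for each tolerance, and the
   supremum a of omega successive such blocks of the club satisfies S y (a) = 0 for all
   y, so no operator through a WCG space has a non-zero eigenvalue. Finally T is not
   bounded below: a function climbing from 0 to 1 and back in 2n steps of height 1/n
   has norm >= 1, while its image is a sum of disjoint blocks and has norm
   O(n^(1/p - 1)). *)

From HB Require Import structures.
Require Import Defs.
From mathcomp Require Import all_boot all_order all_algebra.
From mathcomp Require Import complex.
From mathcomp Require Import all_classical all_reals all_analysis.
From mathcomp Require Import ring lra.

Set Implicit Arguments.
Unset Strict Implicit.
Unset Printing Implicit Defensive.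

Import Order.TTheory GRing.Theory Num.Theory.
Import numFieldNormedType.Exports.

Local Open Scope classical_set_scope.
Local Open Scope ring_scope.

(** * Countable ordinals *)

Section order_omega1.
Local Open Scope order_scope.
Implicit Types (a b c d s t : omega1) (A D : set omega1).

(** The estimates rest on two facts about functions carried by disjoint intervals. Variation lists
    on separate intervals may be concatenated, a lower l_p-estimate; and a jump between two blocks
    splits into one jump of each at the cost 2^p, an upper l_p-estimate. Pairing n bounded blocks
    with a functional therefore compares n e with a multiple of n^(1/p), which fails for large n
    because p > 1. This growth contradiction gives the finiteness of jumps and the nullity of the
    generators of G, and it also ends the argument on operators bounded below.

    The obstacle is continuity at limit ordinals. Extending a piece on a gap of the club by zero is
    safe if the gap starts at a nonlimit ordinal, and the piece belongs to a summand [james a] once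
    its value at the right end is subtracted. The summands are indexed by all limit ordinals rather
    than by gaps because G must serve every T: a gap ending at a, shifted to start at 0, fits into
    the summand of index a. *)

Definition least A : omega1 :=
  xget (sval (cid omega1_inhabited)) [set a | A a /\ forall b, A b -> a <= b].

Lemma leastP A : A !=set0 -> A (least A) /\ forall b, A b -> least A <= b.
Proof.
move=> /omega1_min[a Aa amin].
by have := @xgetPex _ (sval (cid omega1_inhabited)) [set a | A a /\ forall b, A b -> a <= b]; apply; exists a.
Qed.

Lemma least_in A a : A a -> A (least A).
Proof. by move=> Aa; have [] := @leastP A; first by exists a. Qed.

Lemma least_le A a : A a -> least A <= a.
Proof. by move=> Aa; have [|_] := @leastP A; [exists a | apply]. Qed.

Lemma omega1_ind (P : omega1 -> Prop) :
  (forall a, (forall b, b < a -> P b) -> P a) -> forall a, P a.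
Proof.
move=> h a; apply: contrapT => nPa.
have [nPm mle] := @leastP [set b | ~ P b] (ex_intro _ a nPa).
apply: nPm; apply: h => b bm; apply: contrapT => /mle.
by rewrite leNgt bm.
Qed.

Lemma countable_bound A : countable A -> exists b, forall a, A a -> a < b.
Proof.
move=> cA; apply: contrapT => h; apply: omega1_uncountable.
have -> : [set: omega1] = \bigcup_(a in A) [set b | b <= a].
  apply/seteqP; split=> // b _; apply: contrapT => nb; apply: h; exists b => a Aa.
  by rewrite ltNge; apply/negP => ba; apply: nb; exists a.
by apply: bigcup_countable => // a _; exact: omega1_countable_below.
Qed.

Definition ozero : omega1 := least setT.

Lemma ozero_le a : ozero <= a.
Proof. exact: least_le. Qed.

Definition osucc a : omega1 := least [set c | a < c].

Lemma lt_osucc a : a < osucc a.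
Proof.
have [b bP] := countable_bound (countable1 a).
by apply: (@least_in [set c | a < c] b); exact: bP.
Qed.

Lemma le_osucc a : a <= osucc a.
Proof. exact/ltW/lt_osucc. Qed.

Lemma osucc_le a c : (osucc a <= c) = (a < c).
Proof.
apply/idP/idP; last exact: least_le.
exact: lt_le_trans (lt_osucc a).
Qed.

Lemma lt_osuccE a c : (c < osucc a) = (c <= a).
Proof. by rewrite ltNge osucc_le -leNgt. Qed.

Lemma osucc_inj : injective osucc.
Proof.
move=> a b ab; apply: le_anti; rewrite -!lt_osuccE.
by rewrite -{1}ab lt_osucc ab lt_osucc.
Qed.

Lemma limit_osucc a b : limit_ordinal a -> b < a -> osucc b < a.
Proof. by move=> [_ h] /h[c bc ca]; apply: le_lt_trans ca; rewrite osucc_le. Qed.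

Lemma nonlimit_osucc a : ~ limit_ordinal (osucc a).
Proof. by move=> /limit_osucc/(_ (lt_osucc a)); rewrite ltxx. Qed.

Lemma nonlimit_ozero : ~ limit_ordinal ozero.
Proof. by move=> [[b]]; rewrite ltNge ozero_le. Qed.

Lemma nonlimitP s : ~ limit_ordinal s -> s = ozero \/ exists e, s = osucc e.
Proof.
move=> ns; have [sz|sz] := leP s ozero.
  by left; apply: le_anti; rewrite sz ozero_le.
right; apply: contrapT => h; apply: ns; split; first by exists ozero.
move=> b bs; exists (osucc b); first exact: lt_osucc.
by rewrite lt_neqAle osucc_le bs andbT; apply/eqP => sb; apply: h; exists b.
Qed.

Lemma nbhs_omega1P a (P : set omega1) : nbhs a P <->
  exists s, [/\ ~ limit_ordinal s, s <= a & forall c, s <= c -> c <= a -> P c].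
Proof.
split.
  rewrite itv_nbhsE => -[[l r] /= [io ai] iP].
  have mem s : (forall c, s <= c -> (l <= BLeft c)%O) -> forall c, s <= c -> c <= a -> P c.
    move=> h c sc ca; apply: iP => /=; rewrite itv_boundlr h//=.
    by move: ai; rewrite itv_boundlr => /andP[_]; apply: le_trans; rewrite bnd_simp.
  case: l io ai iP mem => [b t|b] io ai iP mem.
    have bE : b = false by case: b io {ai iP mem} => //; case: (r) => [[]|[]] ? [].
    move: mem; rewrite bE => mem.
    exists (osucc t); split; first exact: nonlimit_osucc.
      rewrite osucc_le; move: ai; rewrite bE itv_boundlr => /andP[].
      by rewrite bnd_simp.
    by apply: mem => c; rewrite osucc_le bnd_simp.
  have bE : b = true by case: b io {ai iP mem} => //; case: (r) => [[]|[]] ? [].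
  exists ozero; split; [exact: nonlimit_ozero | exact: ozero_le |].
  by apply: mem => c _; rewrite bE.
move=> [s [ns sa sP]].
have nb1 : nbhs a `]-oo, (osucc a)[%classic.
  apply: open_nbhs_nbhs; split; first exact: lray_open.
  by rewrite /= in_itv /= lt_osucc.
have [sz|[e se]] := nonlimitP ns.
  apply: filterS nb1 => c /=; rewrite in_itv /= lt_osuccE.
  by apply: sP; rewrite sz ozero_le.
have nb2 : nbhs a `]e, +oo[%classic.
  apply: open_nbhs_nbhs; split; first exact: rray_open.
  by rewrite /= in_itv /= andbT -osucc_le -se.
apply: filterS (filterI nb1 nb2) => c [/=]; rewrite !in_itv /= lt_osuccE andbT => ca ec.
by apply: sP => //; rewrite se osucc_le.
Qed.

(** Nonlimit points are isolated, so only limit points can violate closedness. *)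
Lemma closed_omega1P D : closed D <-> forall a, limit_ordinal a ->
  (forall s, s < a -> exists2 d, D d & s <= d <= a) -> D a.
Proof.
split=> [cD a la h|h].
  apply: cD => B /nbhs_omega1P[s [ns sa sP]].
  have [d Dd /andP[sd da]] : exists2 d, D d & s <= d <= a.
    apply: h; rewrite lt_neqAle sa andbT; apply/eqP => sE; by apply: ns; rewrite sE.
  by exists d; split => //; apply: sP.
move=> a cla; have [la|nla] := pselect (limit_ordinal a); last first.
  have [|d [Dd da]] := cla [set a].
    apply/nbhs_omega1P; exists a; split=> // c ac ca.
    by apply: le_anti; rewrite ac ca.
  by rewrite -da.
apply: h => // s sa.
have [|d [Dd /andP[sd da]]] := cla [set c | s <= c <= a].
  apply/nbhs_omega1P; exists (osucc s); split; first exact: nonlimit_osucc.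
    by rewrite osucc_le.
  by move=> c; rewrite osucc_le => /ltW sc ca /=; rewrite sc.
by exists d => //; rewrite sd.
Qed.

Lemma omega_sup (a : nat -> omega1) : (forall n, a n < a n.+1) ->
  exists s, [/\ limit_ordinal s, forall n, a n < s &
    forall b, b < s -> exists n, b < a n].
Proof.
move=> ai; have [b0 b0P] : exists b, forall n, a n < b.
  have [b bP] := @countable_bound (range a) (sub_countable (card_image_le _ _) (countableP _)).
  by exists b => n; apply: bP; exists n.
have [sP smin] := @leastP [set b | forall n, a n < b] (ex_intro _ b0 b0P).
set s := least _ in sP smin; exists s.
have sup b : b < s -> exists n, b < a n.
  move=> bs; apply: contrapT => h; suff : s <= b by rewrite leNgt bs.
  apply: smin => n /=; rewrite ltNge; apply/negP => ban; apply: h.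
  by exists n.+1; apply: le_lt_trans ban _.
split=> //; split; first by exists (a 0%N).
by move=> b /sup[n ban]; exists (a n).
Qed.

Lemma iterS_lt (g : omega1 -> omega1) a : (forall b, b < g b) ->
  forall n, iter n g a < iter n.+1 g a.
Proof. by move=> gb n; rewrite iterS. Qed.

Lemma club_closed_under (g : omega1 -> omega1) :
  club [set d | limit_ordinal d /\ forall b, b < d -> g b < d].
Proof.
split.
  apply/closed_omega1P => a la h; split=> // b ba.
  have [d [_ dg] /andP[bd da]] := h _ (limit_osucc la ba).
  apply: lt_le_trans da; apply: dg; by rewrite -osucc_le.
move=> a.
(* Initial segments are countable, so one ordinal [G b] dominates all values of [g] up to [b]. The
   supremum of the omega iterates of [G] is then closed under [g]. *)
have Gex b : exists c, b < c /\ forall e, e <= b -> g e < c.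
  have [|c cP] := @countable_bound ([set b] `|` (g @` [set e | e <= b])).
    rewrite -bigcup2E; apply: bigcup_countable => // -[|[|i]] _ //=.
    by apply: (sub_countable (card_image_le _ _)); exact: omega1_countable_below.
  exists c; split; first by apply: cP; left.
  by move=> e eb; apply: cP; right; exists e.
have [G GP] := choice Gex.
have [|s [ls as_ sup]] := @omega_sup (fun n => iter n G a).
  by apply: iterS_lt => b; have [] := GP b.
exists s; last exact: ltW (as_ 0%N).
split=> // b /sup[n bn]; apply: lt_trans (as_ n.+1); rewrite iterS.
by have [_] := GP (iter n G a); apply; exact: ltW.
Qed.

Lemma clubW D : club D -> closed D. Proof. by case. Qed.

Definition next D a : omega1 := least [set d | D d /\ a <= d].

Lemma nextP D a : club D ->
  [/\ D (next D a), a <= next D a & forall d, D d -> a <= d -> next D a <= d].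
Proof.
move=> [_ /(_ a)[d Dd ad]].
have [[? ?] m] := @leastP [set d | D d /\ a <= d] (ex_intro _ d (conj Dd ad)).
by split=> // e De ae; apply: m.
Qed.

(** An ordinal closed under passing to the next element of [D] and of [E] is a limit of both sets,
    hence in both. *)
Lemma clubI D E : club D -> club E -> club (D `&` E).
Proof.
move=> cD cE; split; first by apply: closedI; exact: clubW.
move=> a; have [_ /(_ a)] := club_closed_under (fun b => Order.max (next D (osucc b)) (next E (osucc b))).
move=> [d [ld dP] ad]; exists d => //.
have key F : club F -> (forall b, b < d -> next F (osucc b) < d) -> F d.
  move=> cF h; have /closed_omega1P := clubW cF; apply=> // s sd.
  have [Fn sn _] := nextP (osucc s) cF.
  exists (next F (osucc s)) => //; rewrite (ltW (h _ sd)) andbT.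
  exact: le_trans (le_osucc _) sn.
by split; apply: key => // b /dP; rewrite gt_max => /andP[].
Qed.

Lemma club_limit : club limit_ordinal.
Proof.
have := club_closed_under id; congr (club _); apply/seteqP.
by split=> [a []|a la].
Qed.

Lemma club_tail c : club [set a | c <= a].
Proof.
split.
  have -> : [set a | c <= a] = `[c, +oo[%classic.
    by apply/seteqP; split=> a; rewrite /= in_itv /= andbT.
  exact: rray_closed.
move=> a; exists (Order.max a c); rewrite /= ?le_max lexx ?orbT//.
Qed.

(* Initial segments of omega_1 are clopen, so continuity is only a condition from the
   left at limit ordinals. *)
Definition lcont (f : omega1 -> omega1) := forall a e, limit_ordinal a -> e < f a ->
  exists2 s, s < a & forall c, s <= c -> c <= a -> e < f c.

Section enumeration.
Variables (D : set omega1) (cD : club D).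

Definition lt_wf : well_founded (fun a b : omega1 => a < b).
Proof.
move=> a; elim/omega1_ind: a => a IH; constructor => b; exact: IH.
Defined.

(* [enumc] is the increasing enumeration of the club [D] and [denumc b] the least [a]
   with [b <= enumc a]. *)
Definition enum_step a (f : forall b, b < a -> omega1) : omega1 :=
  least [set d | D d /\ forall b (ba : b < a), f b ba < d].

Definition enumc : omega1 -> omega1 := Fix lt_wf (fun=> omega1) enum_step.

Lemma enumcE a : enumc a = least [set d | D d /\ forall b, b < a -> enumc b < d].
Proof.
rewrite /enumc Fix_eq //= => x f g fg; congr least; apply/seteqP.
by split=> d [Dd h]; split => // b ba; have := h b ba; rewrite fg.
Qed.

Lemma enumcP a : [/\ D (enumc a), forall b, b < a -> enumc b < enumc a &
  forall d, D d -> (forall b, b < a -> enumc b < d) -> enumc a <= d].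
Proof.
have [b bP] : exists b, forall c, (enumc @` [set b | b < a]) c -> c < b.
  apply: countable_bound; apply: (sub_countable (card_image_le _ _)).
  apply: sub_countable (omega1_countable_below a); apply: subset_card_le.
  by move=> c /= /ltW.
have [Dn bn _] := nextP b cD.
have [|[h1 h2] h3] := @leastP [set d | D d /\ forall b, b < a -> enumc b < d].
  exists (next D b); split=> // c ca; apply: lt_le_trans bn.
  by apply: bP; exists c.
rewrite enumcE; split=> // d Dd db; by apply: h3.
Qed.

Lemma enumc_mono : {mono enumc : a b / a <= b}.
Proof. by apply: le_mono => b a ba; have [_ + _] := enumcP a; apply. Qed.

Lemma enumc_lt : {mono enumc : a b / a < b}.
Proof. by apply: leW_mono; exact: enumc_mono. Qed.

Lemma enumc_ge a : a <= enumc a.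
Proof.
elim/omega1_ind: a => a IH; rewrite leNgt; apply/negP => h.
have := IH _ h; rewrite leNgt; by rewrite enumc_lt h.
Qed.

Lemma enumc_in a : D (enumc a). Proof. by have [] := enumcP a. Qed.

Definition denumc b : omega1 := least [set a | b <= enumc a].

Lemma denumcP b : b <= enumc (denumc b).
Proof. exact: (@least_in [set a | b <= enumc a] b (enumc_ge b)). Qed.

(** A Galois connection: left continuity, monotonicity and the inversion formulas for [denumc] are
    read off from it. *)
Lemma denumc_le a b : (denumc b <= a) = (b <= enumc a).
Proof.
apply/idP/idP; last by move=> ba; exact: least_le.
by rewrite -enumc_mono; apply: le_trans (denumcP b).
Qed.

Lemma enumcK : cancel enumc denumc.
Proof.
move=> a; apply: le_anti; rewrite denumc_le lexx /=.
by rewrite -enumc_mono denumcP.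
Qed.

Lemma denumcK b : D b -> enumc (denumc b) = b.
Proof.
move=> Db; apply: le_anti; rewrite denumcP andbT.
have [_ _ h] := enumcP (denumc b); apply: h => // c.
by rewrite !ltNge denumc_le.
Qed.

Lemma denumc_homo : {homo denumc : a b / a <= b}.
Proof. by move=> a b ab; rewrite denumc_le (le_trans ab)// denumcP. Qed.

(** If the values below [a] stayed under some [e < enumc a], their supremum would belong to the
    closed set [D] and be an earlier candidate for [enumc a]. *)
Lemma enumc_lcont : lcont enumc.
Proof.
move=> a e la ea; apply: contrapT => h.
have ub b : b < a -> enumc b < e.
  move=> ba; rewrite ltNge; apply/negP => eb; apply: h.
  exists (osucc b); first exact: limit_osucc.
  by move=> c; rewrite osucc_le => bc _; apply: le_lt_trans eb _; rewrite enumc_lt.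
have [s sP smin] := @omega1_min [set s | forall b, b < a -> enumc b < s] (ex_intro _ e ub).
suff Ds : D s.
  have [_ _ /(_ s Ds sP)] := enumcP a; rewrite leNgt.
  by rewrite (le_lt_trans _ ea)// smin.
have /closed_omega1P := clubW cD; apply.
  split; first by have [[b ba] _] := la; exists (enumc b); exact: sP.
  move=> b bs; apply: contrapT => nb; have : s <= b; last by rewrite leNgt bs.
  apply: smin => c ca /=; rewrite ltNge; apply/negP => bc.
  apply: nb; exists (enumc (osucc c)); last by apply: sP; exact: limit_osucc.
  by apply: le_lt_trans bc _; rewrite enumc_lt lt_osucc.
move=> b bs; apply: contrapT => nb; have : s <= b; last by rewrite leNgt bs.
apply: smin => c ca /=; rewrite ltNge; apply/negP => bc.
apply: nb; exists (enumc c); first exact: enumc_in.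
by rewrite bc /= ltW// sP.
Qed.

Lemma denumc_lcont : lcont denumc.
Proof.
move=> a e la; rewrite ltNge denumc_le -ltNge => ea.
exists (osucc (enumc e)); first exact: limit_osucc.
by move=> c; rewrite osucc_le => ec _; rewrite ltNge denumc_le -ltNge.
Qed.

End enumeration.

Lemma min_lcont b : lcont (fun a => Order.min a b).
Proof.
move=> a e la; rewrite lt_min => /andP[ea eb].
exists (osucc e); first exact: limit_osucc.
by move=> c; rewrite osucc_le => ec _; rewrite lt_min ec eb.
Qed.

(** Where [g a] is not a limit, left continuity of [f] says nothing; but there a monotone
    left-continuous [g] is constant just to the left of [a]. *)
Lemma comp_lcont f g : {homo f : a b / a <= b} -> lcont f ->
  {homo g : a b / a <= b} -> lcont g -> lcont (f \o g).
Proof.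
move=> fm fl gm gl a e la /= efg.
have [lga|nla] := pselect (limit_ordinal (g a)).
  have [s sga sP] := fl _ _ lga efg.
  have [s' s'a s'P] := gl _ _ la sga.
  exists s' => // c s'c ca; apply: sP; first by apply/ltW/s'P.
  exact: gm.
have [gz|[t ts]] := nonlimitP nla.
  have [[s sa] _] := la; exists s => // c _ ca; suff -> : g c = g a by [].
  by apply: le_anti; rewrite gm//= gz ozero_le.
have tg : t < g a by rewrite ts lt_osucc.
have [s sa sP] := gl _ _ la tg; exists s => // c sc ca.
suff -> : g c = g a by [].
by apply: le_anti; rewrite gm//= ts osucc_le sP.
Qed.

End order_omega1.

(** * Real-valued norms and bounded operators *)

Section scalar_norm.
Context (R : realType) (k : scalar_kind).
Local Notation K := (scalarField R k).

(* The modulus of a scalar, as an element of R. *)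
Definition kn (z : K) : R := rnorm (z : K^o).

Lemma ltr_ofReal (a b : R) : (ofReal k a < ofReal k b) = (a < b).
Proof. by case: k => //=; rewrite ltcR. Qed.

Lemma knE (z : K) : ofReal k (kn z) = `|z|.
Proof. exact: (@rnormE R k K^o). Qed.

Lemma kn_ge0 z : 0 <= kn z. Proof. exact: rnorm_ge0. Qed.

Lemma ofReal_inj : injective (@ofReal R k).
Proof. exact: (can_inj (@ofRealK R k)). Qed.

Lemma rnorm0 (V : normedModType K) : rnorm (0 : V) = 0.
Proof. by apply: ofReal_inj; rewrite rnormE normr0 ofReal0. Qed.

Lemma rnormN (V : normedModType K) (v : V) : rnorm (- v) = rnorm v.
Proof. by apply: ofReal_inj; rewrite !rnormE normrN. Qed.

Lemma kn0 : kn 0 = 0. Proof. exact: rnorm0. Qed.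

Lemma kn0_eq z : kn z = 0 -> z = 0.
Proof. exact: (@rnorm_eq0 R k K^o). Qed.

Lemma knN z : kn (- z) = kn z. Proof. exact: rnormN. Qed.

Lemma knD z w : kn (z + w) <= kn z + kn w.
Proof. exact: (@ler_rnormD R k K^o). Qed.

Lemma knB z w : kn (z - w) <= kn z + kn w.
Proof. by rewrite -(knN w) knD. Qed.

Lemma knC z w : kn (z - w) = kn (w - z).
Proof. by rewrite -knN opprB. Qed.

Lemma knM z w : kn (z * w) = kn z * kn w.
Proof. exact: (@rnormZ R k K^o). Qed.

Lemma ofReal1 : ofReal k (1 : R) = 1. Proof. by case: k. Qed.

Lemma kn_ofReal r : 0 <= r -> kn (ofReal k r) = r.
Proof.
move=> r0; apply: ofReal_inj; rewrite knE ger0_norm//.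
by rewrite -ofReal0 ler_ofReal.
Qed.

Lemma kn1 : kn 1 = 1.
Proof. by rewrite -ofReal1 kn_ofReal. Qed.

Lemma kn_gt0 z : z != 0 -> 0 < kn z.
Proof.
move=> z0; rewrite lt_neqAle kn_ge0 andbT eq_sym.
by apply: contra z0 => /eqP/kn0_eq ->.
Qed.

Lemma kn_le0_eq z : (forall e, 0 < e -> kn z <= e) -> z = 0.
Proof.
move=> h; apply/eqP; apply/negP => /negP /kn_gt0 z0.
have := h (kn z / 2); rewrite divr_gt0// => /(_ isT).
by rewrite leNgt ltr_pdivrMr// ltr_pMr// ltr1n.
Qed.

Lemma toReal_gt0 (e : K) : 0 < e -> 0 < toReal e.
Proof.
move=> e0; rewrite -ltr_ofReal toRealK ?ofReal0//; exact: ltW.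
Qed.

Lemma normK_lt (V : normedModType K) (v : V) (e : K) : 0 < e ->
  (`|v| < e) = (rnorm v < toReal e).
Proof. by move=> e0; rewrite -rnormE -{1}(toRealK (ltW e0)) ltr_ofReal. Qed.

Section operator.
Context (X Y : normedModType K).

Section linear.
Variables (T : X -> Y) (Tl : linear T).
Let TL : {linear X -> Y} := HB.pack T (GRing.isLinear.Build _ _ _ _ T Tl).
Lemma lin0 : T 0 = 0. Proof. exact: (raddf0 TL). Qed.
Lemma linB x y : T (x - y) = T x - T y. Proof. exact: (raddfB TL). Qed.
Lemma linZ a x : T (a *: x) = a *: T x. Proof. by have := Tl a x 0; rewrite !addr0 lin0 addr0. Qed.
Lemma lin_sum I (r : seq I) (P : pred I) F :
  T (\sum_(i <- r | P i) F i) = \sum_(i <- r | P i) T (F i).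
Proof. exact: (raddf_sum TL). Qed.
End linear.

Lemma bop_bound (T : X -> Y) : bounded_operator T ->
  exists2 M : R, 0 < M & forall x, rnorm (T x) <= M * rnorm x.
Proof.
(* The given bound is a scalar, possibly complex, so its modulus is taken; adding 1 makes it
   positive, so that later proofs can divide by it. *)
move=> [_ [M h]]; exists (kn M + 1) => [|x]; first by rewrite ltr_wpDl ?kn_ge0.
apply: (@le_trans _ _ (kn M * rnorm x)); last by rewrite ler_wpM2r ?rnorm_ge0 ?lerDl.
rewrite -(@ler_ofReal R k) ofRealM knE !rnormE -(normr_id x) -normrM.
have := h x; have [->|x0] := eqVneq `|x| 0; first by rewrite !mulr0 normr0.
move=> hx; rewrite ger0_norm//; exact: le_trans hx.
Qed.

Lemma bop_mk (T : X -> Y) (M : R) : linear T ->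
  (forall x, rnorm (T x) <= M * rnorm x) -> bounded_operator T.
Proof.
move=> Tl h; split=> //; exists (ofReal k M) => x.
by rewrite -!rnormE -ofRealM ler_ofReal.
Qed.

Lemma bop_linear (T : X -> Y) : bounded_operator T -> linear T. Proof. by case. Qed.
End operator.

Lemma bop_comp (X Y Z : normedModType K) (S : Y -> Z) (T : X -> Y) :
  bounded_operator S -> bounded_operator T -> bounded_operator (S \o T).
Proof.
move=> bS bT; have [M M0 hM] := bop_bound bS; have [N N0 hN] := bop_bound bT.
apply: (@bop_mk _ _ _ (M * N)) => [a u v /=|x /=].
  by rewrite (bop_linear bT) (bop_linear bS).
by rewrite -mulrA; apply: le_trans (hM _) _; rewrite ler_wpM2l// ltW.
Qed.

Lemma bop_id (X : normedModType K) : bounded_operator (@idfun X).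
Proof. by apply: (@bop_mk _ _ _ 1) => // x; rewrite mul1r. Qed.

Lemma bop0 (X Y : normedModType K) : bounded_operator (0 : X -> Y).
Proof.
apply: (@bop_mk _ _ _ 0) => [a u v|x]; first by rewrite scaler0 addr0.
by rewrite mul0r rnorm0.
Qed.

Lemma bop_lin (X Y : normedModType K) a (S T : X -> Y) :
  bounded_operator S -> bounded_operator T -> bounded_operator (a *: S + T).
Proof.
move=> bS bT; have [M M0 hM] := bop_bound bS; have [N N0 hN] := bop_bound bT.
apply: (@bop_mk _ _ _ (kn a * M + N)) => [b u v|x].
  change (a *: S (b *: u + v) + T (b *: u + v) =
    b *: (a *: S u + T u) + (a *: S v + T v)).
  rewrite (bop_linear bS) (bop_linear bT) !scalerDr !scalerA [b * a]mulrC.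
  by rewrite addrACA.
rewrite mulrDl; apply: le_trans (ler_rnormD _ _) (lerD _ (hN x)).
by rewrite rnormZ -mulrA ler_wpM2l// rnorm_ge0.
Qed.

End scalar_norm.

(** * The p-variation *)

Section variation.
Context (R : realType) (k : scalar_kind) (p : R) (p1 : 1 < p).
Local Notation K := (scalarField R k).
Local Notation J := (long_james k p1).
Implicit Types (f g : omega1 -> K) (a b : omega1) (s : seq omega1).

Lemma p_gt0 : 0 < p. Proof. exact: lt_trans p1. Qed.

Lemma p_neq0 : p != 0. Proof. by rewrite gt_eqF ?p_gt0. Qed.

Lemma powp0 : 0 `^ p = 0 :> R. Proof. by rewrite powR0// p_neq0. Qed.

Lemma powp_le (u v : R) : 0 <= u -> u <= v -> u `^ p <= v `^ p.
Proof.
move=> u0 uv; rewrite ge0_ler_powR ?nnegrE ?(ltW p_gt0)//; exact: le_trans uv.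
Qed.

Lemma powp_le_inv (u v : R) : 0 <= u -> 0 <= v -> u `^ p <= v `^ p -> u <= v.
Proof.
move=> u0 v0; apply: contra_le => vu.
by rewrite gt0_ltr_powR ?nnegrE ?p_gt0.
Qed.

Definition c2 : R := 2 `^ p.

Lemma c2_ge1 : 1 <= c2.
Proof. by rewrite -(powRr0 2) ler_powR ?ler1n// ltW// p_gt0. Qed.

Lemma c2_gt0 : 0 < c2. Proof. exact: lt_le_trans c2_ge1. Qed.

Lemma powpD (u v : R) : 0 <= u -> 0 <= v ->
  (u + v) `^ p <= c2 * (u `^ p + v `^ p).
Proof.
wlog uv : u v / u <= v => [h u0 v0|u0 v0].
  have [uv|/ltW vu] := leP u v; first exact: h.
  by rewrite addrC [u `^ _ + _]addrC h.
apply: (@le_trans _ _ ((2 * v) `^ p)).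
  by apply: powp_le; [exact: addr_ge0 | rewrite mulrDl mul1r lerD].
by rewrite powRM// ler_wpM2l ?powR_ge0// lerDr powR_ge0.
Qed.

Definition jmp f a b : R := kn (f b - f a) `^ p.

Lemma jmp_ge0 f a b : 0 <= jmp f a b. Proof. exact: powR_ge0. Qed.

(** Variation along lists instead of indexed chains makes concatenation, images under monotone maps
    and induction direct. *)
Fixpoint vfrom f a s : R := if s is b :: s' then jmp f a b + vfrom f b s' else 0.
Definition vsum f s : R := if s is a :: s' then vfrom f a s' else 0.

Lemma vfrom_ge0 f a s : 0 <= vfrom f a s.
Proof. by elim: s a => //= b s IH a; rewrite addr_ge0 ?jmp_ge0. Qed.

Lemma vsum_ge0 f s : 0 <= vsum f s.
Proof. by case: s => //= a s; exact: vfrom_ge0. Qed.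

Lemma vsum_cat f s t : vsum f s + vsum f t <= vsum f (s ++ t).
Proof.
case: s => [|a s] /=; first by rewrite add0r.
elim: s a => [|b s IH] a /=; last by rewrite -addrA lerD2l IH.
case: t => [|b t] /=; first by rewrite addr0.
by rewrite add0r lerDr jmp_ge0.
Qed.

Lemma vsum_flatten f (ss : seq (seq omega1)) :
  \sum_(s <- ss) vsum f s <= vsum f (flatten ss).
Proof.
elim: ss => [|s ss IH]; rewrite ?big_nil//= big_cons.
by apply: le_trans (vsum_cat _ _ _); rewrite lerD2l.
Qed.

Lemma vsum_map f (t : omega1 -> omega1) s : vsum (f \o t) s = vsum f (map t s).
Proof.
case: s => //= a s; elim: s a => //= b s IH a; by rewrite IH.
Qed.

(** Used with a single [fi] to compare two functions with the same jumps on a list, and with several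
    for sums and block decompositions. *)
Lemma vsum_comb (I : Type) (F : seq I) (fi : I -> omega1 -> K) f (C : R) s :
  (forall a b, a \in s -> b \in s -> jmp f a b <= C * \sum_(i <- F) jmp (fi i) a b) ->
  vsum f s <= C * \sum_(i <- F) vsum (fi i) s.
Proof.
case: s => [|a s] /=; first by rewrite big1 ?mulr0.
elim: s a => [|b s IH] a h /=; first by rewrite big1 ?mulr0.
rewrite big_split mulrDr lerD//; first by apply: h; rewrite !inE eqxx ?orbT.
by apply: IH => c d cs ds; apply: h; rewrite inE ?cs ?ds orbT.
Qed.

(* Repetitions in [s] contribute jumps equal to 0, so nondecreasing lists give the same
   supremum as the increasing chains of [Defs.variation]. *)
Definition bvar f (M : R) := forall s, sorted <=%O s -> vsum f s <= M.

Lemma bvar_ge0 f M : bvar f M -> 0 <= M.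
Proof. by move=> /(_ [::]); apply. Qed.

Lemma bvar_le f M N : M <= N -> bvar f M -> bvar f N.
Proof. by move=> MN h s ss; apply: le_trans MN; apply: h. Qed.

Lemma bvar_comp f (t : omega1 -> omega1) M : {homo t : a b / (a <= b)%O} ->
  bvar f M -> bvar (f \o t) M.
Proof.
move=> tm h s ss; rewrite vsum_map; apply: h.
exact: (homo_sorted tm).
Qed.

Lemma bvar_flatten f M (ss : seq (seq omega1)) : bvar f M ->
  sorted <=%O (flatten ss) -> \sum_(s <- ss) vsum f s <= M.
Proof. by move=> h /h; apply: le_trans; exact: vsum_flatten. Qed.

Lemma bvarD f g M N : bvar f M -> bvar g N ->
  bvar (fun a => f a + g a) (c2 * (M + N)).
Proof.
move=> hf hg s ss; pose fi (b : bool) := if b then f else g.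
apply: (@le_trans _ _ (c2 * \sum_(i <- [:: true; false]) vsum (fi i) s)).
  apply: vsum_comb => a b _ _; rewrite big_cons big_seq1 /= /jmp.
  rewrite opprD addrACA; apply: le_trans (powpD (kn_ge0 _) (kn_ge0 _)).
  by apply: powp_le; [exact: kn_ge0 | exact: knD].
rewrite big_cons big_seq1 /= ler_wpM2l ?(ltW c2_gt0)// lerD//; [exact: hf|exact: hg].
Qed.

Lemma bvarZ f M (z : K) : bvar f M -> bvar (fun a => z * f a) (kn z `^ p * M).
Proof.
move=> h s ss; apply: (@le_trans _ _ (kn z `^ p * \sum_(i <- [:: tt]) vsum f s)).
  apply: vsum_comb => a b _ _; rewrite big_seq1 /jmp -mulrBr knM.
  by rewrite powRM ?kn_ge0.
by rewrite big_seq1 ler_wpM2l ?powR_ge0// h.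
Qed.

Lemma bvar_cst (z : K) : bvar (fun=> z) 0.
Proof.
case=> //= a s _; elim: s a => //= b s IH a.
by rewrite /jmp subrr kn0 powp0 add0r IH.
Qed.

Lemma bvar_ext f g M : f =1 g -> bvar f M -> bvar g M.
Proof. by move=> /funext ->. Qed.

Lemma vfrom_strict f a s : path <=%O a s ->
  exists2 t, path <%O a t & vfrom f a t = vfrom f a s.
Proof.
elim: s a => [|b s IH] a /=; first by exists [::].
move=> /andP[ab /IH[t tb tE]]; have [ab'|nab] := eqVneq a b.
  by exists t; rewrite ab'// /jmp subrr kn0 powp0 add0r.
exists (b :: t) => /=; last by rewrite tE.
by rewrite tb andbT lt_neqAle nab.
Qed.

Lemma vfrom_nth f a s : vfrom f a s =
  \sum_(0 <= j < size s) jmp f (nth a (a :: s) j) (nth a (a :: s) j.+1).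
Proof.
elim: s a => [|b s IH] a; first by rewrite big_geq.
rewrite [size _]/= big_nat_recl//= IH; congr (_ + _).
rewrite !big_nat; apply: eq_bigr => j /= js.
by rewrite (set_nth_default a b) ?ltnS 1?ltnW// [nth b s j](set_nth_default a b).
Qed.

Lemma variation_ge f s : sorted <=%O s -> ((vsum f s)%:E <= Defs.variation p f)%E.
Proof.
case: s => [_|a s /= /(vfrom_strict f)[t ta <-]]; apply: ereal_sup_ubound.
  have [a _] := omega1_inhabited.
  by exists (0%N, fun=> a) => //=; rewrite big_geq.
exists (size t, fun j => nth a (a :: t) j) => /=; last by rewrite vfrom_nth.
by move=> j /= jt; move/pathP : ta; apply.
Qed.

Lemma variation_le f M : bvar f M -> (Defs.variation p f <= M%:E)%E.
Proof.
move=> h; apply: ge_ereal_sup => _ [[n a] /= ca <-]; rewrite lee_fin.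
have ss : sorted <=%O (map a (iota 0 n.+1)).
  apply/(sortedP (a 0%N)) => j; rewrite size_map size_iota => jn.
  rewrite !(nth_map 0%N) ?size_iota ?(ltnW jn)// !nth_iota ?(ltnW jn)//.
  exact/ltW/ca.
apply: le_trans (h _ ss); rewrite /vsum [iota _ _]/= map_cons -/(iota _ _) vfrom_nth.
rewrite size_map size_iota le_eqVlt; apply/orP; left; apply/eqP.
rewrite !big_nat; apply: eq_bigr => j /= jn; rewrite /jmp.
have E i : (i <= n)%N -> nth (a 0%N) (a 0%N :: map a (iota 1 n)) i = a i.
  case: i => // i iN /=; by rewrite (nth_map 0%N) ?size_iota// nth_iota.
by rewrite (E j) ?(ltnW jn)// -(E j.+1).
Qed.

Lemma lj_predP (x : J) : [/\ continuous x, x @ near_omega1 --> (0 : K) &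
                   (Defs.variation p x < +oo)%E].
Proof. by case: x => x /= /[!inE]. Qed.

Lemma variation_ge0 f : (0 <= Defs.variation p f)%E.
Proof. exact: (variation_ge f (s := [::])). Qed.

Lemma rnorm_ljE (x : J) : rnorm x `^ p = fine (Defs.variation p x).
Proof.
have [_ _ xoo] := lj_predP x.
have -> : rnorm x = fine (Defs.variation p x) `^ p^-1.
  by rewrite /rnorm; exact: (@ofRealK R k).
by rewrite -powRrM mulVf ?p_neq0// powRr1// fine_ge0// variation_ge0.
Qed.

Lemma bvar_norm (x : J) : bvar x (rnorm x `^ p).
Proof.
move=> s ss; rewrite rnorm_ljE -lee_fin fineK; first exact: variation_ge.
have [_ _ xoo] := lj_predP x.
by rewrite ge0_fin_numE ?variation_ge0.
Qed.

Lemma norm_bvar (x : J) M : bvar x M -> rnorm x `^ p <= M.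
Proof.
move=> /variation_le h; rewrite rnorm_ljE -lee_fin fineK//.
by rewrite ge0_fin_numE ?variation_ge0// (le_lt_trans h)// ltry.
Qed.

Lemma norm_le (x : J) M : 0 <= M -> bvar x (M `^ p) -> rnorm x <= M.
Proof.
by move=> M0 /norm_bvar h; apply: powp_le_inv => //; exact: rnorm_ge0.
Qed.

(** The supremum need not be attained; the factor 2 buys a single list that witnesses the norm. If
    none did, half the norm power would bound the variation, so the norm would be 0 and the empty
    list would do. *)
Lemma near_max (x : J) : exists2 s, sorted <=%O s & rnorm x `^ p <= 2 * vsum x s.
Proof.
apply: contrapT => h.
have h' : bvar x (rnorm x `^ p / 2).
  move=> s ss; rewrite leNgt; apply/negP => hs; apply: h; exists s => //.
  by move: hs; rewrite ltr_pdivrMr// mulrC => /ltW.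
apply: h; exists [::] => //=; rewrite mulr0.
have := norm_bvar h'; rewrite ler_pdivlMr// mulr_natr mulr2n gerDl; exact.
Qed.

(** For each n the modulus of [x] is below 1/(n+1) from some ordinal on, and countably many ordinals
    are bounded: the limit at omega_1 is attained. *)
Lemma lj_zero (x : J) : exists a, forall b, (a <= b)%O -> x b = 0.
Proof.
have [_ xl _] := lj_predP x.
have h n : exists a, forall b, (a <= b)%O -> kn (x b) < n.+1%:R^-1.
  have e0 : 0 < ofReal k (n.+1%:R^-1 : R) by rewrite -ofReal0 ltr_ofReal.
  have : nbhs (0 : K) (ball (0 : K) (ofReal k (n.+1%:R^-1 : R))).
    exact: (@nbhsx_ballx K K^o 0 (ofReal k (n.+1%:R^-1 : R))).
  move=> /xl[a _ ha]; exists a => b /ha /=.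
  by rewrite /ball /= sub0r normrN -knE ltr_ofReal.
have [a aP] := choice h.
have [b bP] := countable_bound (sub_countable (card_image_le a setT) (countableP _)).
exists b => c bc; apply: kn_le0_eq => e e0.
have [n ne] : exists n, n.+1%:R^-1 < e.
  have [n] := @ltr_add_invr R 0 e e0; rewrite add0r => ne; by exists n.
apply: le_trans (ltW ne); apply/ltW/aP/(le_trans _ bc)/ltW/bP; by exists n.
Qed.

Lemma kn_diff_le (x : J) a b : kn (x b - x a) <= rnorm x.
Proof.
wlog ab : a b / (a <= b)%O => [h|].
  have [/h//|/ltW/h] := leP a b; by rewrite knC.
apply: powp_le_inv; [exact: kn_ge0|exact: rnorm_ge0|].
have := @bvar_norm x [:: a; b]; rewrite /= addr0 ab; exact.
Qed.

Lemma kn_le (x : J) a : kn (x a) <= rnorm x.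
Proof.
have [b bP] := lj_zero x; have := @kn_diff_le x a b.
by rewrite (bP b)// sub0r knN.
Qed.

(* See [lcont]. *)
Definition leftcont f := forall a, limit_ordinal a -> forall e : R, 0 < e ->
  exists2 s, (s < a)%O & forall c, (s <= c)%O -> (c <= a)%O -> kn (f c - f a) <= e.

Lemma lj_leftcont (x : J) : leftcont x.
Proof.
move=> a la e e0; have [xc _ _] := lj_predP x.
have e0' : 0 < ofReal k e by rewrite -ofReal0 ltr_ofReal.
have : nbhs (x a : K) (ball (x a : K) (ofReal k e)).
  exact: (@nbhsx_ballx K K^o (x a) (ofReal k e)).
move=> /(xc a) /nbhs_omega1P[s [ns sa sP]]; exists s.
  by rewrite lt_neqAle sa andbT; apply/eqP => sE; apply: ns; rewrite sE.
move=> c sc ca; have := sP c sc ca.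
by rewrite /= /ball /= -knE ltr_ofReal knC => /ltW.
Qed.

Lemma leftcont_continuous f : leftcont f -> continuous f.
Proof.
move=> h a; apply/(@cvgrPdist_lt K K^o _ (nbhs a) _ f (f a)) => e e0.
have [la|nla] := pselect (limit_ordinal a); last first.
  apply/nbhs_omega1P; exists a; split=> // c ac ca.
  suff -> : c = a by rewrite subrr normr0.
  by apply: le_anti; rewrite ac ca.
have t0 := toReal_gt0 e0.
have [|s sa sP] := h a la (toReal e / 2); first by rewrite divr_gt0.
apply/nbhs_omega1P; exists (osucc s); split; first exact: nonlimit_osucc.
  by rewrite osucc_le.
move=> c; rewrite osucc_le => /ltW sc ca; rewrite -knE -(toRealK (ltW e0)) ltr_ofReal.
rewrite knC; apply: le_lt_trans (sP c sc ca) _.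
by rewrite ltr_pdivrMr// ltr_pMr// ltr1n.
Qed.

Lemma in_lj f M : leftcont f -> (exists a, forall b, (a <= b)%O -> f b = 0) ->
  bvar f M -> f \in long_james_pred p1.
Proof.
move=> /leftcont_continuous fc [a fz] fv; rewrite inE; split=> //.
  by apply: cvg_near_cst; exists a.
by apply: le_lt_trans (variation_le fv) (ltry _).
Qed.

Lemma leftcont_comp f (t : omega1 -> omega1) : {homo t : a b / (a <= b)%O} ->
  lcont t -> leftcont f -> leftcont (f \o t).
Proof.
move=> tm tl fc a la e e0 /=.
have triv : (exists2 s, (s < a)%O & forall c, (s <= c)%O -> (c <= a)%O -> t c = t a) ->
  exists2 s, (s < a)%O & forall c, (s <= c)%O -> (c <= a)%O -> kn (f (t c) - f (t a)) <= e.
  move=> [s sa sP]; exists s => // c sc ca; rewrite (sP c)// subrr kn0; exact: ltW.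
have [lta|/nonlimitP[tz|[u tu]]] := pselect (limit_ordinal (t a)).
- have [s sa sP] := fc _ lta e e0; have [s' s'a s'P] := tl _ _ la sa.
  exists s' => // c s'c ca; apply: sP; last exact: tm.
  exact/ltW/s'P.
- apply: triv; have [[s sa] _] := la; exists s => // c _ ca.
  by apply: le_anti; rewrite tm// tz ozero_le.
- apply: triv; have [|s sa sP] := tl a u la; first by rewrite tu lt_osucc.
  by exists s => // c sc ca; apply: le_anti; rewrite tm//= tu osucc_le sP.
Qed.

Lemma leftcontD f g : leftcont f -> leftcont g -> leftcont (fun a => f a + g a).
Proof.
move=> fc gc a la e e0; have e20 : 0 < e / 2 by rewrite divr_gt0.
have [s sa sP] := fc a la _ e20; have [t ta tP] := gc a la _ e20.
exists (Order.max s t); first by rewrite gt_max sa.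
move=> c; rewrite ge_max => /andP[sc tc] ca; rewrite opprD addrACA (splitr e).
by apply: le_trans (knD _ _) _; rewrite lerD ?sP ?tP.
Qed.

Lemma leftcontZ f (z : K) : leftcont f -> leftcont (fun a => z * f a).
Proof.
move=> fc a la e e0; have z0 : 0 < kn z + 1 by rewrite ltr_wpDl ?kn_ge0.
have [|s sa sP] := fc a la (e / (kn z + 1)); first by rewrite divr_gt0.
exists s => // c sc ca; rewrite -mulrBr knM.
apply: le_trans (_ : (kn z + 1) * (e / (kn z + 1)) <= e).
  by apply: ler_pM; rewrite ?kn_ge0 ?lerDl ?sP.
by rewrite mulrC divfK// gt_eqF.
Qed.

Lemma leftcont_cst (z : K) : leftcont (fun=> z).
Proof.
move=> a [[s sa] _] e e0; exists s => // c _ _; rewrite subrr kn0; exact: ltW.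
Qed.

(* At [a] at most one [fi i] is non-zero, and [f a] is its value. *)
Definition blk (I : eqType) (F : seq I) (fi : I -> omega1 -> K) f a :=
  (f a = 0 /\ forall i, i \in F -> fi i a = 0) \/
  exists i0, [/\ i0 \in F, f a = fi i0 a & forall i, i \in F -> i != i0 -> fi i a = 0].

(** The only delicate case has [a] in block i and [b] in another block j. Since block i vanishes at
    [b] and block j at [a], both values are themselves jumps of their blocks, and [powpD] separates
    them. *)
Lemma blk_jmp (I : eqType) (F : seq I) (fi : I -> omega1 -> K) f a b : uniq F ->
  blk F fi f a -> blk F fi f b -> jmp f a b <= c2 * \sum_(i <- F) jmp (fi i) a b.
Proof.
move=> uF ba bb.
have S0 : 0 <= \sum_(i <- F) jmp (fi i) a b.
  by apply: sumr_ge0 => i _; exact: jmp_ge0.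
have one i : i \in F -> jmp f a b = jmp (fi i) a b ->
    jmp f a b <= c2 * \sum_(i <- F) jmp (fi i) a b.
  move=> iF ->; apply: (@le_trans _ _ (\sum_(i <- F) jmp (fi i) a b)).
    rewrite (bigD1_seq i)//= lerDl sumr_ge0// => j _; exact: jmp_ge0.
  by rewrite ler_peMl// c2_ge1.
case: ba bb => [[fa0 fia]|[i [iF fai fia]]] [[fb0 fib]|[j [jF fbj fjb]]].
- by rewrite {1}/jmp fa0 fb0 subrr kn0 powp0 mulr_ge0// ltW// c2_gt0.
- by apply: (one j jF); rewrite /jmp fa0 fbj fia.
- by apply: (one i iF); rewrite /jmp fb0 fai fib.
- have [ij|ij] := eqVneq i j; first by apply: (one i iF); rewrite /jmp fai fbj ij.
  rewrite {1}/jmp fai fbj; apply: le_trans (_ : c2 * (kn (fi j b) `^ p + kn (fi i a) `^ p) <= _).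
    apply: le_trans (powpD (kn_ge0 _) (kn_ge0 _)); apply: powp_le; [exact: kn_ge0|exact: knB].
  rewrite ler_wpM2l ?(ltW c2_gt0)// (bigD1_seq j)//=.
  rewrite {1}/jmp (fia j)// 1?eq_sym// subr0 lerD2l.
  rewrite big_mkcond (bigD1_seq i)//= ij {1}/jmp (fjb i)// sub0r knN lerDl.
  by apply: sumr_ge0 => l _; case: ifP => // _; exact: jmp_ge0.
Qed.

Lemma blk_vsum (I : eqType) (F : seq I) (fi : I -> omega1 -> K) f s : uniq F ->
  (forall a, a \in s -> blk F fi f a) ->
  vsum f s <= c2 * \sum_(i <- F) vsum (fi i) s.
Proof. by move=> uF h; apply: vsum_comb => a b /h ha /h hb; exact: blk_jmp. Qed.

Lemma blk_bvar (I : eqType) (F : seq I) (fi : I -> omega1 -> K) f (M : I -> R) : uniq F ->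
  (forall a, blk F fi f a) -> (forall i, i \in F -> bvar (fi i) (M i)) ->
  bvar f (c2 * \sum_(i <- F) M i).
Proof.
move=> uF h hM s ss; apply: le_trans (blk_vsum uF (fun a _ => h a)) _.
rewrite ler_wpM2l ?(ltW c2_gt0)// big_seq [leRHS]big_seq ler_sum// => i iF.
exact: hM.
Qed.

Lemma indE a b : initial_indicator k p1 b a = if (a <= b)%O then 1 else 0.
Proof.
rewrite /= indicE; case: ifPn => h; first by rewrite mem_set.
by rewrite memNset//; apply/negP.
Qed.

Lemma bvar_ind b : bvar (initial_indicator k p1 b) 1.
Proof.
set f : omega1 -> K := initial_indicator k p1 b.
have fE a : f a = if (a <= b)%O then 1 else 0 by exact: indE.
case=> //= a s; elim: s a => //= c s IH a /andP[ac cs]; rewrite /jmp !fE.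
have zero d t : path <=%O d t -> (b < d)%O -> vfrom f d t = 0.
  elim: t d => //= e t IHt d /andP[de et] bd.
  have be := lt_le_trans bd de.
  by rewrite IHt// addr0 /jmp !fE !leNgt bd be subrr kn0 powp0.
case: (leP c b) => cb.
  by rewrite (le_trans ac cb) subrr kn0 powp0 add0r IH.
rewrite zero// addr0; case: ifP => _; rewrite ?sub0r ?subr0 ?knN ?kn1 ?powR1//.
by rewrite kn0 powp0.
Qed.

Lemma ind_norm b : rnorm (initial_indicator k p1 b : J) <= 1.
Proof. by apply: norm_le => //; rewrite powR1; exact: bvar_ind. Qed.

End variation.

(** * Density of the step functions *)

Section density.
Context (R : realType) (k : scalar_kind) (p : R) (p1 : 1 < p).
Local Notation K := (scalarField R k).
Local Notation J := (long_james k p1).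
Local Notation ind := (initial_indicator k p1).
Implicit Types (f g : omega1 -> K) (a b : omega1) (s : seq omega1).

Lemma closure_rnormP (V : normedModType K) (A : set V) x :
  closure A x <-> forall e : R, 0 < e -> exists2 y, A y & rnorm (x - y) <= e.
Proof.
split=> [clA e e0|h B /nbhs_ballP[e /= e0 eB]].
  have e0' : 0 < ofReal k e by rewrite -ofReal0 ltr_ofReal.
  have [y [Ay]] := clA _ (nbhsx_ballx x _ e0').
  by rewrite -ball_normE /= normK_lt// ofRealK => /ltW xy; exists y.
have t0 : 0 < toReal e / 2 by rewrite divr_gt0// toReal_gt0.
have [y Ay xy] := h _ t0; exists y; split=> //; apply: eB.
rewrite -ball_normE /= normK_lt//; apply: le_lt_trans xy _.
by rewrite ltr_pdivrMr// ltr_pMr ?ltr1n// toReal_gt0.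
Qed.

(** * Growth contradictions and eventual constancy *)

Lemma sorted_blocks (t : nat -> omega1) (S : nat -> seq omega1) m N :
  (forall n, sorted <=%O (S n)) ->
  (forall n c, c \in S n -> (t n <= c <= t n.+1)%O) -> (forall n, t n <= t n.+1)%O ->
  path <=%O (t m) (flatten [seq S n | n <- iota m N]).
Proof.
move=> Ss St tt; elim: N m => //= N IH m; rewrite cat_path; apply/andP; split.
  rewrite (path_sortedE le_trans) Ss andbT; apply/allP => c /St.
  by case/andP.
have lt : (last (t m) (S m) <= t m.+1)%O.
  have := mem_last (t m) (S m); rewrite inE => /orP[/eqP ->//|/St/andP[]//].
exact: (path_le le_trans lt).
Qed.

Lemma no_infinite_blocks f M (e : R) (t : nat -> omega1) (S : nat -> seq omega1) :
  bvar p f M -> 0 < e -> (forall n, sorted <=%O (S n)) ->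
  (forall n c, c \in S n -> (t n <= c <= t n.+1)%O) -> (forall n, t n <= t n.+1)%O ->
  ~ forall n, e <= vsum p f (S n).
Proof.
move=> fM e0 Ss St tt h.
have key N : N%:R * e <= M.
  apply: le_trans (_ : \sum_(s <- [seq S n | n <- iota 0 N]) vsum p f s <= _).
    rewrite big_map mulr_natl -[X in _ *+ X](size_iota 0 N) -sum1_size.
    rewrite -sumrMnr ler_sum// => n _; by rewrite mulr1n.
  by apply: (bvar_flatten fM); exact: (path_sorted (sorted_blocks 0 N Ss St tt)).
have := key (Num.bound (M / e)); rewrite leNgt => /negP; apply.
rewrite -ltr_pdivrMr//; apply: le_lt_trans (archi_boundP _); first by [].
by rewrite divr_ge0 ?(bvar_ge0 fM)// ltW.
Qed.

(** Dividing by n leaves n^(p-1) e^p <= C, which bounds n because p > 1. The left side comes from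
    adding n quantities of size e, the right side from the p-th power of the norm of n disjoint
    blocks. *)
Lemma power_absurd (e C : R) : 0 < e -> ~ forall n : nat, (n%:R * e) `^ p <= C * n%:R.
Proof.
move=> e0 h; pose q := p - 1; have q0 : 0 < q by rewrite subr_gt0.
have ep : 0 < e `^ p by rewrite powR_gt0.
have C0 : 0 <= C.
  by have := h 1%N; rewrite mulr1; apply: le_trans; exact: powR_ge0.
(* An n above A^(1/(p-1)) has n^(p-1) > A > C / e^p. *)
pose A := C / e `^ p + 1; have A0 : 0 < A by rewrite ltr_wpDl// divr_ge0// ltW.
pose n := Num.bound (A `^ q^-1).
have nA : A `^ q^-1 < n%:R by apply: archi_boundP; exact: powR_ge0.
have n0 : 0 < n%:R :> R by apply: le_lt_trans nA; exact: powR_ge0.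
have := h n; rewrite powRM ?(ltW n0) ?(ltW e0)// leNgt => /negP; apply.
have -> : n%:R `^ p = n%:R * n%:R `^ q :> R.
  rewrite -{2}(@powRr1 _ n%:R (ltW n0)) -powRD; first by rewrite /q addrC subrK.
  by rewrite (gt_eqF n0) implybT.
rewrite [C * _]mulrC -mulrA ltr_pM2l//.
rewrite -ltr_pdivrMr; last by rewrite powR_gt0.
apply: (@lt_trans _ _ A).
  by rewrite /A ltrDl.
have {1}-> : A = (A `^ q^-1) `^ q.
  by rewrite -powRrM mulVf ?lt0r_neq0// powRr1// ltW.
by rewrite gt0_ltr_powR ?nnegrE ?powR_ge0// ltW.
Qed.

Lemma phase (z : K) : exists2 c : K, kn c <= 1 & c * z = ofReal k (kn z).
Proof.
have [->|z0] := eqVneq z 0; first by exists 0; rewrite ?kn0// mul0r ofReal0.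
exists (`|z| / z); last by rewrite divfK// knE.
rewrite -(@ler_ofReal R k) knE normrM normfV normr_id divff ?ofReal1//.
by rewrite normr_eq0.
Qed.

(** The coefficients are phases turning each [F (u i)] into its modulus, so that the values add up
    without cancellation. *)
Lemma pairing (X : normedModType K) (F : X -> K^o) (M : R) (I : eqType) (u : I -> X)
    (r : seq I) (e : R) :
  linear F -> (forall x, rnorm (F x) <= M * rnorm x) ->
  (forall i, i \in r -> e <= kn (F (u i))) ->
  exists2 c : I -> K, (forall i, kn (c i) <= 1) &
    (size r)%:R * e <= M * rnorm (\sum_(i <- r) c i *: u i).
Proof.
move=> Fl FM h; have ph i : exists c : K, kn c <= 1 /\ c * F (u i) = ofReal k (kn (F (u i))).
  by have [c c1 cE] := phase (F (u i)); exists c.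
have [c cP] := choice ph.
exists c => [i|]; first by have [] := cP i.
apply: le_trans (FM _); rewrite (lin_sum Fl).
have -> : \sum_(i <- r) F (c i *: u i) = ofReal k (\sum_(i <- r) kn (F (u i))).
  elim: (r) => [|i s IH]; first by rewrite !big_nil ofReal0.
  rewrite !big_cons ofRealD IH; congr (_ + _).
  by rewrite (linZ Fl); have [_] := cP i.
have -> : rnorm (ofReal k (\sum_(i <- r) kn (F (u i))) : K^o) = \sum_(i <- r) kn (F (u i)).
  by apply: kn_ofReal; apply: sumr_ge0 => i _; exact: kn_ge0.
rewrite mulr_natl -[X in _ *+ X]sum1_size -sumrMnr big_seq [leRHS]big_seq.
by apply: ler_sum => i /h; rewrite mulr1n.
Qed.

(** If oscillations of size 1/(n+1) occurred beyond every ordinal, iterating a choice of them would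
    give the forbidden sequence. So every tolerance is met from some ordinal on, and these countably
    many ordinals have a common bound. *)
Lemma eventually_const g :
  (forall e, 0 < e -> ~ exists b b' : nat -> omega1, forall n,
     [/\ (b n <= b' n)%O, (b' n <= b n.+1)%O & e <= kn (g (b' n) - g (b n))]) ->
  exists a, forall b, (a <= b)%O -> g b = g a.
Proof.
move=> h; have H n : exists a, forall b b', (a <= b)%O -> (b <= b')%O ->
    kn (g b' - g b) <= n.+1%:R^-1.
  apply: contrapT => na; apply: (h (n.+1%:R^-1)); first by rewrite invr_gt0.
  have na' a : exists bb : omega1 * omega1, [/\ (a <= bb.1)%O, (bb.1 <= bb.2)%O &
      n.+1%:R^-1 <= kn (g bb.2 - g bb.1)].
    apply: contrapT => ha; apply: na; exists a => b b' ab bb'.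
    rewrite leNgt; apply/negP => /ltW hb; apply: ha; by exists (b, b').
  have [B BP] := choice na'; have [a0 _] := omega1_inhabited.
  pose a m := iter m (fun a => (B a).2) a0.
  exists (fun m => (B (a m)).1), (fun m => (B (a m)).2) => m.
  have [_ -> ->] := BP (a m); split=> //.
  by have [+ _ _] := BP (a m.+1); rewrite /a iterS.
have [a aP] := choice H.
have [b bP] := countable_bound (sub_countable (card_image_le a setT) (countableP _)).
exists b => c bc; apply/eqP; rewrite -subr_eq0; apply/eqP/kn_le0_eq => e e0.
have [n] := @ltr_add_invr R 0 e e0; rewrite add0r => /ltW; apply: le_trans.
by apply: aP => //; apply/ltW/bP; exists n.
Qed.

Lemma bvar_eventually_const f M : bvar p f M -> exists a, forall b, (a <= b)%O -> f b = f a.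
Proof.
move=> fM; apply: eventually_const => e e0 [b [b' bP]].
apply: (@no_infinite_blocks f M (e `^ p) b (fun n => [:: b n; b' n])) => //.
- by rewrite powR_gt0.
- by move=> n /=; have [-> _ _] := bP n.
- move=> n c; have [h1 h2 _] := bP n; rewrite !inE => /orP[] /eqP ->.
    by rewrite lexx (le_trans h1).
  by rewrite h1.
- by move=> n; have [h1 h2 _] := bP n; rewrite (le_trans h1).
- move=> n /=; have [_ _ h] := bP n; rewrite addr0 /jmp powp_le// ltW//.
Qed.

Lemma ev_bop a : @bounded_operator K J K^o (fun x : J => x a).
Proof. by apply: (@bop_mk _ _ _ _ _ 1) => // x; rewrite mul1r; exact: kn_le. Qed.

Lemma ljD (x y : J) a : (x + y) a = x a + y a. Proof. by []. Qed.
Lemma ljB (x y : J) a : (x - y) a = x a - y a. Proof. by []. Qed.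
Lemma ljZ c (x : J) a : (c *: x) a = c * x a. Proof. by []. Qed.

Lemma lj_sumE (I : Type) (r : seq I) (x : I -> J) a :
  (\sum_(i <- r) x i : J) a = \sum_(i <- r) x i a.
Proof. exact: (lin_sum (bop_linear (ev_bop a))). Qed.

Lemma lj_eqP (x y : J) : (forall a, x a = y a) -> x = y.
Proof. by move=> h; apply: val_inj; apply/funext. Qed.

Lemma blk_sum (I : eqType) (F : seq I) (fi : I -> omega1 -> K) f a : uniq F ->
  f a = \sum_(i <- F) fi i a ->
  (forall i j, fi i a <> 0 -> fi j a <> 0 -> i = j) -> blk F fi f a.
Proof.
move=> uF fE h; have [[i [iF fi0]]|nz] := pselect (exists i, i \in F /\ fi i a <> 0).
  have z j : j \in F -> j != i -> fi j a = 0.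
    by move=> jF /eqP ji; apply: contrapT => fj0; apply: ji; exact: h.
  right; exists i; split=> //; rewrite fE (bigD1_seq i)//= big_seq_cond big1 ?addr0//.
  by move=> j /andP[]; exact: z.
have z j : j \in F -> fi j a = 0.
  by move=> jF; apply: contrapT => fj0; apply: nz; exists j.
by left; split=> //; rewrite fE big_seq big1.
Qed.

(** Infinitely many jumps of size e would be values of [F] at the indicators of disjoint intervals;
    n of these, with phases, have norm of order n^(1/p), while [F] sums to at least n e. *)
Lemma functional_eventually_const (F : J -> K^o) : bounded_operator F ->
  exists a, forall b, (a <= b)%O -> F (ind b) = F (ind a).
Proof.
move=> bF; have Fl := bop_linear bF; have [M M0 FM] := bop_bound bF.
apply: (@eventually_const (fun b => F (ind b))) => e e0 [b [b' bP]].
have bb n : (b n <= b n.+1)%O by have [h1 h2 _] := bP n; exact: le_trans h2.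
have bmon : {homo b : i j / (i <= j)%N >-> (i <= j)%O}.
  exact: (homo_leq le_refl le_trans).
pose u n : J := ind (b' n) - ind (b n).
have uE n a : u n a = if (b n < a)%O && (a <= b' n)%O then 1 else 0.
  have [h1 _ _] := bP n; rewrite /u ljB !indE.
  case: (leP a (b n)) => h /=; first by rewrite (le_trans h h1) subrr.
  by case: ifP; rewrite subr0.
have uvar n : bvar p (u n) (c2 p * (1 + 1)).
  have h := bvarZ (- 1) (@bvar_ind R k p p1 (b n)).
  rewrite knN kn1 powR1 mul1r in h.
  by apply: (bvar_ext _ (bvarD p1 (bvar_ind k p1 (b' n)) h)) => a; rewrite mulN1r.
(* The inner [c2 p * 2] bounds the variation of one interval indicator, a difference of two initial
   ones; the outer [c2 p] is the cost of the block decomposition. *)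
apply: (@power_absurd e (M `^ p * (c2 p * (c2 p * 2)))) => // n.
have [|c c1 cP] := @pairing J F M nat u (iota 0 n) e Fl FM.
  by move=> i _; rewrite (linB Fl); have [] := bP i.
rewrite size_iota in cP; apply: (le_trans (powp_le p1 _ cP)).
  by rewrite mulr_ge0// ltW.
rewrite (powRM _ (ltW M0) (rnorm_ge0 _)) -!mulrA ler_wpM2l ?powR_ge0//.
apply: norm_bvar.
have -> : c2 p * (c2 p * (2 * n%:R)) = c2 p * \sum_(i <- iota 0 n) (c2 p * 2).
  rewrite big_const_seq count_predT size_iota iter_addr addr0; congr (_ * _).
  by rewrite mulrA mulr_natr.
apply: (blk_bvar p1 (fi := fun i a => c i * u i a)) => [|a|i _]; first exact: iota_uniq.
  apply: blk_sum; first exact: iota_uniq.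
    by rewrite lj_sumE.
  move=> i j; rewrite !uE.
  case: ifP => [/andP[ia ai] _|_]; last by rewrite mulr0.
  case: ifP => [/andP[ja aj] _|_]; last by rewrite mulr0.
  apply: contrapT => /eqP; rewrite neq_ltn => /orP[] ij.
    have [_ h _] := bP i; have := le_trans ai (le_trans h (bmon _ _ ij)).
    by rewrite leNgt ja.
  have [_ h _] := bP j; have := le_trans aj (le_trans h (bmon _ _ ij)).
  by rewrite leNgt ia.
apply: (bvar_le _ (bvarZ (c i) (uvar i))).
rewrite ler_piMl//; first by rewrite mulr_ge0// ltW// c2_gt0.
by have := powp_le p1 (kn_ge0 (c i)) (c1 i); rewrite powR1.
Qed.

(** * Truncations and the closed span of the indicators *)

Section cut.
Variables (b : omega1) (x : J).

Definition cutf a : K := if (a <= b)%O then x a else 0.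

Lemma cutfE a : cutf a = x (Order.min a b) + (x b * ind b a + - x b).
Proof.
rewrite indE /cutf; case: (leP a b) => ab; rewrite ?mulr1 ?subrr ?addr0//.
by rewrite mulr0 add0r subrr.
Qed.

Lemma min_homo : {homo (fun a => Order.min a b) : a c / (a <= c)%O}.
Proof. by move=> a c ac; rewrite le_min !ge_min ac lexx orbT. Qed.

Lemma cut_subproof : cutf \in long_james_pred p1.
Proof.
have E : cutf = (fun a => x (Order.min a b) + (x b * ind b a + - x b)).
  by apply/funext => a; exact: cutfE.
rewrite E; apply: in_lj.
- apply: leftcontD; first exact: (leftcont_comp min_homo (@min_lcont b) (@lj_leftcont _ _ _ _ x)).
  by apply: leftcontD; [apply/leftcontZ/lj_leftcont | exact: leftcont_cst].
- exists (osucc b) => c; rewrite osucc_le => bc; rewrite -cutfE /cutf.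
  by rewrite leNgt bc.
- apply: (bvarD p1); first exact: (bvar_comp min_homo (bvar_norm x)).
  apply: (bvarD p1); last exact: bvar_cst.
  have h := bvarZ (x b) (bvar_ind k p1 b); exact: h.
Qed.

Definition cut : J := LongJames cut_subproof.

Lemma cutE a : cut a = if (a <= b)%O then x a else 0. Proof. by []. Qed.

End cut.

Lemma cut_all (x : J) : exists b, cut b x = x.
Proof.
have [b bP] := lj_zero x; exists b; apply: lj_eqP => a; rewrite cutE.
by case: leP => // /ltW /bP.
Qed.

Lemma vfrom_cst f a b s : path <=%O a s -> (a = b) -> all (fun c => (c <= b)%O) s ->
  vfrom p f a s = 0.
Proof.
elim: s a => //= c s IH a /andP[ac cs] ab /andP[cb sb].
have cE : c = b by apply: le_anti; rewrite cb -ab.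
by rewrite (IH c)// /jmp ab cE subrr kn0 powp0 ?addr0.
Qed.

(** The entries equal to [b] are the last ones, so dropping them loses a single jump into [b], all
    later jumps being 0. *)
Lemma vsum_trim f (g : omega1) b (e : R) s : sorted <=%O s -> 0 <= e ->
  (forall c, c \in s -> (g <= c <= b)%O) ->
  (forall c, (g <= c)%O -> (c < b)%O -> jmp p f c b <= e) ->
  exists t, [/\ sorted <=%O t, forall c, c \in t -> (g <= c < b)%O &
     vsum p f s <= vsum p f t + e].
Proof.
move=> ss e0 sgb fb.
have key a u : path <=%O a u -> all (fun c => (c <= b)%O) u -> (a < b)%O -> (g <= a)%O ->
    exists t, [/\ path <=%O a t, all (fun c => (c < b)%O) t & vfrom p f a u <= vfrom p f a t + e].
  elim: u a => [|c u IH] a; first by move=> _ _ _ _; exists [::]; split; rewrite //= add0r.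
  move=> /= /andP[ac cu] /andP[cb ub] ab ga.
  have [cb'|bc] := ltP c b.
    have [t [ct tb tE]] := IH c cu ub cb' (le_trans ga ac).
    by exists (c :: t); split; rewrite /= ?ac ?cb'// -addrA lerD2l.
  have cE : c = b by apply: le_anti; rewrite cb.
  exists [::]; split=> //=.
  by rewrite (vfrom_cst _ cu cE ub) addr0 add0r cE fb.
case: s ss sgb => [_ _|a s /= pas sgb]; first by exists [::]; split; rewrite //= add0r.
have /andP[ga ab] : (g <= a <= b)%O by apply: sgb; rewrite mem_head.
have sb : all (fun c => (c <= b)%O) s.
  by apply/allP => c cs; have /andP[] : (g <= c <= b)%O by apply: sgb; rewrite inE cs orbT.
have [ab'|ba] := ltP a b.
  have [t [at_ tb tE]] := key _ _ pas sb ab' ga; exists (a :: t); split=> //.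
  move=> c; rewrite inE => /orP[/eqP ->|ct]; first by rewrite ga ab'.
  rewrite (allP tb)// andbT (le_trans ga)//.
  by move: at_; rewrite (path_sortedE le_trans) => /andP[/allP/(_ c ct)].
exists [::]; split=> //=; rewrite (vfrom_cst _ pas _ sb) ?add0r//.
by apply: le_anti; rewrite ab ba.
Qed.

(** Otherwise every final segment below [b] would carry a list of variation at least e/2, and
    starting each list where the previous one ended would give infinitely many blocks. The remaining
    jump into [b] is small by left continuity. *)
Lemma tail_small (x : J) b (e : R) (s0 : omega1) : limit_ordinal b -> 0 < e -> (s0 < b)%O ->
  exists g : omega1, [/\ (s0 <= g)%O, (g < b)%O &
    forall s, sorted <=%O s -> (forall c, c \in s -> (g <= c <= b)%O) -> vsum p x s <= e].
Proof.
move=> lb e0 s0b; have e20 : 0 < e / 2 by rewrite divr_gt0.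
have [g1 [s0g1 g1b g1P]] : exists g : omega1, [/\ (s0 <= g)%O, (g < b)%O & forall s, sorted <=%O s ->
    (forall c, c \in s -> (g <= c < b)%O) -> vsum p x s <= e / 2].
  apply: contrapT => h.
  have S_ex a : exists s, (s0 <= a < b)%O -> [/\ sorted <=%O s,
      (forall c, c \in s -> (a <= c < b)%O) & e / 2 <= vsum p x s].
    have [/andP[sa ab]|nab] := boolP (s0 <= a < b)%O; last by exists [::].
    apply: contrapT => hs; apply: h; exists a; split=> // s ss sP.
    by rewrite leNgt; apply/negP => /ltW hh; apply: hs; exists s.
  have [S SP] := choice S_ex.
  pose t n := iter n (fun a => last a (S a)) s0.
  have tP n : (s0 <= t n < b)%O.
    elim: n => [|n IH]; first by rewrite /= lexx.
    have [_ Sab _] := SP _ IH; rewrite /t iterS -/(t n).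
    have := mem_last (t n) (S (t n)); rewrite inE => /orP[/eqP ->//|/Sab/andP[h1 ->]].
    by rewrite andbT (le_trans _ h1)//; case/andP: IH.
  have last_ge n c : c \in S (t n) -> (t n <= c <= t n.+1)%O.
    move=> cS; have [Ss Sab _] := SP _ (tP n); have /andP[-> _] := Sab _ cS.
    rewrite /t iterS -/(t n) /=.
    suff h' : forall U v, sorted <=%O U -> c \in U -> (c <= last v U)%O by exact: h'.
    elim=> // u U IH v /= uU; rewrite inE => /orP[/eqP ->|cU].
      have := mem_last u U; rewrite inE => /orP[/eqP ->//|].
      by move: uU; rewrite (path_sortedE le_trans) => /andP[/allP + _]; apply.
    by apply: IH => //; exact: path_sorted uU.
  apply: (@no_infinite_blocks x _ (e / 2) t (S \o t) (bvar_norm x) e20).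
  - by move=> n; have [] := SP _ (tP n).
  - exact: last_ge.
  - move=> n; rewrite /t iterS -/(t n).
    have := mem_last (t n) (S (t n)); rewrite inE => /orP[/eqP ->//|].
    by move=> /last_ge/andP[].
  - by move=> n; have [] := SP _ (tP n).
have [|g2 g2b g2P] := @lj_leftcont _ _ _ _ x b lb ((e / 2) `^ p^-1); first by rewrite powR_gt0.
exists (Order.max g1 g2); split; [by rewrite le_max s0g1|by rewrite gt_max g1b|].
move=> s ss sP; have [||||t [ts tP tE]] := @vsum_trim x (Order.max g1 g2) b (e / 2) s => //.
- exact: ltW.
- move=> c; rewrite ge_max => /andP[_ g2c] cb.
  have -> : e / 2 = ((e / 2) `^ p^-1) `^ p.
    by rewrite -powRrM mulVf ?p_neq0// powRr1// ltW.
  by rewrite /jmp powp_le ?kn_ge0// knC g2P// ltW.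
apply: (le_trans tE); rewrite {2}(splitr e) lerD2r; apply: g1P => // c /tP.
by rewrite ge_max => /andP[/andP[-> _]].
Qed.

Lemma cut_limit (x : J) b (e : R) (s0 : omega1) : limit_ordinal b -> 0 < e -> (s0 < b)%O ->
  exists g : omega1, [/\ (s0 <= g)%O, (g < b)%O &
    rnorm (cut b x - (x b *: (ind b - ind g) + cut g x) : J) <= e].
Proof.
(* Two functions of variation at most [e'] have a sum of variation at most [c2 p * (e' + e')], which
   is e^p. *)
move=> lb e0 s0b; pose e' := e `^ p / (c2 p * 2).
have e'0 : 0 < e' by rewrite divr_gt0 ?powR_gt0// mulr_gt0 ?c2_gt0.
have [g [s0g gb gP]] := tail_small x lb e'0 s0b.
exists g; split=> //; apply: norm_le; first exact: ltW.
set h := osucc g; have hb : (h <= b)%O by rewrite osucc_le.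
(* The error is [x - x b] on the interval from [h] to [b] and 0 elsewhere. Clamping arguments into
   this interval gives the right values from [h] on; on the ordinals up to [g] it leaves the
   constant [x h - x b], removed by a multiple of [ind g]. *)
pose t a := Order.min (Order.max a h) b.
have tm : {homo t : a c / (a <= c)%O}.
  move=> a c ac; rewrite /t le_min !ge_min lexx orbT andbT.
  by rewrite ge_max !le_max ac lexx !orbT.
have tg a : (g <= t a <= b)%O.
  by rewrite /t ge_min lexx orbT le_min (ltW gb) le_max le_osucc orbT.
have v1 : bvar p (x \o t) e'.
  move=> s ss; rewrite vsum_map; apply: gP; first exact: (homo_sorted tm).
  by move=> c /mapP[a _ ->].
have v2 : bvar p (fun a => - (x h - x b) * ind g a) e'.
  apply: (bvar_le _ (bvarZ (- (x h - x b)) (bvar_ind k p1 g))).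
  rewrite mulr1 knN knC; apply: le_trans (gP [:: h; b] _ _).
  - by rewrite /= addr0.
  - by rewrite /= hb.
  - move=> c; rewrite !inE => /orP[]/eqP ->; first by rewrite le_osucc.
    by rewrite (ltW gb) lexx.
have v3 : bvar p (fun a => (x \o t) a + - x b) e'.
  move=> s ss; apply: le_trans (v1 s ss);
    apply: le_trans (vsum_comb (C := 1) (F := [:: tt]) (fi := fun=> x \o t) _) _.
    by move=> a c _ _; rewrite big_seq1 mul1r /jmp opprD opprK addrACA addNr addr0.
  by rewrite big_seq1 mul1r.
have v4 := bvarD p1 v3 v2; move: v4.
have -> : c2 p * (e' + e') = e `^ p.
  by rewrite /e'; field; rewrite gt_eqF// c2_gt0.
move=> v4; apply: (bvar_ext _ v4) => a; rewrite /comp /t ljB ljD ljZ ljB !cutE !indE.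
case: (leP a g) => ag.
  have ah : (a <= h)%O := le_trans ag (le_osucc g).
  rewrite (le_trans ag (ltW gb)) (max_idPr ah) (min_idPl hb) mulr1.
  by rewrite !subrr mulr0 add0r subrr.
have ha : (h <= a)%O by rewrite osucc_le.
rewrite (max_idPl ha) mulr0 !addr0 subr0.
by case: (leP a b) => ab; rewrite ?mulr1// mulr0 subrr subr0.
Qed.

(** Transfinite induction on [b]: zero and successor steps are exact identities, since only the
    value at [b] is new, and [cut_limit] handles limit steps. *)
Lemma cut_closure (x : J) b :
  closure (lspan [set ind c | c in [set c | (c <= b)%O]]) (cut b x).
Proof.
pose C b := closure (lspan [set ind c | c in [set c | (c <= b)%O]] : set J).
have Csub c d : (c <= d)%O -> C c `<=` C d.
  move=> cd; apply: closure_subset => _ [n [z [a [ha ->]]]]; exists n, z, a; split=> // i.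
  by have [e ec <-] := ha i; exists e => //; exact: le_trans cd.
have Clin c z u v : C c u -> C c v -> C c (z *: u + v).
  have [_ h] := @closed_span_submod K J [set ind e | e in [set e | (e <= c)%O]].
  by move=> Cu Cv; have := h z u v; rewrite !inE; apply.
have Cind c d : (d <= c)%O -> C c (ind d).
  move=> dc; apply: subset_closure; exists 1%N, (fun=> 1), (fun=> ind d); split; last first.
    by rewrite big_ord1 scale1r.
  by move=> _; exists d.
have Cdiff c d e : (d <= c)%O -> (e <= c)%O -> C c (ind d - ind e).
  move=> dc ec; rewrite addrC -scaleN1r; apply: Clin; exact: Cind.
rewrite -/(C b); elim/omega1_ind: b => b IH.
have [lb|/nonlimitP[bz|[e be]]] := pselect (limit_ordinal b).
- apply/closure_rnormP => e e0; have e20 : 0 < e / 2 by rewrite divr_gt0.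
  have [[s0 s0b] _] := lb; have [g [_ gb gP]] := cut_limit x lb e20 s0b.
  have := Clin b (x b) _ _ (Cdiff b b g (lexx _) (ltW gb)) (Csub _ _ (ltW gb) _ (IH _ gb)).
  move=> /closure_rnormP/(_ _ e20)[y Cy yP]; exists y => //.
  rewrite (splitr e); apply: le_trans (lerD gP yP).
  by apply: le_trans (ler_rnormD _ _); rewrite addrA subrK.
- have -> : cut b x = x b *: ind b + 0.
    apply: lj_eqP => a; rewrite addr0 cutE ljZ indE; case: ifP => ab; last by rewrite mulr0.
    by rewrite mulr1; congr (x _); apply: le_anti; rewrite ab bz ozero_le.
  apply: (Clin); first exact: Cind.
  have -> : (0 : J) = (-1) *: ind b + ind b by rewrite scaleN1r addNr.
  exact: (Clin b (-1) _ _ (Cind _ _ (lexx b)) (Cind _ _ (lexx b))).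
- have eb : (e < b)%O by rewrite be lt_osucc.
  have -> : cut b x = x b *: (ind b - ind e) + cut e x.
    apply: lj_eqP => a; rewrite ljD ljZ ljB !cutE !indE; case: (leP a e) => ae.
      by rewrite (le_trans ae (ltW eb)) subrr mulr0 add0r.
    rewrite subr0 addr0; case: ifP => ab; last by rewrite mulr0.
    by rewrite mulr1; congr (x _); apply: le_anti; rewrite ab be osucc_le.
  apply: (Clin); first by apply: Cdiff => //; exact: ltW.
  exact: (Csub _ _ (ltW eb) _ (IH _ eb)).
Qed.

Lemma functional_ext (F : J -> K^o) : bounded_operator F ->
  (forall b, F (ind b) = 0) -> forall x, F x = 0.
Proof.
move=> bF Fz x; have Fl := bop_linear bF; have [M M0 FM] := bop_bound bF.
apply: kn_le0_eq => e e0; have [b <-] := cut_all x.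
have eM : 0 < e / M by rewrite divr_gt0.
have /closure_rnormP/(_ _ eM)[y [n [c [a [ha ->]]]] yP] := @cut_closure x b.
set y' := \sum_(i < n) _ in yP.
have Fy : F y' = 0.
  rewrite (lin_sum Fl) big1// => i _; have [d _ <-] := ha i.
  by rewrite (linZ Fl) Fz scaler0.
rewrite -[F _]subr0 -Fy -(linB Fl); apply: le_trans (FM _) _.
by rewrite mulrC -ler_pdivlMr.
Qed.

Lemma james_zero a (x : J) : subspace_set (james k p1 a) x -> forall b, (a <= b)%O -> x b = 0.
Proof.
move=> /closure_rnormP h b ab; apply: kn_le0_eq => e /h[y [n [c [d [hd ->]]]] yP].
apply: le_trans yP; apply: le_trans (kn_le _ b); rewrite ljB lj_sumE big1 ?subr0// => i _.
by have [f fa <-] := hd i; rewrite ljZ indE leNgt (lt_le_trans fa ab) mulr0.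
Qed.

(** Since [x a] is 0, the indicator term in [cut_limit] disappears and [x] is close to a truncation
    at some [g] strictly below [a]. *)
Lemma jamesP a (x : J) : limit_ordinal a -> (forall b, (a <= b)%O -> x b = 0) ->
  subspace_set (james k p1 a) x.
Proof.
move=> la xz; apply/closure_rnormP => e e0; have e20 : 0 < e / 2 by rewrite divr_gt0.
have xE : x = cut a x.
  by apply: lj_eqP => b; rewrite cutE; case: leP => // /ltW /xz.
have [[s0 s0a] _] := la; have [g [_ ga gP]] := cut_limit x la e20 s0a.
have /closure_rnormP/(_ _ e20)[y [n [c [d [hd yE]]]] yP] := @cut_closure x g.
exists y; first exists n, c, d; first split=> // i.
  by have [f fg <-] := hd i; exists f => //; exact: le_lt_trans ga.
rewrite (xz a)// scale0r add0r -xE in gP.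
rewrite (splitr e); apply: le_trans (lerD gP yP).
by apply: le_trans (ler_rnormD _ _); rewrite addrA subrK.
Qed.

End density.

(** * The character Lambda *)

Section eventual_eigenvalue.
Context (R : realType) (k : scalar_kind) (p : R) (p1 : 1 < p).
Local Notation K := (scalarField R k).
Local Notation J := (long_james k p1).
Local Notation ind := (initial_indicator k p1).
Implicit Types (f g : omega1 -> K) (a b : omega1) (S T : J -> J).

Lemma bop_scale (X Y : normedModType K) (T : X -> Y) z : bounded_operator T ->
  bounded_operator (fun x => z *: T x).
Proof.
move=> bT; have [M M0 TM] := bop_bound bT; apply: (@bop_mk _ _ _ _ _ (kn z * M)) => [a u v|x].
  by rewrite (bop_linear bT) scalerDr !scalerA mulrC.
by rewrite rnormZ -mulrA ler_wpM2l ?kn_ge0.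
Qed.

Lemma coord_bop (X : normedModType K) (T : X -> J) a : bounded_operator T ->
  @bounded_operator K X K^o (fun x => T x a).
Proof. by move=> bT; exact: (bop_comp (ev_bop k p1 a) bT). Qed.

Lemma leftcont_eq f g a : limit_ordinal a -> leftcont f -> leftcont g ->
  (forall c, (c < a)%O -> f c = g c) -> f a = g a.
Proof.
move=> la fc gc fg; apply/eqP; rewrite -subr_eq0; apply/eqP/kn_le0_eq => e e0.
have e20 : 0 < e / 2 by rewrite divr_gt0.
have [s sa sP] := fc a la _ e20; have [t ta tP] := gc a la _ e20.
set u := Order.max s t; have ua : (u < a)%O by rewrite gt_max sa.
have -> : f a - g a = (g u - g a) - (f u - f a).
  by rewrite (fg u ua); ring.
rewrite (splitr e); apply: le_trans (knB _ _) _.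
by rewrite lerD ?sP ?tP ?(ltW ua)// le_max lexx ?orbT.
Qed.

Lemma operator_structure T : bounded_operator T ->
  exists (D : set omega1) (l : omega1 -> K) (a0 : omega1) (z : K),
    [/\ club D /\ D `<=` limit_ordinal,
        forall d, D d -> forall b a, (b < d)%O -> (d <= a)%O -> T (ind b) a = 0,
        forall d, D d -> forall a b, (a < d)%O -> (d <= b)%O -> T (ind b) a = l a,
        forall d, D d -> forall b, (d <= b)%O -> T (ind b) d = l d &
        forall a, (a0 <= a)%O -> l a = z].
Proof.
move=> bT; have [M M0 TM] := bop_bound bT.
have [zt ztP] := choice (fun b => lj_zero (T (ind b))).
have [h hP] := choice (fun a => functional_eventually_const (coord_bop a bT)).
pose l a := T (ind (h a)) a.
have lE a b : (h a <= b)%O -> T (ind b) a = l a by exact: hP.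
(* The finitely many rows met by a list are all constant from a common [b] on, so along that list
   [l] coincides with the single column [T (ind b)], of norm at most [M]. *)
have lvar : bvar p l (M `^ p).
  move=> s ss; have [b bP] : exists b, forall a, a \in s -> (h a <= b)%O.
    have [b bP] := @countable_bound (h @` [set` s])
      (sub_countable (card_image_le _ _) (finite_set_countable (finite_seq s))).
    by exists b => a sa; apply/ltW/bP; exists a.
  apply: le_trans (_ : rnorm (T (ind b)) `^ p <= _); last first.
    apply: powp_le => //; first exact: rnorm_ge0.
    by apply: le_trans (TM _) _; rewrite ler_piMr ?(ltW M0)// ind_norm.
  apply: le_trans (bvar_norm (T (ind b)) ss).
  apply: le_trans (vsum_comb (C := 1) (F := [:: tt]) (fi := fun=> T (ind b)) _) _.
    by move=> a c sa sc; rewrite big_seq1 mul1r /jmp !lE ?bP.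
  by rewrite big_seq1 mul1r.
have [a0 a0P] := bvar_eventually_const p1 lvar.
exists [set d | limit_ordinal d /\ forall b, (b < d)%O -> (Order.max (zt b) (h b) < d)%O].
exists l, a0, (l a0); split.
- by split; [exact: club_closed_under | move=> d []].
- move=> d [_ dP] b a bd da; apply: ztP; apply: le_trans da.
  by have := dP b bd; rewrite gt_max => /andP[/ltW].
- move=> d [_ dP] a b ad db; apply: lE; apply: le_trans db.
  by have := dP a ad; rewrite gt_max => /andP[_ /ltW].
- move=> d [ld dP]; have hd c : (c < d)%O -> (h c <= d)%O.
    by move=> /dP; rewrite gt_max => /andP[_ /ltW].
  (* The row at [d] itself is known to be constant only from [h d] on, possibly beyond [d]. The
     columns of index at least [d] agree at every point below [d], hence also at the limit [d] by
     left continuity. *)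
  have key b : (d <= b)%O -> T (ind b) d = T (ind d) d.
    move=> db; apply: leftcont_eq => //; try exact: lj_leftcont.
    by move=> c /hd hc; rewrite !lE// (le_trans hc).
  move=> b db; rewrite key// -(key (Order.max d (h d))) ?le_max ?lexx//.
  by apply: lE; rewrite le_max lexx orbT.
- exact: a0P.
Qed.

Lemma structure_eigenvalue T (D : set omega1) (l : omega1 -> K) (a0 : omega1) (z : K) :
  bounded_operator T -> club D ->
  (forall d, D d -> forall b a, (b < d)%O -> (d <= a)%O -> T (ind b) a = 0) ->
  (forall d, D d -> forall b, (d <= b)%O -> T (ind b) d = l d) ->
  (forall a, (a0 <= a)%O -> l a = z) -> eventual_eigenvalue T z.
Proof.
move=> bT cD h1 h2 h3; exists (D `&` [set a | (a0 <= a)%O]).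
  by apply: clubI => //; exact: club_tail.
move=> x a [Da aa]; apply/eqP; rewrite -subr_eq0; apply/eqP.
have bF : @bounded_operator K J K^o (fun x => T x a - z * x a).
  have := bop_lin (- z) (ev_bop k p1 a) (coord_bop a bT).
  congr bounded_operator; apply/funext => y.
  by rewrite -[LHS]/(- z * y a + T y a) addrC mulNr.
apply: (functional_ext bF) => b; rewrite indE.
case: (leP a b) => ab; first by rewrite (h2 a)// h3// mulr1 subrr.
by rewrite (h1 a)// mulr0 subrr.
Qed.

Lemma eigenvalue_exists T : bounded_operator T -> exists z, eventual_eigenvalue T z.
Proof.
move=> bT; have [D [l [a0 [z [[cD _] h1 _ h2 h3]]]]] := operator_structure bT.
exists z; exact: (structure_eigenvalue bT cD h1 h2 h3).
Qed.

Lemma eigenvalue_unique T z w : eventual_eigenvalue T z -> eventual_eigenvalue T w -> z = w.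
Proof.
move=> [D cD DP] [E cE EP]; have [_ /(_ ozero)[d [Dd Ed] _]] := clubI cD cE.
have := DP (ind d) d Dd; rewrite (EP _ _ Ed) indE lexx !mulr1; exact: esym.
Qed.

Lemma LambdaP T : bounded_operator T -> eventual_eigenvalue T (Lambda T).
Proof. by move=> /eigenvalue_exists h; exact: xgetPex h. Qed.

Lemma Lambda_eq T z : eventual_eigenvalue T z -> Lambda T = z.
Proof.
move=> h; apply: (@eigenvalue_unique T) => //.
by apply: (@xgetPex _ 0 [set l | eventual_eigenvalue T l]); exists z.
Qed.

Lemma eigenvalue_comp S T z w : eventual_eigenvalue S z -> eventual_eigenvalue T w ->
  eventual_eigenvalue (S \o T) (z * w).
Proof.
move=> [D cD DP] [E cE EP]; exists (D `&` E); first exact: clubI.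
by move=> x a [Da Ea] /=; rewrite DP// EP// mulrA.
Qed.

Lemma eigenvalue_lin S T c z w : eventual_eigenvalue S z -> eventual_eigenvalue T w ->
  eventual_eigenvalue (c *: S + T) (c * z + w).
Proof.
move=> [D cD DP] [E cE EP]; exists (D `&` E); first exact: clubI.
move=> x a [Da Ea]; rewrite -[LHS]/(c * S x a + T x a) DP// EP// mulrDl mulrA//.
Qed.

Lemma eigenvalue_id : eventual_eigenvalue (@idfun J) 1.
Proof. by exists setT => [|x a _]; [split=> // a; exists a | rewrite mul1r]. Qed.

Lemma eigenvalue0 : eventual_eigenvalue (0 : J -> J) 0.
Proof. by exists setT => [|x a _]; [split=> // a; exists a | rewrite mul0r]. Qed.

Lemma lift_op (V : normedModType K) (F : V -> omega1 -> K) (M : R) : 0 <= M ->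
  (forall v, leftcont (F v)) ->
  (forall v, exists a, forall b, (a <= b)%O -> F v b = 0) ->
  (forall z u v a, F (z *: u + v) a = z * F u a + F v a) ->
  (forall v, bvar p (F v) ((M * rnorm v) `^ p)) ->
  exists2 S : V -> J, bounded_operator S & forall v a, S v a = F v a.
Proof.
move=> M0 Fc Fz Fl Fv.
pose S v : J := LongJames (in_lj p1 (Fc v) (Fz v) (Fv v)).
exists S => //; apply: (@bop_mk _ _ _ _ S M) => [z u v|v].
  by apply: lj_eqP => a; rewrite ljD ljZ; exact: Fl.
by apply: norm_le; [rewrite mulr_ge0 ?rnorm_ge0 | exact: Fv].
Qed.

Lemma composition_op (t : omega1 -> omega1) : {homo t : a b / (a <= b)%O} -> lcont t ->
  (forall a, exists b, forall c, (b <= c)%O -> (a <= t c)%O) ->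
  exists2 S : J -> J, bounded_operator S & forall x a, S x a = x (t a).
Proof.
move=> tm tl tu; apply: (@lift_op J (fun x => x \o t) 1) => //.
- by move=> x; apply: leftcont_comp => //; exact: lj_leftcont.
- move=> x; have [a aP] := lj_zero x; have [b bP] := tu a.
  by exists b => c bc; rewrite /= aP// bP.
- by move=> x; apply: bvar_comp => //; rewrite mul1r; exact: bvar_norm.
Qed.

(* [A] composes with the enumeration of the club on which [T] acts as [z], [B] with its
   monotone left inverse. *)
Lemma factor_identity T z : bounded_operator T -> eventual_eigenvalue T z -> z != 0 ->
  exists A B : J -> J, [/\ bounded_operator A, bounded_operator B &
    A \o T \o B = idfun].
Proof.
move=> bT [D cD DP] z0.
have [|||A bA AE] := @composition_op (enumc D).
- by move=> a b; rewrite enumc_mono.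
- exact: enumc_lcont.
- by move=> a; exists a => c ac; apply: (le_trans ac); exact: enumc_ge.
have [|||B bB BE] := @composition_op (denumc D).
- exact: denumc_homo.
- exact: denumc_lcont.
- move=> a; exists (enumc D a) => c ac.
  by rewrite -(enumcK cD a); exact: denumc_homo.
exists (fun y => z^-1 *: A y), B; split; [exact: bop_scale | exact: bB |].
apply/funext => x; apply: lj_eqP => a.
rewrite -[LHS]/(z^-1 * A (T (B x)) a) AE DP; last exact: enumc_in.
by rewrite BE enumcK// mulrA mulVf// mul1r.
Qed.

Lemma ker_LambdaP T : ker_Lambda k p1 T <-> bounded_operator T /\ eventual_eigenvalue T 0.
Proof.
split=> -[bT h]; split=> //; last exact: Lambda_eq.
by rewrite -h; exact: LambdaP.
Qed.

Lemma ker_Lambda_ideal : two_sided_ideal (ker_Lambda k p1).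
Proof.
split=> [T []// | | a S T /ker_LambdaP[bS eS] /ker_LambdaP[bT eT] | S T bS /ker_LambdaP[bT eT]].
- by apply/ker_LambdaP; split; [exact: bop0 | exact: eigenvalue0].
- apply/ker_LambdaP; split; first exact: bop_lin.
  by have := eigenvalue_lin a eS eT; rewrite mulr0 addr0.
- have eS := LambdaP bS; split; apply/ker_LambdaP; split; try exact: bop_comp.
    by have := eigenvalue_comp eS eT; rewrite mulr0.
  by have := eigenvalue_comp eT eS; rewrite mul0r.
Qed.

Lemma not_factoring_ker : not_factoring_identity J = ker_Lambda k p1.
Proof.
apply/seteqP; split=> T.
  move=> [bT nf]; split=> //; apply/eqP; apply: contrapT => /negP z0.
  have [A [B [bA bB idE]]] := factor_identity bT (LambdaP bT) z0.
  exact: (nf A B bA bB (esym idE)).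
move=> /ker_LambdaP[bT eT]; split=> // A B bA bB idE.
have e := eigenvalue_comp (eigenvalue_comp (LambdaP bA) eT) (LambdaP bB).
rewrite -idE mulr0 mul0r in e.
by have /eqP := eigenvalue_unique eigenvalue_id e; rewrite oner_eq0.
Qed.

(** An ideal with a member of nonzero character contains the identity, which factors through that
    member. *)
Lemma proper_ideal_ker I : two_sided_ideal I -> I <> @bounded_operator K J J ->
  I `<=` ker_Lambda k p1.
Proof.
move=> [Ib I0 IL IM] In T IT; have bT := Ib _ IT; split=> //.
apply/eqP; apply: contrapT => /negP z0; apply: In; apply/seteqP; split=> // S bS.
have [A [B [bA bB idE]]] := factor_identity bT (LambdaP bT) z0.
have [I1 _] := IM A T bA IT; have [_ I2] := IM B _ bB I1.
rewrite idE in I2; by have [] := IM S _ bS I2.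
Qed.

Lemma ker_Lambda_proper : ker_Lambda k p1 <> @bounded_operator K J J.
Proof.
move=> kE; have : ker_Lambda k p1 idfun by rewrite kE; exact: bop_id.
move=> /ker_LambdaP[_ /(eigenvalue_unique eigenvalue_id)/eqP].
by rewrite oner_eq0.
Qed.

Lemma ker_Lambda_maximal : maximal_ideal (ker_Lambda k p1).
Proof.
split; [exact: ker_Lambda_ideal | exact: ker_Lambda_proper |].
move=> I iI kI; have [|nI] := pselect (I = @bounded_operator K J J); first by right.
by left; apply/seteqP; split=> //; exact: proper_ideal_ker.
Qed.

Lemma maximal_ideal_ker I : maximal_ideal I -> I = ker_Lambda k p1.
Proof.
move=> [iI nI Imax]; have [//|h] := Imax _ ker_Lambda_ideal (proper_ideal_ker iI nI).
by case: ker_Lambda_proper.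
Qed.

End eventual_eigenvalue.

(** * Weakly compactly generated spaces *)

Section weak_topology.
Context (R : realType) (k : scalar_kind).
Local Notation K := (scalarField R k).

Definition dual_of (X : normedModType K) (f : X -> K) (bf : @bounded_operator K X K^o f) : dual X :=
  exist _ f (mem_set bf).

Lemma weak_nbhs (X : normedModType K) (f : X -> K) (w : X) (e : R) :
  @bounded_operator K X K^o f -> 0 < e ->
  nbhs (w : weak_topology X) [set v : X | kn (f v - f w) < e].
Proof.
move=> bf e0; pose F := dual_of bf.
have e0' : 0 < ofReal k e by rewrite -ofReal0 ltr_ofReal.
have c1 : continuous (fun v : weak_topology X => (weak_eval v : {ptws dual X -> K}) F).
  move=> v; apply: (@continuous_comp _ _ _ (@weak_eval K X : weak_topology X -> _)
    (fun g : {ptws dual X -> K} => g F)).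
    exact: initial_continuous.
  exact: (@proj_continuous (dual X) (fun=> K : topologicalType) F).
have := c1 w _ (nbhsx_ballx (f w : K^o) _ e0').
apply: (@filterS _ (nbhs (w : weak_topology X)) _) => v /=.
by rewrite -ball_normE /= -(@knE R k) ltr_ofReal knC.
Qed.

(** Every functional is small on [A] off a finite subset: weakly, [A] resembles the one-point
    compactification of a discrete set, with 0 at infinity. *)
Definition null_family (X : normedModType K) (A : set X) := A 0 /\
  forall f : X -> K, @bounded_operator K X K^o f -> forall e : R, 0 < e ->
    finite_set [set a | A a /\ e <= kn (f a)].

(** Weak neighbourhoods of 0 miss only finitely many points of [A]. So a filter on [A] either
    clusters at 0 or contains a finite subset of [A], where it clusters anyway. *)
Lemma null_weakly_compact (X : normedModType K) (A : set X) :
  null_family A -> weakly_compact A.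
Proof.
move=> [A0 Af] F FF FA.
pose W : topologicalType := weak_topology X.
(* The sets containing all but finitely many points of [A] form a filter; its weak convergence to 0
   is tested one functional at a time. *)
have key (U : set W) : nbhs (0 : W) U -> finite_set (A `\` U).
  pose G : set_system W := [set U | finite_set (A `\` U)].
  have FG : Filter G.
    split=> [|P Q GP GQ|P Q PQ]; rewrite /G /=.
    - by rewrite setDT.
    - by rewrite setDIr finite_setU.
    - by apply: sub_finite_set => a [Aa nQ]; split=> // /PQ.
  suff : G --> (0 : W) by apply.
  move=> V /= [_ [[B oB <-] B0] BV].
  have cB : (@weak_eval K X) @ G --> (weak_eval (0 : X) : {ptws dual X -> K}).
    apply/cvg_sup => f C [_ [[Q oQ <-] Q0] QC].
    apply: (@filterS _ G _ (@weak_eval K X @^-1` (proj f @^-1` Q))).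
      by move=> v; exact: QC.
    have bf : @bounded_operator K X K^o (\val f) by have := svalP f; rewrite inE.
    have /nbhs_ballP[e /= e0 eQ] : nbhs (\val f (0 : X) : K^o) Q.
      by apply: open_nbhs_nbhs.
    apply: sub_finite_set (Af _ bf _ (toReal_gt0 e0)) => v [Av nQ]; split=> //.
    rewrite leNgt; apply/negP => ve; apply: nQ; apply: eQ.
    rewrite -ball_normE /= (lin0 (bop_linear bf)) sub0r normrN.
    by rewrite -(@knE R k) -(toRealK (ltW e0)) ltr_ofReal.
  have /cB : nbhs (weak_eval (0 : X) : {ptws dual X -> K}) B by apply: open_nbhs_nbhs.
  by apply: (@filterS _ G FG) => v; exact: BV.
have [cl|ncl] := pselect (cluster F (0 : W)); first by exists 0.
have [B [U [FB [nU BU]]]] : exists B U, F B /\ (nbhs (0 : W) U /\ B `&` U = set0).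
  apply: contrapT => h; apply: ncl => B U FB nU; apply/set0P/negP => /eqP BU.
  by apply: h; exists B, U.
have fAB : finite_set (A `&` B).
  apply: sub_finite_set (key U nU) => a [Aa Ba]; split=> // Ua.
  have : (B `&` U) a by [].
  by rewrite BU.
have [a [[Aa _] ca]] := @finite_compact W _ fAB F FF (filterI FA FB).
by exists a.
Qed.

Lemma corestriction (X Y : normedModType K) (W : closedSubspace X) (S : Y -> X) :
  bounded_operator S -> (forall y, subspace_set W (S y)) ->
  exists2 S' : Y -> subspaceType W, bounded_operator S' &
    forall y, subspace_val (S' y) = S y.
Proof.
move=> bS SW; have [M M0 SM] := bop_bound bS.
have mem y : S y \in subspace_pred W by rewrite /subspace_pred; exact: mem_set.
exists (fun y => SubspaceType (mem y)) => //.
apply: (@bop_mk _ _ _ _ _ M) => [a u v|y]; last exact: SM.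
by apply: val_inj; exact: (bop_linear bS).
Qed.

Lemma null_range_wcg (X Y : normedModType K) (S : Y -> X) (A : set Y) :
  bounded_operator S -> null_family A -> closure (lspan A) = setT ->
  weakly_compactly_generated (subspaceType (closed_span (range S))).
Proof.
move=> bS [A0 Af] Ad.
have Sl := bop_linear bS.
have rS y : lspan (range S) (S y).
  by exists 1%N, (fun=> 1), (fun=> S y); split=> [_|]; [exists y | rewrite big_ord1 scale1r].
have [|S' bS' S'E] := @corestriction X Y (closed_span (range S)) S bS.
  by move=> y; apply: subset_closure.
have S'l := bop_linear bS'.
exists (S' @` A).
  apply: null_weakly_compact; split; first by exists 0 => //; exact: (lin0 S'l).
  move=> f bf e e0; apply: sub_finite_set (finite_image S' (Af _ (bop_comp bf bS') _ e0)).
  by move=> _ [[y Ay <-] ey]; exists y.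
apply/seteqP; split=> // w _; apply/closure_rnormP => e e0.
have [M M0 SM] := bop_bound bS.
have e20 : 0 < e / 2 by rewrite divr_gt0.
have /closure_rnormP/(_ _ e20)[_ [n [c [a [ha ->]]]] wy] : closure (lspan (range S)) (subspace_val w).
  by case: w => w /=; rewrite /subspace_pred inE.
have ha' i : exists b, S b = a i by have [b _ bE] := ha i; exists b.
have [b bE] := choice ha'.
pose y := \sum_(i < n) c i *: b i.
have Sy : S y = \sum_(i < n) c i *: a i.
  by rewrite (lin_sum Sl); apply: eq_bigr => i _; rewrite (linZ Sl) bE.
have eM : 0 < e / 2 / M by rewrite divr_gt0.
have /closure_rnormP/(_ _ eM)[_ [m [d [v [hv ->]]]] yv] : closure (lspan A) y by rewrite Ad.
exists (\sum_(i < m) d i *: S' (v i)).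
  by exists m, d, (S' \o v); split=> // i; exists (v i).
have S'y : rnorm (w - S' y) <= e / 2 by rewrite -Sy in wy; rewrite -S'E in wy.
rewrite -[w](subrK (S' y)) -addrA (splitr e); apply: le_trans (ler_rnormD _ _) _.
rewrite lerD//.
have -> : \sum_(i < m) d i *: S' (v i) = S' (\sum_(i < m) d i *: v i).
  by rewrite (lin_sum S'l); apply: eq_bigr => i _; rewrite (linZ S'l).
have -> : rnorm (S' y - S' (\sum_(i < m) d i *: v i)) = rnorm (S (y - \sum_(i < m) d i *: v i)).
  by rewrite -(linB S'l) -S'E.
apply: le_trans (SM _) _; by rewrite mulrC -ler_pdivlMr.
Qed.

End weak_topology.

Section wcg.
Context (R : realType) (k : scalar_kind) (p : R) (p1 : 1 < p).
Local Notation K := (scalarField R k).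
Local Notation J := (long_james k p1).
Local Notation ind := (initial_indicator k p1).

(* On a weakly compact set the pointwise convergence [S y a --> 0] as [a] tends to
   omega_1 is uniform enough for finitely many [a] to be needed for each tolerance;
   the supremum of omega many such blocks of [D] kills the whole set. *)
Lemma weakly_compact_block (Y : normedModType K) (S : Y -> J) (A : set Y) (D : set omega1)
    (a : omega1) (e : R) :
  bounded_operator S -> weakly_compact A -> club D -> 0 < e ->
  exists b, forall y, A y -> exists2 c, D c & ((a <= c <= b)%O /\ kn (S y c) <= e).
Proof.
move=> bS cA cD e0; apply: contrapT => h.
(* If no [b] worked, these decreasing sets would generate a proper filter on [A]. At a cluster point
   [y], [S y] vanishes at some late [d] in [D], while points of [B d] arbitrarily near [y] have
   values at least e there. *)
pose B b := [set y | A y /\ forall c, D c -> (a <= c <= b)%O -> e <= kn (S y c)].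
have B0 b : B b !=set0.
  apply: contrapT => Be; apply: h; exists b => y Ay; apply: contrapT => hy.
  apply: Be; exists y; split=> // c Dc acb; rewrite leNgt; apply/negP => /ltW ce.
  by apply: hy; exists c.
pose F : set_system (weak_topology Y) := filter_from setT B.
have FF : ProperFilter F.
  apply: filter_from_proper => [|b _]; last exact: B0.
  apply: filter_from_filter => [|b c _ _]; first by exists a.
  exists (Order.max b c) => // y [Ay yP]; split; split=> // d Dd /andP[ad db];
    apply: yP => //; by rewrite ad le_max db ?orbT.
have FA : F A by exists a => // y [].
have [y [Ay cy]] := cA F FF FA.
have [z zP] := lj_zero (S y).
have [_ /(_ (Order.max a z))[d Dd]] := cD; rewrite ge_max => /andP[ad zd].
have e20 : 0 < e / 2 by rewrite divr_gt0.
have [v [[Av vP] /= vy]] := cy _ _ (ex_intro2 _ _ d I (@subset_refl _ (B d)) : F (B d))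
  (weak_nbhs y (coord_bop d bS) e20).
have := vP d Dd; rewrite ad lexx => /(_ isT); rewrite leNgt => /negP; apply.
rewrite (zP d zd) subr0 in vy; apply: lt_trans vy _.
by rewrite ltr_pdivrMr// ltr_pMr// ltr1n.
Qed.

Lemma weakly_compact_zero (Y : normedModType K) (S : Y -> J) (A : set Y) (D : set omega1) :
  bounded_operator S -> weakly_compact A -> closure (lspan A) = setT -> club D ->
  exists2 a, D a & forall y, S y a = 0.
Proof.
move=> bS cA Ad cD.
have blk n a : exists b, forall y, A y ->
    exists2 c, D c & ((a <= c <= b)%O /\ kn (S y c) <= n.+1%:R^-1).
  by apply: weakly_compact_block.
pose nx n a := sval (cid (blk n a)).
have nxP n a : forall y, A y -> exists2 c, D c & ((a <= c <= nx n a)%O /\ kn (S y c) <= n.+1%:R^-1).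
  exact: (svalP (cid (blk n a))).
pose t := fix t n := if n is n'.+1 then osucc (Order.max (t n') (nx n' (t n'))) else ozero.
have tS n : t n.+1 = osucc (Order.max (t n) (nx n (t n))) by [].
have [|s [ls ts sup]] := @omega_sup t.
  by move=> n; rewrite tS; apply: le_lt_trans (lt_osucc _); rewrite le_max lexx.
have sA y : A y -> S y s = 0.
  move=> Ay; apply: kn_le0_eq => e e0; have e20 : 0 < e / 2 by rewrite divr_gt0.
  have [u us uP] := lj_leftcont (S y) ls e20.
  have [n0 n0P] := sup u us; have [n1] := @ltr_add_invr R 0 (e / 2) e20; rewrite add0r => n1P.
  have tmon : {homo t : i j / (i <= j)%N >-> (i <= j)%O}.
    apply: (homo_leq le_refl le_trans) => n; rewrite tS.
    by apply: le_trans (le_osucc _); rewrite le_max lexx.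
  (* [n0] puts the block where [S y] is within e/2 of its value at [s], and [n1] makes the tolerance
     of the block at most e/2. *)
  pose n := maxn n0 n1; have [c Dc [/andP[tc cn] cP]] := nxP n (t n) y Ay.
  have cs : (c <= s)%O.
    apply: le_trans (ltW (ts n.+1)); rewrite tS; apply: le_trans (le_osucc _).
    by rewrite le_max cn orbT.
  have uc : (u <= c)%O.
    by apply: le_trans tc; apply: le_trans (ltW n0P) (tmon _ _ (leq_maxl _ _)).
  have := uP c uc cs; rewrite knC => h.
  rewrite -[S y s](subrK (S y c)) (splitr e); apply: le_trans (knD _ _) (lerD h _).
  apply: le_trans cP _; apply: le_trans (ltW n1P).
  by rewrite lef_pV2 ?posrE ?ltr0Sn// ler_nat ltnS leq_maxr.
(* With [A] empty, [Y] is zero and any point of [D] serves. Otherwise a point of [A] yields elements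
   of [D] in every block, so their supremum [s] lies in [D]. *)
have [[y0 Ay0]|A0] := pselect (A !=set0); last first.
  have [_ /(_ ozero)[d Dd _]] := cD; exists d => // y.
  have bd := coord_bop d bS; have [M M0 SM] := bop_bound bd.
  apply: kn_le0_eq => e e0; have eM : 0 < e / M by rewrite divr_gt0.
  have /closure_rnormP/(_ _ eM)[_ [n [c [a [ha ->]]]] yP] : closure (lspan A) y by rewrite Ad.
  case: n c a ha yP => [|n] c a ha yP; last by case: A0; exists (a ord0).
  rewrite big_ord0 subr0 in yP; apply: le_trans (SM y) _; by rewrite mulrC -ler_pdivlMr.
exists s.
  have /closed_omega1P := clubW cD; apply => // b bs.
  have [n bn] := sup b bs; have [c Dc [/andP[tc cn] _]] := nxP n (t n) _ Ay0.
  exists c => //; rewrite (le_trans (ltW bn) tc) /=.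
  apply: le_trans (ltW (ts n.+1)); rewrite tS; apply: le_trans (le_osucc _).
  by rewrite le_max cn orbT.
move=> y; have bd := coord_bop s bS; have [M M0 SM] := bop_bound bd.
have Sl := bop_linear bd.
apply: kn_le0_eq => e e0; have eM : 0 < e / M by rewrite divr_gt0.
have /closure_rnormP/(_ _ eM)[_ [n [c [a [ha ->]]]] yP] : closure (lspan A) y by rewrite Ad.
set y' := \sum_(i < n) _ in yP.
have Sy' : S y' s = 0.
  have := lin_sum Sl (index_enum 'I_n) predT (fun i => c i *: a i) => /= ->.
  apply: big1 => i _; have := linZ Sl (c i) (a i) => /= ->.
  by rewrite sA ?scaler0.
have := SM (y - y'); have := linB Sl y y' => /= ->; rewrite Sy' subr0 => h.
by apply: le_trans h _; rewrite mulrC -ler_pdivlMr.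
Qed.

Lemma wcg_eigenvalue (Y : normedModType K) (S : Y -> J) (T : J -> Y) z :
  weakly_compactly_generated Y -> bounded_operator S ->
  eventual_eigenvalue (S \o T) z -> z = 0.
Proof.
move=> [A cA Ad] bS [D cD DP].
have [a Da Sa] := weakly_compact_zero bS cA Ad cD.
have h : S (T (ind a)) a = z * ind a a := DP (ind a) a Da.
by move: h; rewrite Sa indE lexx mulr1.
Qed.

Lemma wcg_operators_ker : wcg_operators J `<=` ker_Lambda k p1.
Proof.
move=> T [bT [W [wW TW]]]; split=> //.
have [|T' bT' T'E] := @corestriction R k J J W T bT; first by move=> y; apply: TW; exists y.
apply: Lambda_eq; have [z ez] := eigenvalue_exists bT.
have bv : bounded_operator (@subspace_val K J W : subspaceType W -> J).
  by apply: (@bop_mk _ _ _ _ _ 1) => // x; rewrite mul1r.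
suff z0 : z = 0 by rewrite -z0.
apply: (wcg_eigenvalue wW bv (T := T')).
by have -> : @subspace_val K J W \o T' = T by apply/funext => y; exact: T'E.
Qed.

End wcg.

(** * The l_p-sum of the spaces james a *)

Section G_space_theory.
Context (R : realType) (k : scalar_kind) (p : R) (p1 : 1 < p).
Local Notation K := (scalarField R k).
Local Notation J := (long_james k p1).
Local Notation G := (G_space k p1).
Local Notation ind := (initial_indicator k p1).
Local Notation L := (limit_ordinal : Type).
Local Notation E := (fun a : limit_ordinal => subspaceType (james k p1 (\val a))).
Implicit Types (g : G) (a : L).

(* The coordinates of [g], seen in the whole space rather than in [james a]. *)
Definition Gc g a : J := subspace_val (lp_fun g a).

Lemma Gc_lin z g h a : Gc (z *: g + h) a = z *: Gc g a + Gc h a.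
Proof. by []. Qed.

Lemma Gc_mem g a : subspace_set (james k p1 (\val a)) (Gc g a).
Proof. by rewrite /Gc; case: (lp_fun g a) => x /=; rewrite /subspace_pred inE. Qed.

Lemma Gc_zero g a b : (\val a <= b)%O -> Gc g a b = 0.
Proof. by apply: james_zero; exact: Gc_mem. Qed.

Lemma Gc_inj g h : (forall a, Gc g a = Gc h a) -> g = h.
Proof.
move=> gh; apply: val_inj; apply/functional_extensionality_dep => a.
by apply: val_inj; exact: gh.
Qed.

Let tot (f : product E) := lp_total p f.

Let tot_ge0 f : (0 <= tot f)%E.
Proof. by apply: esum_ge0 => i _; rewrite lee_fin powR_ge0. Qed.

Let tot_ge f (s : seq L) : uniq s ->
  ((\sum_(a <- s) rnorm (f a) `^ p)%:E <= tot f)%E.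
Proof.
move=> us; rewrite /tot /lp_total /esum; apply: ereal_sup_ubound.
by exists [set` s]; [split => //; exact: finite_seq | rewrite -fsbig_seq// sumEFin].
Qed.

Let tot_le f M : (forall s : seq L, uniq s -> \sum_(a <- s) rnorm (f a) `^ p <= M) ->
  (tot f <= M%:E)%E.
Proof.
move=> h; apply: ge_ereal_sup => _ [A [fA _] <-].
by rewrite fsbig_finite// sumEFin lee_fin; apply: h; exact: finmap.fset_uniq.
Qed.

Let G_norm g : rnorm g `^ p = fine (tot (lp_fun g)).
Proof.
have -> : rnorm g = fine (tot (lp_fun g)) `^ p^-1.
  by rewrite /rnorm; exact: (@ofRealK R k).
by rewrite -powRrM mulVf ?p_neq0// powRr1// fine_ge0.
Qed.

Let G_fin g : (tot (lp_fun g) < +oo)%E.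
Proof. by case: g => g /=; rewrite inE. Qed.

Lemma G_sum_le g (s : seq L) : uniq s ->
  \sum_(a <- s) rnorm (Gc g a) `^ p <= rnorm g `^ p.
Proof.
move=> us; rewrite G_norm -lee_fin fineK ?ge0_fin_numE//.
exact: (tot_ge (lp_fun g) us).
Qed.

Lemma G_norm_le g M : (forall s : seq L, uniq s -> \sum_(a <- s) rnorm (Gc g a) `^ p <= M) ->
  rnorm g `^ p <= M.
Proof.
move=> h; rewrite G_norm -lee_fin fineK ?ge0_fin_numE//.
exact: (tot_le (f := lp_fun g)).
Qed.

Lemma G_mk (h : L -> J) M : (forall a, subspace_set (james k p1 (\val a)) (h a)) ->
  (forall s : seq L, uniq s -> \sum_(a <- s) rnorm (h a) `^ p <= M) ->
  exists g, forall a, Gc g a = h a.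
Proof.
move=> hm hM.
have mem a : h a \in subspace_pred (james k p1 (\val a)) by rewrite /subspace_pred; exact: mem_set.
pose f : product E := fun a => SubspaceType (mem a).
have fP : f \in lp_sum_pred p1.
  rewrite inE; apply: le_lt_trans (ltry M); exact: (@tot_le f M hM).
by exists (LpSum fP).
Qed.

Lemma G_op (V : normedModType K) (h : V -> L -> J) (M : R) : 0 <= M ->
  (forall v a, subspace_set (james k p1 (\val a)) (h v a)) ->
  (forall z u v a, h (z *: u + v) a = z *: h u a + h v a) ->
  (forall v (s : seq L), uniq s -> \sum_(a <- s) rnorm (h v a) `^ p <= (M * rnorm v) `^ p) ->
  exists2 U : V -> G, bounded_operator U & forall v a, Gc (U v) a = h v a.
Proof.
move=> M0 hm hl hM.
have [U UE] := choice (fun v => G_mk (hm v) (hM v)).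
exists U => //; apply: (@bop_mk _ _ _ _ U M) => [z u v|v].
  by apply: Gc_inj => a; rewrite Gc_lin !UE hl.
apply: (powp_le_inv p1); [exact: rnorm_ge0 | exact: mulr_ge0 M0 (rnorm_ge0 _) |].
apply: G_norm_le => s us; rewrite (eq_bigr (fun a => rnorm (h v a) `^ p)).
  exact: hM.
by move=> a _; rewrite UE.
Qed.

Lemma single_ex a : exists2 U : E a -> G, bounded_operator U &
  forall w b, Gc (U w) b = if b == a then subspace_val w else 0.
Proof.
apply: (@G_op (E a) (fun w b => if b == a then subspace_val w else 0) 1) => //.
- move=> w b; case: eqP => [->|_]; first by case: w => x /=; rewrite /subspace_pred inE.
  by have [+ _] := subspace_submod (james k p1 (\val b)); rewrite inE.
- by move=> z u v b; case: ifP => // _; rewrite scaler0 addr0.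
move=> w s us; rewrite mul1r.
have [aS|aS] := boolP (a \in s).
  rewrite (bigD1_seq a)//= eqxx big1 ?addr0// => b /negPf ->.
  by rewrite rnorm0 powp0.
rewrite big_seq big1 ?powR_ge0// => b bs; case: eqP => [ba|_]; last by rewrite rnorm0 powp0.
by rewrite ba in bs; rewrite bs in aS.
Qed.

Definition single a : E a -> G := sval (cid2 (single_ex a)).
Arguments single a w : clear implicits.

Lemma single_bop a : bounded_operator (single a).
Proof. by rewrite /single; case: cid2. Qed.

Lemma singleE a w b : Gc (single a w) b = if b == a then subspace_val w else 0.
Proof. by rewrite /single; case: cid2. Qed.

Lemma Gc_sum (I : Type) (r : seq I) (F : I -> G) a : Gc (\sum_(i <- r) F i) a = \sum_(i <- r) Gc (F i) a.
Proof.
have h : linear (fun g : G => Gc g a) by move=> z u v; exact: Gc_lin.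
exact: (lin_sum h).
Qed.

Lemma Gc_sum_single (r : seq L) (w : forall a, E a) (c : L -> K) b : uniq r ->
  Gc (\sum_(a <- r) c a *: single a (w a)) b = if b \in r then c b *: subspace_val (w b) else 0.
Proof.
move=> ur; rewrite Gc_sum.
have E1 a : Gc (c a *: single a (w a)) b = if b == a then c b *: subspace_val (w b) else 0.
  have := Gc_lin (c a) (single a (w a)) 0 b; rewrite addr0 => ->.
  have -> : Gc 0 b = 0 by [].
  rewrite addr0 singleE; case: eqP => [->//|_]; by rewrite scaler0.
rewrite (eq_bigr _ (fun a _ => E1 a)).
have [br|br] := boolP (b \in r).
  rewrite (bigD1_seq b)//= eqxx big1 ?addr0// => a; by rewrite eq_sym => /negPf ->.
rewrite big_seq big1// => a ar; case: eqP => // ba; by move: br; rewrite ba ar.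
Qed.

Lemma norm_sum_single (r : seq L) (w : forall a, E a) (c : L -> K) : uniq r ->
  (forall a, kn (c a) <= 1) -> (forall a, rnorm (w a) <= 1) ->
  rnorm (\sum_(a <- r) c a *: single a (w a)) `^ p <= (size r)%:R.
Proof.
move=> ur c1 w1; apply: G_norm_le => s us.
apply: (@le_trans _ _ (\sum_(a <- s) (a \in r)%:R)).
  apply: ler_sum => a _; rewrite Gc_sum_single//; case: ifP => _; last by rewrite rnorm0 powp0.
  have h : rnorm (c a *: subspace_val (w a)) <= 1.
    rewrite rnormZ; apply: (@le_trans _ _ (1 * 1)); last by rewrite mulr1.
    apply: ler_pM; [exact: rnorm_ge0 | exact: rnorm_ge0 | exact: c1 | exact: w1].
  by have := powp_le p1 (rnorm_ge0 _) h; rewrite powR1.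
rewrite -natr_sum ler_nat.
apply: (@leq_trans (size [seq a <- s | a \in r])).
  rewrite size_filter; elim: (s) => [|a t IH]; first by rewrite big_nil.
  by rewrite big_cons /= leq_add2l.
apply: uniq_leq_size; first exact: filter_uniq.
by move=> a; rewrite mem_filter => /andP[].
Qed.

(** * A null generating set of the l_p-sum *)

Definition below_code (b : omega1) : omega1 -> nat :=
  sval (cid (elimT (countable_injP _) (omega1_countable_below b))).

Lemma below_code_inj b c d : (c <= b)%O -> (d <= b)%O ->
  below_code b c = below_code b d -> c = d.
Proof.
move=> cb db; rewrite /below_code; case: cid => f /= fi; apply: fi; rewrite inE//.
Qed.

Lemma ind_james a b : (b < \val a)%O -> subspace_set (james k p1 (\val a)) (ind b).
Proof.
move=> ba; apply: subset_closure; exists 1%N, (fun=> 1), (fun=> ind b).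
by split=> [_|]; [exists b | rewrite big_ord1 scale1r].
Qed.

Definition james_ind a b : E a :=
  match pselect (b < \val a)%O with
  | left h => SubspaceType (mem_set (ind_james h) : ind b \in subspace_pred (james k p1 (\val a)))
  | right _ => 0
  end.

Lemma james_indE a b : (b < \val a)%O -> subspace_val (james_ind a b) = ind b.
Proof. by rewrite /james_ind; case: pselect. Qed.

Lemma james_ind_norm a b : rnorm (james_ind a b) <= 1.
Proof.
rewrite /james_ind; case: pselect => [h|h]; last by rewrite rnorm0.
exact: (ind_norm k p1 b).
Qed.

(* The scaling by [1 / (n + 1)], with [n] the code of [b] below [a], makes the family null
   within each summand; across the summands the l_p norm does it. *)
Definition G_gen : set G := [set g | g = 0 \/ exists a b, (b < \val a)%O /\
  g = ofReal k ((below_code (\val a) b).+1%:R^-1) *: single a (james_ind a b)].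

(** Vectors of norm at most 1 in m different summands, combined with phases, have norm at most
    m^(1/p), while [f] would be at least m e on the combination. *)
Lemma G_gen_fixed_code (f : G -> K) (n : nat) (e : R) :
  @bounded_operator K G K^o f -> 0 < e ->
  finite_set [set a : L | exists b, [/\ (b < \val a)%O, below_code (\val a) b = n &
    e <= kn (f (single a (james_ind a b)))]].
Proof.
move=> bf e0; apply: contrapT => /infinite_set_fset inf.
have fl := bop_linear bf; have [M M0 fM] := bop_bound bf.
set B := [set a : L | _] in inf.
have bex a : exists b, B a -> e <= kn (f (single a (james_ind a b))).
  have [[b [_ _ h]]|nB] := pselect (B a); first by exists b.
  by exists (\val a).
have [bt btP] := choice bex.
apply: (@power_absurd R p p1 e (M `^ p) e0) => m.
have [C CB mC] := inf m.
pose r : seq L := take m (finmap.enum_fset C).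
have ur : uniq r by apply: take_uniq; exact: finmap.fset_uniq.
have sr : size r = m by rewrite size_takel.
have [|c c1 cP] := @pairing R k G f M _ (fun a : L => single a (james_ind a (bt a))) r e fl fM.
  by move=> a ar; apply: btP; apply: CB; exact: mem_take ar.
rewrite sr in cP; apply: (le_trans (powp_le p1 _ cP)); first by rewrite mulr_ge0// ltW.
rewrite powRM ?(ltW M0)//; last exact: rnorm_ge0.
apply: ler_wpM2l; first exact: powR_ge0.
rewrite -[in leRHS]sr; apply: norm_sum_single => //.
by move=> a; exact: james_ind_norm.
Qed.

Lemma G_gen_null : null_family G_gen.
Proof.
split=> [|f bf e e0]; first by left.
have fl := bop_linear bf; have [M M0 fM] := bop_bound bf.
have scal (n : nat) : 0 < n.+1%:R^-1 :> R by rewrite invr_gt0.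
have norm1 a b : kn (f (single a (james_ind a b))) <= M.
  apply: le_trans (fM _) _; rewrite ler_piMr ?(ltW M0)//.
  apply: (powp_le_inv p1); [exact: rnorm_ge0 | exact: ler01 | rewrite powR1].
  have := @norm_sum_single [:: a] (fun a => james_ind a b) (fun=> 1) isT.
  rewrite big_seq1 scale1r /=; apply=> [_|c]; first by rewrite kn1.
  exact: james_ind_norm.
(* Generators whose code is at least [N] are scaled so far down that [f] is below e on them; each of
   the remaining finitely many codes leaves finitely many summands. *)
pose N := Num.bound (M / e).
have NP : M / e < N%:R by apply: archi_boundP; rewrite divr_ge0// ltW.
pose B n := [set a : L | exists b, [/\ (b < \val a)%O, below_code (\val a) b = n &
    e <= kn (f (single a (james_ind a b)))]].
have fB n : finite_set (B n) by exact: G_gen_fixed_code.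
have bex n a : exists b, B n a -> (b < \val a)%O /\ below_code (\val a) b = n.
  have [[b [h1 h2 _]]|nB] := pselect (B n a); first by exists b.
  by exists (\val a).
pose bt n a := sval (cid (bex n a)).
have btP n a : B n a -> (bt n a < \val a)%O /\ below_code (\val a) (bt n a) = n.
  exact: svalP (cid (bex n a)).
pose gen (n : nat) (a : L) : G := ofReal k (n.+1%:R^-1) *: single a (james_ind a (bt n a)).
apply: (@sub_finite_set _ _ (\bigcup_(n in `I_N) (gen n @` B n))); last first.
  apply: bigcup_finite; first exact: finite_II.
  by move=> n _; apply: finite_image.
move=> g [[->|[a [b [ba ->]]]] eg].
  by move: eg; rewrite (lin0 fl) kn0 leNgt e0.
set n := below_code (\val a) b in eg *.
have eg' : e <= n.+1%:R^-1 * kn (f (single a (james_ind a b))).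
  by apply: le_trans eg _; rewrite (linZ fl) knM kn_ofReal// ltW.
have Ba : B n a.
  exists b; split=> //; apply: le_trans eg' _.
  by rewrite ler_piMl ?kn_ge0// invf_le1// ler1n.
exists n.
  rewrite /=; apply: contrapT => /negP; rewrite -leqNgt => Nn.
  have := le_trans eg' (ler_wpM2l (ltW (scal n)) (norm1 a b)).
  rewrite leNgt mulrC ltr_pdivrMr ?ltr0Sn// => /negP; apply.
  rewrite mulrC -ltr_pdivrMr//; apply: lt_le_trans NP _.
  by rewrite ler_nat (leq_trans Nn).
exists a => //; rewrite /gen; have [h1 h2] := btP n a Ba.
by rewrite (@below_code_inj (\val a) (bt n a) b (ltW h1) (ltW ba) h2).
Qed.

Let clG := closure (lspan G_gen).

Let clG_lin z g h : clG g -> clG h -> clG (z *: g + h).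
Proof.
have [_ H] := @closed_span_submod K G G_gen.
by move=> Cu Cv; have := H z g h; rewrite !inE; apply.
Qed.

Let clG0 : clG 0.
Proof. by have [+ _] := @closed_span_submod K G G_gen; rewrite inE. Qed.

Let clG_sum (I : Type) (r : seq I) (F : I -> G) : (forall i, clG (F i)) -> clG (\sum_(i <- r) F i).
Proof.
move=> h; elim: r => [|i r IH]; first by rewrite big_nil.
by rewrite big_cons -[F i]scale1r; exact: clG_lin.
Qed.

Let clG_ind a b : (b < \val a)%O -> clG (single a (james_ind a b)).
Proof.
move=> ba; set n := below_code (\val a) b.
have -> : single a (james_ind a b) =
    ofReal k n.+1%:R *: (ofReal k (n.+1%:R^-1) *: single a (james_ind a b)) + 0.
  by rewrite addr0 scalerA -ofRealM divff ?pnatr_eq0// ofReal1 scale1r.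
apply: clG_lin; last exact: clG0.
apply: subset_closure; exists 1%N, (fun=> 1), (fun=> ofReal k (n.+1%:R^-1) *: single a (james_ind a b)).
by split=> [_|]; [right; exists a, b | rewrite big_ord1 scale1r].
Qed.

Let single_norm a (w : E a) : rnorm (single a w) <= rnorm w.
Proof.
apply: (powp_le_inv p1); [exact: rnorm_ge0 | exact: rnorm_ge0 |].
apply: G_norm_le => s us.
have [aS|aS] := boolP (a \in s).
  rewrite (bigD1_seq a)//= singleE eqxx big1 ?addr0; first exact: lexx.
  by move=> b ba; rewrite singleE (negPf ba) rnorm0 powp0.
rewrite big_seq big1; first exact: powR_ge0.
move=> b bs; rewrite singleE; case: eqP => [ba|_]; last by rewrite rnorm0 powp0.
by rewrite ba in bs; rewrite bs in aS.
Qed.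

Let clG_single a (w : E a) : clG (single a w).
Proof.
apply/closure_rnormP => e e0; have e20 : 0 < e / 2 by rewrite divr_gt0.
have sl := bop_linear (single_bop a).
have /closure_rnormP/(_ _ e20)[_ [n [c [d [hd ->]]]] wy] :
    closure (lspan [set ind b | b in [set b | (b < \val a)%O]]) (subspace_val w).
  by case: w => w /=; rewrite /subspace_pred inE.
have hd' i : exists b, (b < \val a)%O /\ ind b = d i by have [b ba bE] := hd i; exists b.
have [b bP] := choice hd'.
pose v : E a := \sum_(i < n) c i *: james_ind a (b i).
have cv : clG (single a v).
  rewrite (lin_sum sl); apply: clG_sum => i; rewrite (linZ sl) -[_ *: _]addr0.
  by apply: clG_lin; [apply: clG_ind; have [] := bP i | exact: clG0].
have vE : subspace_val v = \sum_(i < n) c i *: d i.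
  have h : linear (@subspace_val K J (james k p1 (\val a)) : E a -> J) by [].
  rewrite (lin_sum h); apply: eq_bigr => i _; rewrite (linZ h).
  by have [h1 <-] := bP i; rewrite james_indE.
have [u uA uP] := iffLR (closure_rnormP _ _) cv _ e20.
exists u => //; rewrite -[single a w](subrK (single a v)) -addrA (splitr e).
apply: le_trans (ler_rnormD _ _) _; apply: lerD; last exact: uP.
rewrite -(linB sl); apply: le_trans (single_norm _) _.
by rewrite -vE in wy; exact: wy.
Qed.

Definition G_coord g a : E a := lp_fun g a.

Lemma G_approx g (e : R) : 0 < e -> exists2 s : seq L, uniq s &
  rnorm (g - \sum_(a <- s) single a (G_coord g a)) <= e.
Proof.
move=> e0; have ep : 0 < e `^ p by rewrite powR_gt0.
have [s [us sP]] : exists s : seq L, uniq s /\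
    rnorm g `^ p - e `^ p <= \sum_(a <- s) rnorm (Gc g a) `^ p.
  apply: contrapT => h.
  have := @G_norm_le g (rnorm g `^ p - e `^ p); rewrite lerBrDl gerDr leNgt ep => H.
  suff : false by [].
  apply: H => s us; rewrite leNgt; apply/negP => /ltW hs; apply: h.
  by exists s.
exists s => //; apply: (powp_le_inv p1); [exact: rnorm_ge0 | exact: ltW |].
apply: G_norm_le => t ut.
have cE b : Gc (g - \sum_(a <- s) single a (G_coord g a)) b = if b \in s then 0 else Gc g b.
  have := Gc_lin (-1) (\sum_(a <- s) single a (G_coord g a)) g b.
  rewrite scaleN1r addrC => ->; rewrite scaleN1r.
  have -> : \sum_(a <- s) single a (G_coord g a) = \sum_(a <- s) 1 *: single a (G_coord g a).
    by apply: eq_bigr => a _; rewrite scale1r.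
  rewrite Gc_sum_single//; case: ifP => _; last by rewrite oppr0 add0r.
  by rewrite scale1r addNr.
pose t' := [seq b <- t | b \notin s].
have -> : \sum_(b <- t) rnorm (Gc (g - \sum_(a <- s) single a (G_coord g a)) b) `^ p =
    \sum_(b <- t') rnorm (Gc g b) `^ p.
  rewrite big_filter [RHS]big_mkcond; apply: eq_bigr => b _; rewrite cE.
  by case: ifP => // _; rewrite rnorm0 powp0.
have ust : uniq (s ++ t').
  rewrite cat_uniq us filter_uniq// andbT; apply/hasPn => b.
  by rewrite mem_filter => /andP[].
have := G_sum_le g ust; rewrite big_cat /= => h.
have := le_trans (lerD sP (lexx _)) h.
by rewrite -addrA gerDl addrC subr_le0.
Qed.

Lemma G_gen_dense : closure (lspan G_gen) = setT.
Proof.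
apply/seteqP; split=> // g _; apply/closure_rnormP => e e0.
have e20 : 0 < e / 2 by rewrite divr_gt0.
have [s us sP] := G_approx g e20.
have cl : clG (\sum_(a <- s) single a (G_coord g a)) by apply: clG_sum => a; exact: clG_single.
have [u uA uP] := iffLR (closure_rnormP _ _) cl _ e20.
exists u => //; rewrite -[g](subrK (\sum_(a <- s) single a (G_coord g a))) -addrA (splitr e).
apply: le_trans (ler_rnormD _ _) _; apply: lerD; [exact: sP | exact: uP].
Qed.

Lemma G_factor_wcg (S : G -> J) (U : J -> G) : bounded_operator S -> bounded_operator U ->
  wcg_operators J (S \o U).
Proof.
move=> bS bU; split; first exact: bop_comp.
exists (closed_span (range S)); split; first exact: null_range_wcg G_gen_null G_gen_dense.
move=> _ [x _ <-]; apply: subset_closure.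
exists 1%N, (fun=> 1), (fun=> S (U x)); split=> [_|]; first by exists (U x).
by rewrite big_ord1 scale1r.
Qed.

Lemma factoring_span_ker : factoring_span J G `<=` ker_Lambda k p1.
Proof.
have [_ I0 IL _] := ker_Lambda_ideal k p1.
move=> T [n [c [a [ha ->]]]].
elim: n c a ha => [|n IH] c a ha; first by rewrite big_ord0.
rewrite big_ord_recl; apply: IL; last by apply: IH => i; exact: ha.
have [S bS [U bU <-]] := ha ord0.
exact: (wcg_operators_ker (G_factor_wcg bS bU)).
Qed.

End G_space_theory.

(** * Factoring through the l_p-sum *)

Section interval_systems.
Context (R : realType) (k : scalar_kind) (p : R) (p1 : 1 < p).
Local Notation K := (scalarField R k).
Local Notation J := (long_james k p1).
Local Notation G := (G_space k p1).
Local Notation L := (limit_ordinal : Type).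

(** Sorting the indices by the left ends [lo] makes the concatenation of the lists [Q i] sorted. *)
Lemma vsum_disjoint (I : eqType) (s : seq I) (Q : I -> seq omega1) (lo hi : I -> omega1)
    (f : omega1 -> K) (M : R) : bvar p f M ->
  (forall i, i \in s -> sorted <=%O (Q i)) ->
  (forall i c, i \in s -> c \in Q i -> (lo i <= c <= hi i)%O) ->
  uniq s -> (forall i j, i \in s -> j \in s -> i != j -> (lo i <= lo j)%O -> (hi i <= lo j)%O) ->
  \sum_(i <- s) vsum p f (Q i) <= M.
Proof.
move=> fM Qs Qlh us dis; pose r i j := (lo i <= lo j)%O.
have rt : transitive r by move=> j i l; exact: le_trans.
have rtot : total r by move=> i j; exact: le_total.
pose t := sort r s; have st : perm_eq t s by rewrite perm_sort.
rewrite -(perm_big _ st) /= -(big_map Q predT (fun q => vsum p f q)).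
apply: (bvar_flatten fM); rewrite (sorted_pairwise le_trans).
have : pairwise r t by rewrite -(sorted_pairwise rt) sort_sorted.
have : uniq t by rewrite (perm_uniq st).
have : {subset t <= s} by move=> i; rewrite (perm_mem st).
elim: t {st} => //= i t IH ts /andP[it ut] /andP[ir tr]; rewrite pairwise_cat.
have is_ : i \in s by apply: ts; rewrite mem_head.
have ts' : {subset t <= s} by move=> j jt; apply: ts; rewrite inE jt orbT.
apply/and3P; split; last exact: IH.
  apply/allrelP => c d cQ /flattenP[_ /mapP[j jt ->] dQ].
  have /andP[_ ch] := Qlh i c is_ cQ; have /andP[dl _] := Qlh j d (ts' _ jt) dQ.
  apply: le_trans ch _; apply: le_trans _ dl; apply: dis => //; first exact: ts'.
    by apply: contra it => /eqP ->.
  by move/allP : ir; apply.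
by rewrite -(sorted_pairwise le_trans); exact: Qs.
Qed.

Lemma bvar_shift (f : omega1 -> K) (z : K) (M : R) : bvar p f M -> bvar p (fun a => f a + z) M.
Proof.
move=> fM s ss; apply: le_trans (fM s ss).
apply: le_trans (vsum_comb (C := 1) (F := [:: tt]) (fi := fun=> f) _) _.
  by move=> a c _ _; rewrite big_seq1 mul1r /jmp opprD addrACA subrr addr0.
by rewrite big_seq1 mul1r.
Qed.

Lemma limit_above_seq (a : omega1) (s : seq omega1) : limit_ordinal a ->
  exists2 b, (b < a)%O & forall c, c \in s -> (c < a)%O -> (c < b)%O.
Proof.
move=> la; elim: s => [|c s [b ba bP]].
  by have [[b ba] _] := la; exists b.
have [ca|ac] := ltP c a; last first.
  exists b => // d; rewrite inE => /orP[/eqP ->|ds da]; last exact: bP.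
  by rewrite ltNge ac.
exists (Order.max b (osucc c)); first by rewrite gt_max ba limit_osucc.
move=> d; rewrite inE => /orP[/eqP ->|ds da]; first by rewrite lt_max lt_osucc orbT.
by rewrite lt_max bP.
Qed.

Lemma G_finite (g : G) (e : R) : 0 < e -> finite_set [set a : L | e <= rnorm (Gc g a)].
Proof.
move=> e0; apply: contrapT => /infinite_set_fset inf.
have ep : 0 < e `^ p by rewrite powR_gt0.
have [C CB mC] := inf (Num.bound (rnorm g `^ p / e `^ p)).
have h : (size (finmap.enum_fset C))%:R * e `^ p <= rnorm g `^ p.
  apply: le_trans (G_sum_le g (finmap.fset_uniq C)).
  rewrite mulr_natl -[X in _ *+ X]sum1_size -sumrMnr big_seq [leRHS]big_seq.
  apply: ler_sum => a aC; rewrite mulr1n; apply: (powp_le p1 (ltW e0)).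
  exact: CB.
have := archi_boundP (divr_ge0 (powR_ge0 (rnorm g) p) (ltW ep)).
rewrite ltNge => /negP; apply; rewrite ler_pdivlMr//.
by apply: le_trans h; rewrite ler_pM2r// ler_nat.
Qed.

(** * Restriction to a disjoint family of intervals, and extension from it *)

Section system.
(** [v] selects the indices that carry an interval, since a given club produces gaps for only some
    limit ordinals. *)
Variables (c b : L -> omega1) (v : L -> Prop).
Let tail (a : L) : set omega1 := [set x | (c a <= x)%O].
Let tailC a : club (tail a). Proof. exact: club_tail. Qed.
Let sh (a : L) := enumc (tail a).
Let sh' (a : L) := denumc (tail a).
Let P (a : L) (g : omega1) := v a /\ (c a <= g <= b a)%O.
Hypothesis cb : forall a, v a -> (c a <= b a)%O.
Hypothesis bsh : forall a, v a -> (b a <= sh a (\val a))%O.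
Hypothesis cn : forall a, v a -> ~ limit_ordinal (c a).
Hypothesis dis : forall a a' g, P a g -> P a' g -> a = a'.

Let t a g := Order.min (sh a g) (b a).

Let t_homo a : {homo t a : x y / (x <= y)%O}.
Proof.
by move=> x y xy; rewrite /t le_min !ge_min lexx orbT andbT /sh enumc_mono// xy.
Qed.

Let t_lcont a : lcont (t a).
Proof.
apply: (@comp_lcont (fun x => Order.min x (b a)) (sh a)).
- by move=> x y xy; rewrite le_min !ge_min lexx orbT xy.
- exact: min_lcont.
- by move=> x y xy; rewrite /sh enumc_mono.
- exact: enumc_lcont.
Qed.

Let t_in a g : v a -> P a (t a g).
Proof.
move=> va; split=> //; rewrite /t le_min ge_min lexx orbT andbT cb// andbT.
exact: (enumc_in (tailC a) g).
Qed.

Lemma interval_restriction : exists U : J -> G, [/\ bounded_operator U,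
  forall (x : J) a g, v a -> Gc (U x) a g = x (t a g) - x (b a) &
  forall (x : J) a, ~ v a -> Gc (U x) a = 0].
Proof.
pose h (x : J) (a : L) (g : omega1) : K := if `[< v a >] then x (t a g) - x (b a) else 0.
have h_zero x a g : (\val a <= g)%O -> h x a g = 0.
  move=> ag; rewrite /h; case: asboolP => // va.
  suff -> : t a g = b a by rewrite subrr.
  by apply/min_idPr/(le_trans (bsh va)); rewrite /sh enumc_mono.
have h_var x a : v a -> bvar p (h x a) (rnorm x `^ p).
  move=> va; rewrite /h asboolT//; apply: bvar_shift.
  by apply: (bvar_comp (@t_homo a)); exact: bvar_norm.
have [H HE] : exists H : J -> L -> J, forall x a g, H x a g = h x a g.
  have ex (x : J) (a : L) : exists H : J, forall g, H g = h x a g.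
    have [va|nva] := pselect (v a); last by exists 0 => g; rewrite /h asboolF.
    have hc : leftcont (h x a).
      rewrite /h asboolT//; apply: leftcontD; last exact: leftcont_cst.
      by apply: leftcont_comp; [exact: t_homo | exact: t_lcont | exact: lj_leftcont].
    by exists (LongJames (in_lj p1 hc (ex_intro _ _ (h_zero x a)) (h_var x a va))).
  have exx x := choice (ex x).
  by exists (fun x => projT1 (exx x)) => x; exact: (projT2 (exx x)).
(* The bound 2 absorbs the factor 2 of [near_max], as 2 <= 2^p. *)
have [||||U bU UE] := @G_op R k p p1 J H 2 => //.
- by move=> x a; apply: jamesP; [have := valP a; rewrite inE | move=> g /h_zero; rewrite HE].
- move=> z x y a; apply: lj_eqP => g; rewrite ljD ljZ !HE /h.
  case: asboolP => _; last by rewrite mulr0 addr0.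
  by rewrite !ljD !ljZ mulrBr opprD addrACA.
- move=> x s us; rewrite powRM ?rnorm_ge0//.
  have Sex a : exists q, sorted <=%O q /\ rnorm (H x a) `^ p <= 2 * vsum p (H x a) q.
    by have [q q1 q2] := near_max (H x a); exists q.
  have [S SP] := choice Sex.
  pose s' := [seq a <- s | `[< v a >]].
  apply: (@le_trans _ _ (\sum_(a <- s') 2 * vsum p x (map (t a) (S a)))).
    rewrite big_filter [leRHS]big_mkcond; apply: ler_sum => a _.
    case: asboolP => va; last first.
      have -> : H x a = 0 by apply: lj_eqP => g; rewrite HE /h asboolF.
      by rewrite rnorm0 powp0.
    apply: le_trans (SP a).2 _; rewrite ler_pM2l// -vsum_map.
    apply: le_trans (vsum_comb (C := 1) (F := [:: tt]) (fi := fun=> x \o t a) _) _.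
      by move=> d e _ _; rewrite big_seq1 mul1r /jmp !HE /h asboolT//= opprB addrA subrK.
    by rewrite big_seq1 mul1r.
  rewrite -mulr_sumr; apply: ler_pM => //.
  + by apply: sumr_ge0 => a _; exact: vsum_ge0.
  + by rewrite -{1}(powRr1 (ler0n R 2)) ler_powR ?ler1n// ltW.
  have vs a : a \in s' -> v a by rewrite mem_filter => /andP[/asboolP].
  apply: (@vsum_disjoint _ s' (fun a => map (t a) (S a)) c b x _ (bvar_norm x)).
  + by move=> a _; apply: (homo_sorted (@t_homo a)); have [] := SP a.
  + by move=> a d /vs va /mapP[g _ ->]; have [] := t_in g va.
  + exact: filter_uniq.
  + move=> a a' /vs va /vs va' aa' cc; rewrite leNgt; apply/negP => ba.
    by move/eqP: aa'; apply; apply: (dis (g := c a')); split=> //; rewrite ?cc ?lexx ?(ltW ba)//= cb.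
exists U; split=> // [x a g va|x a nva]; first by rewrite UE HE /h asboolT.
by apply: lj_eqP => g; rewrite UE HE /h asboolF.
Qed.

Let D (g : G) (a : L) (x : omega1) : K := Gc g a (sh' a x) - Gc g a (sh' a (b a)).

Let lab (x : omega1) : option L :=
  if pselect (exists a, P a x) is left h then Some (sval (cid h)) else None.

Let labP a x : P a x -> lab x = Some a.
Proof.
move=> Pax; rewrite /lab; case: pselect => [h|nh]; last by case: nh; exists a.
by congr Some; apply: (dis _ Pax); exact: svalP (cid h).
Qed.

Let lab_some a x : lab x = Some a -> P a x.
Proof. by rewrite /lab; case: pselect => // h [<-]; exact: svalP (cid h). Qed.

Let F (g : G) (x : omega1) : K := if lab x is Some a then D g a x else 0.

Let B (g : G) (a : L) (x : omega1) : K := if (c a <= x <= b a)%O then D g a x else 0.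

Let cl a x := Order.min (Order.max x (c a)) (b a).

Let cl_homo a : {homo cl a : x y / (x <= y)%O}.
Proof.
move=> x y xy; rewrite /cl le_min !ge_min lexx orbT andbT.
by rewrite ge_max !le_max xy lexx !orbT.
Qed.

(** Clamping to the interval already gives 0 to the right of [b a]; to the left of [c a] it gives
    the constant [kap], removed with an indicator of an initial segment. That segment ends at the
    predecessor of the nonlimit [c a]. *)
Let B_var g a : v a -> bvar p (B g a) (c2 p * (rnorm (Gc g a) `^ p *+ 2)).
Proof.
move=> va; set y := Gc g a; pose m := - y (sh' a (b a)).
pose kap := y (sh' a (c a)) + m.
have h1 : bvar p (fun x => y (sh' a (cl a x)) + m) (rnorm y `^ p).
  apply: bvar_shift; apply: (@bvar_comp _ _ _ _ (sh' a \o cl a) _ _ (bvar_norm y)).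
  by move=> u w uw; rewrite /= /sh'; exact: (denumc_homo (tailC a) (cl_homo a uw)).
have kn_kap : kn (- kap) `^ p <= rnorm y `^ p.
  by apply: (powp_le p1 (kn_ge0 _)); rewrite knN; exact: kn_diff_le.
have h2 : bvar p (fun x => - kap * (if (x < c a)%O then 1 else 0)) (rnorm y `^ p).
  have [cz|[e ce]] := nonlimitP (cn va).
    apply: bvar_le (bvar_ext _ (bvar_cst p1 0)); first exact: powR_ge0.
    by move=> x /=; rewrite cz ltNge ozero_le mulr0.
  apply: bvar_le (bvar_ext _ (bvarZ (- kap) (bvar_ind k p1 e))); first by rewrite mulr1.
  by move=> x /=; rewrite ce lt_osuccE -(indE k p1).
apply: bvar_ext (bvarD p1 h1 h2) => x; rewrite /B /D -/y /cl.
have [xc|cx] := ltP x (c a).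
  by rewrite (min_idPl (cb va)) mulr1 /kap /= subrr.
by rewrite mulr0 addr0 /=; case: (leP x (b a)) => xb //; rewrite subrr.
Qed.

Let F_blk g (s : seq omega1) x : x \in s ->
  blk (undup (pmap lab s)) (B g) (F g) x.
Proof.
move=> xs; have mem a y : y \in s -> lab y = Some a -> a \in undup (pmap lab s).
  by move=> ys ya; rewrite mem_undup mem_pmap -ya map_f.
have memv a : a \in undup (pmap lab s) -> v a.
  by rewrite mem_undup mem_pmap => /mapP[y _ /esym/lab_some[]].
rewrite /blk; case lx: (lab x) => [a|]; last first.
  left; split=> [|i /memv vi]; first by rewrite /F lx.
  rewrite /B; case: ifP => // cxb; have Pix : P i x by split.
  by move: lx; rewrite (labP Pix).
have [va cxb] := lab_some lx; right; exists a; split; first exact: mem lx.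
  by rewrite /F lx /B cxb.
move=> i /memv vi ia; rewrite /B; case: ifP => // cxb'.
have Pix : P i x by split.
by move: lx ia; rewrite (labP Pix) => -[->]; rewrite eqxx.
Qed.

(** A list meets finitely many intervals, so the block estimate applies. The 8 collects three
    factors 2^p: the block estimate, [B_var], and a bound for the 2 in [B_var]. *)
Let F_var g : bvar p (F g) ((8 * rnorm g) `^ p).
Proof.
move=> s ss; have uF : uniq (undup (pmap lab s)) by exact: undup_uniq.
have memv a : a \in undup (pmap lab s) -> v a.
  by rewrite mem_undup mem_pmap => /mapP[y _ /esym/lab_some[]].
apply: le_trans (blk_vsum p1 uF (@F_blk g s)) _.
apply: (@le_trans _ _ (c2 p * \sum_(a <- undup (pmap lab s)) c2 p * (c2 p * rnorm (Gc g a) `^ p))).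
  rewrite ler_pM2l ?c2_gt0// big_seq [leRHS]big_seq; apply: ler_sum => a /memv va.
  apply: le_trans (B_var g va ss) _; rewrite ler_pM2l ?c2_gt0// -mulr_natl ler_wpM2r ?powR_ge0//.
  by rewrite /c2 -{1}(powRr1 (ler0n R 2)) ler_powR ?ler1n// ltW.
rewrite -!mulr_sumr !mulrA -[8](_ : 2 * 2 * 2 = 8); last by lra.
rewrite !powRM ?mulr_ge0 ?rnorm_ge0 ?ler0n//; apply: ler_wpM2l.
  by rewrite !mulr_ge0 ?powR_ge0.
exact: G_sum_le.
Qed.

Let D_le g a x : kn (D g a x) <= rnorm (Gc g a).
Proof. exact: kn_diff_le. Qed.

(** Only countably many coordinates of [g] are nonzero, so the right ends of their intervals are
    bounded. *)
Let F_zero g : exists a, forall x, (a <= x)%O -> F g x = 0.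
Proof.
pose A := \bigcup_n [set a : L | n.+1%:R^-1 <= rnorm (Gc g a)].
have cA : countable A.
  apply: bigcup_countable => // n _; apply: finite_set_countable; apply: G_finite.
  by rewrite invr_gt0.
have [z zP] := countable_bound (sub_countable (card_image_le b A) cA).
exists z => x zx; rewrite /F; case lx: (lab x) => [a|//].
have [va /andP[_ xb]] := lab_some lx.
apply: kn_le0_eq => e e0; apply: le_trans (D_le _ _ _) _.
rewrite leNgt; apply/negP => ea; have [n] := @ltr_add_invr R 0 e e0; rewrite add0r => ne.
have /zP : (b @` A) (b a) by exists a => //; exists n => //=; apply/ltW/(lt_trans ne ea).
by rewrite ltNge (le_trans zx xb).
Qed.

(** At a limit point outside all intervals, the finitely many coordinates of norm at least e have
    intervals that stay away from it on the left, and the others contribute less than e. Inside an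
    interval, the point lies strictly after the nonlimit left end. *)
Let F_leftcont g : leftcont (F g).
Proof.
move=> x lx e e0; case Lx: (lab x) => [a|]; last first.
  have [s sE] := iffLR (finite_seqP _) (finite_image b (G_finite g e0)).
  have [d dx dP] := limit_above_seq s lx.
  exists d => // y dy yx; rewrite {2}/F Lx subr0 /F; case ly: (lab y) => [a|]; last first.
    by rewrite kn0 ltW.
  have [va /andP[cy yb]] := lab_some ly; apply: le_trans (D_le _ _ _) _.
  rewrite leNgt; apply/negP => ea.
  have bs : b a \in s by have : [set` s] (b a) by rewrite -sE; exists a => //; exact: ltW.
  have [bx|xb] := ltP (b a) x.
    by have := dP _ bs bx; rewrite ltNge (le_trans dy yb).
  by rewrite (@labP a x) in Lx => //; split=> //; rewrite xb (le_trans cy yx).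
have [va /andP[cx xb]] := lab_some Lx.
have cx' : (c a < x)%O.
  by rewrite lt_neqAle cx andbT; apply/eqP => cE; apply: (cn va); rewrite cE.
have lc : leftcont (D g a).
  apply: leftcontD; last exact: leftcont_cst.
  apply: (@leftcont_comp _ _ (Gc g a) (sh' a)); last exact: lj_leftcont.
    by move=> u w uw; exact: (denumc_homo (tailC a) uw).
  exact: denumc_lcont.
have [s sx sP] := lc x lx e e0; exists (Order.max s (c a)); first by rewrite gt_max sx.
move=> y; rewrite ge_max => /andP[sy cy] yx.
have Ly : lab y = Some a by apply: labP; split=> //; rewrite cy (le_trans yx).
by rewrite /F Lx Ly; exact: sP.
Qed.

Lemma interval_extension : exists S : G -> J, [/\ bounded_operator S,
  forall g a x, v a -> (c a <= x <= b a)%O -> S g x = Gc g a (sh' a x) - Gc g a (sh' a (b a)) &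
  forall g x, (forall a, v a -> ~ (c a <= x <= b a)%O) -> S g x = 0].
Proof.
have [|S bS SE] := @lift_op R k p p1 G F 8 (ler0n R 8) F_leftcont F_zero _ F_var.
  move=> z u w x; rewrite /F; case: (lab x) => [a|]; last by rewrite mulr0 addr0.
  by rewrite /D !Gc_lin !ljD !ljZ mulrBr opprD addrACA.
exists S; split=> // [g a x va cxb|g x nP]; rewrite SE /F.
  by rewrite (@labP a x)//.
by case lx: (lab x) => [a|//]; have [va /nP] := lab_some lx.
Qed.

End system.

Section restriction_extension.
Variables (c b : L -> omega1) (v : L -> Prop).
Let tl (a : L) : set omega1 := [set x | (c a <= x)%O].
Let tlC a : club (tl a). Proof. exact: club_tail. Qed.

(* Here [enumc [set x | c a <= x]] is the order isomorphism of omega_1 onto the final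
   segment from [c a]. The [a]-th coordinate of [U x] is [x] on the interval from [c a] to
   [b a], pulled back along it, and [S g] pushes the coordinates forward; both subtract
   the value at [b a], so that the results are continuous and lie in [james a]. *)
Lemma interval_operators :
  (forall a, v a -> (c a <= b a)%O) ->
  (forall a, v a -> (b a <= enumc [set x | (c a <= x)%O] (\val a))%O) ->
  (forall a, v a -> ~ limit_ordinal (c a)) ->
  (forall a a' x, v a -> v a' -> (c a <= x <= b a)%O -> (c a' <= x <= b a')%O -> a = a') ->
  exists (S : G -> J) (U : J -> G),
    [/\ bounded_operator S, bounded_operator U,
      forall (x : J) a g, v a -> (c a <= g <= b a)%O -> S (U x) g = x g - x (b a),
      forall (g : G) x, (forall a, v a -> ~ (c a <= x <= b a)%O) -> S g x = 0 &
      (forall x : J, (forall a g, v a -> (c a <= g <= b a)%O -> x g = 0) -> U x = 0) /\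
      ((forall a, v a) -> (forall a, b a = enumc [set x | (c a <= x)%O] (\val a)) ->
        cancel S U)].
Proof.
move=> cb bsh cn dis.
have dis' a a' x : (v a /\ (c a <= x <= b a)%O) -> (v a' /\ (c a' <= x <= b a')%O) -> a = a'.
  by move=> [va ca] [va' ca']; exact: (dis a a' x).
have [S [bS SE S0]] := interval_extension cb cn dis'.
have [U [bU UE U0]] := interval_restriction cb bsh dis'.
exists S, U; split=> //.
- move=> x a g va cgb; rewrite (SE _ a)// !UE//.
  have /andP[cg gb] := cgb.
  have e1 : enumc (tl a) (denumc (tl a) g) = g := denumcK (tlC a) cg.
  have e2 : enumc (tl a) (denumc (tl a) (b a)) = b a := denumcK (tlC a) (le_trans cg gb).
  by rewrite -/(tl a) e1 e2 minxx (min_idPl gb) subrr subr0.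
- split=> [x xz|va bE g].
    apply: Gc_inj => a; have [va|/U0 //] := pselect (v a).
    apply: lj_eqP => g; rewrite UE//.
    have e1 : (c a <= enumc (tl a) g)%O := enumc_in (tlC a) g.
    rewrite !(xz a)//; first exact: subrr.
      by rewrite cb ?lexx.
    by rewrite le_min e1 cb// ge_min lexx orbT.
  apply: Gc_inj => a; apply: lj_eqP => x; rewrite UE//.
  have cE y : (c a <= enumc (tl a) y)%O := enumc_in (tlC a) y.
  have [xa|ax] := leP x (\val a).
    have xb : (enumc (tl a) x <= b a)%O by rewrite bE (enumc_mono (tlC a)).
    rewrite (min_idPl xb) !(SE _ a)// ?cE ?xb// ?lexx ?andbT ?cb//.
    rewrite subrr subr0 (enumcK (tlC a)) bE (enumcK (tlC a)).
    by rewrite (Gc_zero g (lexx (\val a))) subr0.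
  have bx : (b a <= enumc (tl a) x)%O by rewrite bE (enumc_mono (tlC a)) ltW.
  by rewrite (min_idPr bx) subrr (Gc_zero g (ltW ax)).
Qed.

End restriction_extension.

Lemma ker_factors_through_G (T : J -> J) : ker_Lambda k p1 T ->
  exists (S : G -> J) (U : J -> G), [/\ bounded_operator S, bounded_operator U & S \o U = T].
Proof.
move=> /ker_LambdaP[bT [D0 cD0 DP]].
pose D := D0 `&` limit_ordinal; have cD : club D by apply: clubI => //; exact: club_limit.
pose c (a : L) := least [set x | forall d, D d -> (d < \val a)%O -> (d < x)%O].
have cP (a : L) d : D d -> (d < \val a)%O -> (d < c a)%O.
  by apply: (@least_in [set x | forall d, D d -> (d < \val a)%O -> (d < x)%O] (\val a)).
have cle (a : L) x : (forall d, D d -> (d < \val a)%O -> (d < x)%O) -> (c a <= x)%O.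
  exact: least_le.
pose v (a : L) := D (\val a) /\ ~ limit_ordinal (c a).
have [||||S [U [bS bU SU S0 _]]] := @interval_operators c (fun a => \val a) v.
- by move=> a _; apply: cle.
- by move=> a _; exact: (enumc_ge (club_tail (c a))).
- by move=> a [].
- have key (a a' : L) x : v a -> v a' -> (x <= \val a)%O -> (c a' <= x)%O -> (\val a < \val a')%O -> False.
    move=> [Da _] [Da' _] xa cx aa'.
    by have := cP a' _ Da aa'; rewrite ltNge (le_trans cx xa).
  move=> a a' x va va' /andP[ca xa] /andP[ca' xa']; apply: val_inj.
  apply/eqP; rewrite eq_le !leNgt; apply/andP; split; apply/negP => h.
    exact: (key a' a x).
  exact: (key a a' x).
exists S, (U \o T); split; [exact: bS | exact: bop_comp |].
apply/funext => x; apply: lj_eqP => g /=.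
have Tz d : D d -> T x d = 0 by move=> [/DP -> _]; rewrite mul0r.
(* On a gap, subtracting the value at its right end changes nothing, because [T x] vanishes on [D].
   A point outside the gaps must lie in [D]: otherwise the next element of [D] would end a gap
   around it. *)
have [[a [va cga]]|nv] := pselect (exists a : L, v a /\ (c a <= g <= \val a)%O).
  by rewrite (SU _ a)// (Tz (\val a)) ?subr0//; case: va.
rewrite S0; last by move=> a va cga; apply: nv; exists a.
apply/esym; have [Dn gn nmin] := nextP g cD.
have [gE|gn'] := eqVneq g (next D g); first by apply: Tz; rewrite gE.
have gn2 : (g < next D g)%O by rewrite lt_neqAle gn' gn.
pose a : L := exist _ (next D g) (mem_set Dn.2).
case: nv; exists a.
have cg : (c a <= g)%O.
  apply: cle => d Dd da; rewrite ltNge; apply/negP => gd.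
  by move: da; rewrite /= ltNge nmin.
split; last by rewrite cg ltW.
split=> // lc.
(* A limit [c a] is a supremum of points of [D], hence in [D]; being below [a], it would be below
   itself. *)
have Dc : D (c a).
  have /closed_omega1P := clubW cD; apply => // s sc.
  apply: contrapT => h; have : (c a <= s)%O; last by rewrite leNgt sc.
  apply: cle => d Dd da; rewrite ltNge; apply/negP => sd; apply: h.
  by exists d => //; rewrite sd ltW// cP.
by have := cP a (c a) Dc (le_lt_trans cg gn2); rewrite ltxx.
Qed.

Lemma ker_factoring_span : ker_Lambda k p1 `<=` factoring_span J G.
Proof.
move=> T /ker_factors_through_G[S [U [bS bU <-]]].
exists 1%N, (fun=> 1), (fun=> S \o U); split=> [_|]; last by rewrite big_ord1 scale1r.
by exists S => //; exists U.
Qed.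

Lemma ker_wcg_operators : ker_Lambda k p1 `<=` wcg_operators J.
Proof.
move=> T /ker_factors_through_G[S [U [bS bU <-]]]; exact: G_factor_wcg.
Qed.

End interval_systems.

(** * Compressible operators *)

Section compressible_operators.
Context (R : realType) (k : scalar_kind) (p : R) (p1 : 1 < p).
Local Notation K := (scalarField R k).
Local Notation J := (long_james k p1).
Local Notation G := (G_space k p1).
Local Notation L := (limit_ordinal : Type).

(** A row of [M i] is fixed by [M i] and killed by every other [M j]. Nonzero rows taken from n+1 of
    the matrices would thus be n+1 independent vectors in dimension n. *)
Lemma orthogonal_idempotents n (M : nat -> 'M[K]_n) :
  (forall i, M i *m M i = M i) -> (forall i j, i <> j -> M i *m M j = 0) ->
  exists i, M i = 0.
Proof.
move=> Mi Mo; apply: contrapT => h.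
have nz i : exists r : 'I_n, row r (M i) != 0.
  apply: contrapT => hr; apply: h; exists i; apply/row_matrixP => r.
  rewrite row0; apply/eqP; apply: contrapT => /negP nr; apply: hr; by exists r.
have [r rP] := choice nz.
pose W : 'M[K]_(n.+1, n) := \matrix_(i < n.+1) row (r i) (M i).
have WM (u : 'rV_n.+1) (j : 'I_n.+1) : u *m W *m M j = u 0 j *: row (r j) (M j).
  rewrite -mulmxA mulmx_sum_row (bigD1 j)//= big1 ?addr0.
    by congr (_ *: _); rewrite row_mul rowK -row_mul Mi.
  move=> i ij; rewrite row_mul rowK -row_mul Mo ?row0 ?scaler0//.
  by move=> /ord_inj/eqP; rewrite (negPf ij).
have : row_free W.
  rewrite -kermx_eq0; apply/rowV0P => u /sub_kermxP uW.
  apply/rowP => j; rewrite mxE; apply/eqP.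
  have := WM u j; rewrite uW mul0mx => /esym/eqP.
  by rewrite scaler_eq0 (negPf (rP j)) orbF.
rewrite -row_leq_rank => nW; have := leq_trans nW (rank_leq_col W).
by rewrite ltnn.
Qed.

Lemma rnorm_power (X : normedModType K) n (f : power X n) :
  rnorm f = \sum_(i < n) rnorm (f i).
Proof.
apply: (@ofReal_inj R k); rewrite rnormE -[LHS]/(\sum_(i < n) `|f i|).
elim/big_rec2: _ => [|i a b _ ->]; first by rewrite ofReal0.
by rewrite ofRealD rnormE.
Qed.

Definition pin n (j : 'I_n) (x : J) : power J n := fun i => if i == j then x else 0.

Lemma pin_bop n (j : 'I_n) : bounded_operator (pin j).
Proof.
apply: (@bop_mk _ _ _ _ _ 1) => [z u w|x].
  apply/funext => i; rewrite /pin -[RHS]/(z *: (if i == j then u else 0) + (if i == j then w else 0)).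
  by case: ifP => // _; rewrite scaler0 addr0.
rewrite mul1r rnorm_power (bigD1 j)//= big1 => [|i ij].
  by rewrite addr0 /pin eqxx.
by rewrite /pin (negPf ij) rnorm0.
Qed.

Lemma proj_bop n (i : 'I_n) : bounded_operator (fun f : power J n => f i).
Proof.
apply: (@bop_mk _ _ _ _ _ 1) => // f; rewrite mul1r rnorm_power (bigD1 i)//= lerDl.
by apply: sumr_ge0 => j _; exact: rnorm_ge0.
Qed.

Lemma power_decomp n (f : power J n) : f = \sum_(j < n) pin j (f j).
Proof.
apply/funext => i.
have /= -> := lin_sum (bop_linear (proj_bop i)) (index_enum 'I_n) predT (fun j => pin j (f j)).
rewrite (bigD1 i)//= big1 => [|j ji]; first by rewrite addr0 /pin eqxx.
by rewrite /pin eq_sym (negPf ji).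
Qed.

Lemma eigenvalue_ext (T T' : J -> J) z : (forall x, T x = T' x) ->
  eventual_eigenvalue T z -> eventual_eigenvalue T' z.
Proof. by move=> TT' [D cD DP]; exists D => // x a Da; rewrite -TT' DP. Qed.

Lemma eigenvalue_sum (I : Type) (r : seq I) (T : I -> J -> J) (z : I -> K) :
  (forall i, eventual_eigenvalue (T i) (z i)) ->
  eventual_eigenvalue (fun x => \sum_(i <- r) T i x) (\sum_(i <- r) z i).
Proof.
move=> h; elim: r => [|i r IH].
  rewrite big_nil; apply: eigenvalue_ext (eigenvalue0 k p1) => x.
  by rewrite big_nil.
rewrite big_cons -[z i]mul1r; apply: eigenvalue_ext (eigenvalue_lin 1 (h i) IH) => x.
by rewrite big_cons -[T i x in RHS]scale1r.
Qed.

Definition Lambda_mx n (Q : power J n -> power J n) : 'M[K]_n :=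
  \matrix_(i, j) Lambda (fun x : J => Q (pin j x) i).

Let entry_bop n (Q : power J n -> power J n) i j : bounded_operator Q ->
  bounded_operator (fun x : J => Q (pin j x) i).
Proof. by move=> bQ; exact: (bop_comp (proj_bop i) (bop_comp bQ (pin_bop j))). Qed.

Lemma Lambda_mx_comp n (Q Q' : power J n -> power J n) :
  bounded_operator Q -> bounded_operator Q' ->
  Lambda_mx (Q \o Q') = Lambda_mx Q *m Lambda_mx Q'.
Proof.
move=> bQ bQ'; apply/matrixP => i j; rewrite !mxE.
under eq_bigr do rewrite !mxE.
apply: Lambda_eq.
apply: (@eigenvalue_ext (fun x => \sum_(l < n) ((fun y => Q (pin l y) i) \o (fun x => Q' (pin j x) l)) x)).
  move=> x /=; rewrite [Q' (pin j x) in RHS]power_decomp.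
  have bPQ := bop_comp (proj_bop i) bQ.
  by have /= -> := lin_sum (bop_linear bPQ) (index_enum 'I_n) predT (fun l => pin l (Q' (pin j x) l)).
apply: eigenvalue_sum => l.
exact: eigenvalue_comp (LambdaP (entry_bop i l bQ)) (LambdaP (entry_bop l j bQ')).
Qed.

Lemma Lambda_mx0 n : Lambda_mx (0 : power J n -> power J n) = 0.
Proof.
apply/matrixP => i j; rewrite !mxE; apply: Lambda_eq.
by apply: eigenvalue_ext (eigenvalue0 k p1) => x.
Qed.

Lemma compressible_ker : compressible J `<=` ker_Lambda k p1.
Proof.
move=> T [bT [n [Q [Qp Qo QT]]]]; split=> //.
have [i Qi0] : exists i, Lambda_mx (Q i) = 0.
  apply: orthogonal_idempotents => [i|i j ij].
    by have [bQ QQ] := Qp i; rewrite -(Lambda_mx_comp bQ bQ) QQ.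
  have [bQi _] := Qp i; have [bQj _] := Qp j.
  by rewrite -(Lambda_mx_comp bQi bQj) (Qo i j ij); exact: Lambda_mx0.
have [A [B [bA bB TE]]] := QT i; have [bQ _] := Qp i.
apply: Lambda_eq.
have eA l : eventual_eigenvalue (fun x => A (pin l x)) (Lambda (fun x => A (pin l x))).
  by apply: LambdaP; exact: (bop_comp bA (pin_bop l)).
have eB l : eventual_eigenvalue (fun x => B x l) (Lambda (fun x => B x l)).
  by apply: LambdaP; exact: (bop_comp (proj_bop l) bB).
have eQ l m : eventual_eigenvalue (fun x => Q i (pin m x) l) 0.
  have <- : Lambda_mx (Q i) l m = 0 by rewrite Qi0 mxE.
  by rewrite mxE; exact: LambdaP (entry_bop l m bQ).
have key l m : eventual_eigenvalue
    ((fun x => A (pin l x)) \o ((fun x => Q i (pin m x) l) \o (fun x => B x m))) 0.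
  have := eigenvalue_comp (eA l) (eigenvalue_comp (eQ l m) (eB m)).
  by rewrite mul0r mulr0.
(* Splitting both the argument and the value of [Q i] into coordinates writes [T] as a double sum
   over the entries of [Q i], all of character 0. *)
have e2 := eigenvalue_sum (index_enum 'I_n) (fun m => eigenvalue_sum (index_enum 'I_n) (fun l => key l m)).
rewrite [X in eventual_eigenvalue _ X]big1 in e2; last by move=> m _; rewrite big1.
apply: eigenvalue_ext e2 => x /=; rewrite TE /= [B x in RHS]power_decomp.
have bAQ := bop_comp bA bQ.
have /= -> := lin_sum (bop_linear bAQ) (index_enum 'I_n) predT (fun m => pin m (B x m)).
apply: eq_bigr => m _; rewrite [Q i (pin m (B x m)) in RHS]power_decomp.
by rewrite (lin_sum (bop_linear bA)).
Qed.

(** * Orthogonal complemented copies of the l_p-sum *)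

Lemma iter_osucc_inj (a a' : omega1) m n : limit_ordinal a -> limit_ordinal a' ->
  iter m osucc a = iter n osucc a' -> a = a' /\ m = n.
Proof.
move=> la la'; elim: m n => [|m IH] [|n] /=.
- by move=> ->.
- by move=> aE; case: (@nonlimit_osucc (iter n osucc a')); rewrite -aE.
- by move=> aE; case: (@nonlimit_osucc (iter m osucc a)); rewrite aE.
- by move=> /osucc_inj/IH[-> ->].
Qed.

Lemma iter_osucc_ge a n : (a <= iter n osucc a)%O.
Proof. by elim: n => [|n IH] //=; apply: le_trans IH (le_osucc _). Qed.

(* [E] enumerates a club closed under [(d, a) |-> ] the [a]-th element after [d], so the
   gap following its [a]-th element has order type greater than [a]. *)
Lemma long_gaps : exists2 E : omega1 -> omega1, {homo E : a b / (a < b)%O} &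
  forall a b, (b <= a)%O -> (enumc [set x | (osucc (E a) <= x)%O] b < E (osucc a))%O.
Proof.
pose f (d b : omega1) := enumc [set x | (osucc d <= x)%O] b.
have gex (c : omega1) : exists g, forall d b, (d <= c)%O -> (b <= c)%O -> (f d b < g)%O.
  have below (h : omega1 -> omega1) : exists g, forall e, (e <= c)%O -> (h e < g)%O.
    have [g gP] := countable_bound (sub_countable (card_image_le h _) (omega1_countable_below c)).
    by exists g => e ec; apply: gP; exists e.
  have [h hP] := choice (fun d => below (f d)).
  have [g gP] := below h; exists g => d b dc bc; apply: lt_trans (gP d dc).
  exact: hP.
have [g gP] := choice gex.
have cD := club_closed_under g.
set D := [set d | _] in cD.
exists (enumc D) => [a b|a b ba]; first by rewrite (enumc_lt cD).
have [lE EP] : D (enumc D (osucc a)) := enumc_in cD (osucc a).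
apply: lt_trans (EP (enumc D a) _); last by rewrite (enumc_lt cD) lt_osucc.
by apply: gP => //; apply: le_trans ba _; exact: (enumc_ge cD).
Qed.

(** The n-th copy places its a-th summand in the gap after the element of the club with index a + n.
    Distinct pairs of a limit ordinal and a natural number have distinct sums, so all gaps differ,
    and a + n >= a makes the gap long enough. *)
Lemma orthogonal_copies : exists (S : nat -> G -> J) (U : nat -> J -> G),
  [/\ forall n, bounded_operator (S n), forall n, bounded_operator (U n),
    forall n, cancel (S n) (U n) & forall m n, m <> n -> forall g, U m (S n g) = 0].
Proof.
have [E Emono Egap] := long_gaps.
have Ele : {homo E : a b / (a <= b)%O} by apply: ltW_homo.
pose N n (a : L) := iter n osucc (\val a).
pose c n (a : L) := osucc (E (N n a)).
pose b n (a : L) := enumc [set x | (c n a <= x)%O] (\val a).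
have la (a : L) : limit_ordinal (\val a) by have := valP a; rewrite inE.
have bE n a : (b n a < E (osucc (N n a)))%O by apply: Egap; exact: iter_osucc_ge.
have inj m n a a' x : (c m a <= x <= b m a)%O -> (c n a' <= x <= b n a')%O -> a = a' /\ m = n.
  move=> /andP[ca ba] /andP[ca' ba'].
  have NN : N m a = N n a'.
    have key m' n' a1 a2 : (c n' a2 <= x)%O -> (x <= b m' a1)%O -> ~ (N m' a1 < N n' a2)%O.
      move=> h1 h2; rewrite -osucc_le => /Ele h.
      have := lt_le_trans (le_lt_trans h2 (bE m' a1)) h.
      by rewrite ltNge; move: h1; rewrite osucc_le => /ltW ->.
    apply/eqP; rewrite eq_le !leNgt; apply/andP; split; apply/negP.
      exact: key.
    exact: key.
  by have [aa ->] := iter_osucc_inj (la a) (la a') NN; split=> //; exact: val_inj.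
have ops n : exists SU : (G -> J) * (J -> G), [/\ bounded_operator SU.1, bounded_operator SU.2,
    forall (g : G) x, (forall a : L, ~ (c n a <= x <= b n a)%O) -> SU.1 g x = 0,
    forall x : J, (forall (a : L) g, (c n a <= g <= b n a)%O -> x g = 0) -> SU.2 x = 0 &
    cancel SU.1 SU.2].
  have [||||S [U [bS bU _ S0 [U0 SK]]]] := @interval_operators R k p p1 (c n) (b n) (fun=> True).
  - by move=> a _; exact: (enumc_in (club_tail (c n a))).
  - by move=> a _; exact: lexx.
  - by move=> a _; exact: nonlimit_osucc.
  - by move=> a a' x _ _ ca ca'; have [] := inj n n a a' x ca ca'.
  exists (S, U); split.
  - exact: bS.
  - exact: bU.
  - by move=> g x nx; apply: S0 => a _; exact: nx.
  - by move=> x xz; apply: U0 => a g _; exact: xz.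
  - by apply: SK => // a.
have [SU SUP] := choice ops.
exists (fun n => (SU n).1), (fun n => (SU n).2); split.
- by move=> n; have [] := SUP n.
- by move=> n; have [_] := SUP n.
- by move=> n; have [_ _ _ _] := SUP n.
- move=> m n mn g; have [_ _ _ U0 _] := SUP m; have [_ _ S0 _ _] := SUP n.
  apply: U0 => a x cx; apply: S0 => a' cx'.
  by have [_ /mn] := inj m n a a' x cx cx'.
Qed.

Lemma ker_compressible : ker_Lambda k p1 `<=` compressible J.
Proof.
move=> T kT; have [S [U [bS bU TE]]] := ker_factors_through_G kT.
have [Sn [Un [bSn bUn SUK SU0]]] := orthogonal_copies.
split; first by case: kT.
pose i0 : 'I_1 := ord0.
(* The projections are [Sn n \o Un n], and [T = S \o U] factors as [(S \o Un n) \o (Sn n \o Un n) \o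
   (Sn n \o U)]. *)
exists 1%N, (fun n f => pin i0 (Sn n (Un n (f i0)))).
have bQ n : bounded_operator (fun f : power J 1 => pin i0 (Sn n (Un n (f i0)))).
  exact: (bop_comp (pin_bop i0) (bop_comp (bSn n) (bop_comp (bUn n) (proj_bop i0)))).
have pinE x : pin i0 x i0 = x by rewrite /pin eqxx.
split=> [n|m n mn|n].
- split; first exact: bQ.
  by apply/funext => f /=; rewrite pinE SUK.
- apply/funext => f /=; rewrite pinE SU0//.
  rewrite (lin0 (bop_linear (bSn m))); exact: (lin0 (bop_linear (pin_bop i0))).
- exists (fun f => S (Un n (f i0))), (fun x => pin i0 (Sn n (U x))); split.
  + exact: (bop_comp bS (bop_comp (bUn n) (proj_bop i0))).
  + exact: (bop_comp (pin_bop i0) (bop_comp (bSn n) bU)).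
  + by rewrite -TE; apply/funext => x /=; rewrite !pinE !SUK.
Qed.

End compressible_operators.

(** * Singular operators *)

Section singular_operators.
Context (R : realType) (k : scalar_kind) (p : R) (p1 : 1 < p).
Local Notation K := (scalarField R k).
Local Notation J := (long_james k p1).
Local Notation ind := (initial_indicator k p1).

Lemma rnorm_le_eq0 (X : normedModType K) (x : X) :
  (forall e, 0 < e -> rnorm x <= e) -> x = 0.
Proof.
move=> h; apply: rnorm_eq0; apply/eqP; rewrite eq_le rnorm_ge0 andbT.
by apply/ler_addgt0Pr => e e0; rewrite add0r; exact: h.
Qed.

(** From A T B = id, B A T is idempotent. Its fixed space is closed, isomorphic to the whole space
    through [B], and satisfies |w| = |B A T w| <= M |T w|. *)
Lemma nonker_fixes_copy (T : J -> J) : bounded_operator T -> Lambda T != 0 ->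
  fixes_copy J T.
Proof.
move=> bT z0; have [A [B [bA bB idE]]] := factor_identity bT (LambdaP bT) z0.
have ATB x : A (T (B x)) = x by have := congr1 (fun f => f x) idE.
have Bl := bop_linear bB; have bAT := bop_comp bA bT; have bBAT := bop_comp bB bAT.
pose W : set J := [set w | B (A (T w)) = w].
have WS : submod_closed (mem W).
  split=> [|z u w]; rewrite !inE /W /=; first exact: (lin0 (bop_linear bBAT)).
  move=> uE wE; have := bop_linear bBAT z u w; rewrite /= uE wE; exact.
have Wc : closed W.
  move=> w clw; have bD := bop_lin (-1) (bop_id J) bBAT.
  have [M M0 DM] := bop_bound bD.
  have DE x : (-1 *: (idfun : J -> J) + (B \o (A \o T))) x = B (A (T x)) - x.
    by rewrite -[LHS]/(-1 *: x + B (A (T x))) scaleN1r addrC.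
  suff : B (A (T w)) - w = 0 by move/subr0_eq.
  apply: rnorm_le_eq0 => e e0; have eM : 0 < e / M by rewrite divr_gt0.
  have [y Wy wy] := iffLR (closure_rnormP _ _) clw _ eM.
  have -> : B (A (T w)) - w = (-1 *: (idfun : J -> J) + (B \o (A \o T))) (w - y).
    rewrite (linB (bop_linear bD)) !DE; have -> : B (A (T y)) = y by exact: Wy.
    by rewrite subrr subr0.
  by apply: le_trans (DM _) _; rewrite mulrC -ler_pdivlMr.
pose CW := ClosedSubspace WS Wc; exists CW; split.
  have [|V bV VE] := @corestriction R k J J CW B bB; first by move=> x; rewrite /= /W /= ATB.
  have [MA MA0 AM] := bop_bound bAT.
  exists (fun w => A (T (subspace_val w))), V; split.
  - apply: (@bop_mk _ _ _ _ _ MA) => [z u w|w]; last exact: (AM (subspace_val w)).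
    exact: (bop_linear bAT).
  - exact: bV.
  - move=> w; apply: val_inj; rewrite /= VE; case: w => w /=.
    by rewrite /subspace_pred inE; exact.
  - by move=> x; rewrite VE ATB.
have [M M0 BAM] := bop_bound (bop_comp bB bA).
exists (ofReal k M^-1).
  by rewrite -ofReal0 ltr_ofReal invr_gt0.
move=> w Ww; rewrite -!(@rnormE R k) -ofRealM ler_ofReal ler_pdivrMl//.
by have := BAM (T w); rewrite /= [B _]Ww.
Qed.

(* The witness takes the value 1 at [eta n] and changes by [1 / n] at each [eta i], so
   its image has disjoint blocks with coefficients [1 / n]. *)
Lemma ker_not_bounded_below (N : J -> J) (e : R) : bounded_operator N ->
  eventual_eigenvalue N 0 -> 0 < e -> ~ forall x, e * rnorm x <= rnorm (N x).
Proof.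
move=> bN eN e0 Nbb.
have [D [l [a0 [z [[cD Dl] h1 h2 h3 h4]]]]] := operator_structure bN.
have z0 : z = 0 by apply: (eigenvalue_unique _ eN); exact: (structure_eigenvalue bN cD h1 h3 h4).
have {}h4 a : (a0 <= a)%O -> l a = 0 by move=> /h4 ->.
have [M M0 NM] := bop_bound bN; have Nl := bop_linear bN.
pose eta := fix eta n := next D (if n is n'.+1 then osucc (eta n') else a0).
have etaD n : D (eta n).
  by case: n => [|n] /=; [have [] := nextP a0 cD | have [] := nextP (osucc (eta n)) cD].
have eta_lt n : (eta n < eta n.+1)%O.
  by have [_ + _] := nextP (osucc (eta n)) cD; rewrite osucc_le.
have eta0 : (a0 <= eta 0)%O by have [_ + _] := nextP a0 cD.
have eta_hom i j : (i < j)%N -> (eta i < eta j)%O by exact: (homo_ltn lt_trans eta_lt).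
have eta_le i j : (i <= j)%N -> (eta i <= eta j)%O.
  by rewrite leq_eqVlt => /orP[/eqP ->//|/eta_hom/ltW].
(* The image has 2n blocks, each of variation at most n^(-p) M^p, and [c2 p] is the block cost;
   multiplying by n^p leaves one factor n. *)
apply: (@power_absurd R p p1 e (c2 p * 2 * M `^ p) e0) => n.
have [->|n0] := posnP n; first by rewrite mul0r mulr0 powp0.
have nR : 0 < n%:R :> R by rewrite ltr0n.
pose q : K := ofReal k (n%:R^-1).
have nq : n%:R * q = 1.
  have -> : n%:R = ofReal k n%:R :> K.
    elim: (n) => [|m IH]; first by rewrite ofReal0.
    by rewrite -!natr1 ofRealD IH ofReal1.
  by rewrite -ofRealM divff ?ofReal1// gt_eqF.
pose d i : K := if (i < n)%N then - q else q.
have kd i : kn (d i) = n%:R^-1.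
  by rewrite /d; case: ifP => _; rewrite ?knN kn_ofReal// invr_ge0 ltW.
have d_lo : \sum_(i <- iota 0 n) d i = - 1.
  rewrite big_seq (eq_bigr (fun=> - q)) => [|i]; last first.
    by rewrite mem_iota /d add0n => /andP[_ ->].
  rewrite -big_seq big_const_seq count_predT size_iota iter_addr addr0.
  by rewrite mulNrn -mulr_natl nq.
have d_hi : \sum_(i <- iota n n) d i = 1.
  rewrite big_seq (eq_bigr (fun=> q)) => [|i]; last first.
    by rewrite mem_iota /d => /andP[ni _]; rewrite ltnNge ni.
  rewrite -big_seq big_const_seq count_predT size_iota iter_addr addr0.
  by rewrite -mulr_natl nq.
pose F := iota 0 (n + n).
have Fsplit (f : nat -> K) : \sum_(i <- F) f i = \sum_(i <- iota 0 n) f i + \sum_(i <- iota n n) f i.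
  by rewrite /F iotaD big_cat add0n.
pose x : J := \sum_(i <- F) d i *: ind (eta i).
have x1 : 1 <= rnorm x.
  apply: le_trans (kn_le x (eta n)); rewrite /x lj_sumE Fsplit.
  rewrite big_seq big1 => [|i]; last first.
    by rewrite mem_iota add0n => /andP[_ /eta_hom h]; rewrite ljZ indE leNgt h mulr0.
  rewrite add0r big_seq (eq_bigr d) => [|i]; last first.
    by rewrite mem_iota => /andP[/eta_le h _]; rewrite ljZ indE h mulr1.
  by rewrite -big_seq d_hi kn1.
pose t a := Order.max a (eta 0).
have tm : {homo t : a b / (a <= b)%O}.
  by move=> a b ab; rewrite /t ge_max !le_max ab lexx orbT.
pose zt i a := d i * N (ind (eta i)) (t a).
have zt0 i a : (t a <= eta i)%O -> zt i a = 0.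
  move=> ti; have at0 : (a0 <= t a)%O by rewrite le_max eta0 orbT.
  rewrite /zt; move: ti; rewrite le_eqVlt => /orP[/eqP ti|ti].
    by rewrite ti (h3 _ (etaD i))// h4 ?mulr0// -ti.
  by rewrite (h2 _ (etaD i))// h4// mulr0.
have zt1 i a : (eta i.+1 <= t a)%O -> zt i a = 0.
  by move=> ti; rewrite /zt (h1 _ (etaD i.+1)) ?mulr0.
have Nx a : N x a = \sum_(i <- F) zt i a.
  rewrite /x (lin_sum Nl) lj_sumE.
  have [ea|ae] := leP (eta 0) a.
    by apply: eq_bigr => i _; rewrite (linZ Nl) ljZ /zt /t (max_idPl ea).
  rewrite [RHS]big1 => [|i _]; last by apply: zt0; rewrite /t (max_idPr (ltW ae)) eta_le.
  (* Below [eta 0] every column involved has the same value [l a], which need not be 0; the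
     coefficients sum to 0 so that these contributions cancel. *)
  rewrite (eq_bigr (fun i => d i * l a)) => [|i _]; last first.
    by rewrite (linZ Nl) ljZ (h2 _ (etaD 0))// eta_le.
  by rewrite -mulr_suml Fsplit d_lo d_hi addNr mul0r.
have nx_var : bvar p (N x) (c2 p * \sum_(i <- F) n%:R^-1 `^ p * M `^ p).
  apply: (blk_bvar p1 (fi := zt)) => [|a|i _]; first exact: iota_uniq.
    apply: blk_sum; [exact: iota_uniq | exact: Nx |].
    move=> i j zi zj; have ub m : zt m a <> 0 -> (eta m < t a < eta m.+1)%O.
      by move=> zm; rewrite !ltNge; apply/andP; split; apply/negP; [move/zt0 | move/zt1].
    have /andP[i1 i2] := ub i zi; have /andP[j1 j2] := ub j zj.
    have sep m m' : (t a < eta m.+1)%O -> (eta m' < t a)%O -> (m' <= m)%N.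
      move=> h5 h6; rewrite leqNgt; apply/negP => mm.
      by have := lt_le_trans h5 (eta_le m.+1 m' mm); rewrite ltNge (ltW h6).
    by apply/eqP; rewrite eqn_leq (sep j i j2 i1) (sep i j i2 j1).
  rewrite -(kd i); apply: (@bvarZ _ _ _ (N (ind (eta i)) \o t) _ (d i)).
  apply: (bvar_comp tm); apply: (bvar_le _ (bvar_norm (N (ind (eta i))))).
  apply: (powp_le p1 (rnorm_ge0 _)); apply: le_trans (NM _) _.
  by rewrite ler_piMr ?(ltW M0)// ind_norm.
have en : e `^ p <= c2 p * 2 * M `^ p * n%:R * n%:R^-1 `^ p.
  apply: le_trans (_ : rnorm (N x) `^ p <= _).
    apply: (powp_le p1 (ltW e0)); apply: le_trans (Nbb x).
    by rewrite ler_peMr// ltW.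
  apply: le_trans (norm_bvar nx_var) _.
  set Y := n%:R^-1 `^ p * M `^ p.
  have -> : \sum_(i <- F) Y = n%:R * Y + n%:R * Y.
    by rewrite /F big_const_seq count_predT size_iota iter_addr addr0 mulrnDr -[Y *+ n]mulr_natl.
  by rewrite le_eqVlt; apply/orP; left; apply/eqP; rewrite /Y; ring.
rewrite powRM ?ler0n ?(ltW e0)// mulrC -ler_pdivlMr ?powR_gt0//.
apply: le_trans en _; rewrite ler_pM2l.
  rewrite -powR_inv1 ?ler0n// -powRrM mulN1r powRN; exact: lexx.
by rewrite !mulr_gt0 ?c2_gt0 ?powR_gt0.
Qed.

(** Composing [T] with an isomorphism onto the fixed copy gives an operator of the whole space that
    is bounded below, yet its character is still 0. *)
Lemma ker_singular (T : J -> J) : ker_Lambda k p1 T -> ~ fixes_copy J T.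
Proof.
move=> /ker_LambdaP[bT eT] [W [[U [V [bU bV UV VU]]] [c c0 cT]]].
have bval : bounded_operator (@subspace_val K J W : subspaceType W -> J).
  by apply: (@bop_mk _ _ _ _ _ 1) => // w; rewrite mul1r.
have bvV := bop_comp bval bV; have bN := bop_comp bT bvV.
have eN : eventual_eigenvalue (T \o ((@subspace_val K J W : subspaceType W -> J) \o V)) 0.
  by have := eigenvalue_comp eT (LambdaP bvV); rewrite mul0r.
have [M M0 UM] := bop_bound bU.
have e0 : 0 < toReal c / M by rewrite divr_gt0// toReal_gt0.
apply: (ker_not_bounded_below bN eN e0) => x.
have Wv : subspace_set W (subspace_val (V x)).
  by case: (V x) => y /=; rewrite /subspace_pred inE.
have := cT _ Wv; rewrite -!(@rnormE R k) -{1}(toRealK (ltW c0)) -ofRealM ler_ofReal => h.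
apply: le_trans h; rewrite mulrAC ler_pdivrMr// -mulrA ler_wpM2l ?(ltW (toReal_gt0 c0))//.
by rewrite mulrC; have := UM (V x); rewrite VU.
Qed.

End singular_operators.

Theorem theorem3p7 (R : realType) (k : scalar_kind) (p : R) (p1 : 1 < p) :
  let J : normedModType (scalarField R k) := long_james k p1 in
  let G : normedModType (scalarField R k) := G_space k p1 in
  [/\ ker_Lambda k p1 = wcg_operators J,
      wcg_operators J = factoring_span J G,
      factoring_span J G = compressible J &
      compressible J = not_factoring_identity J]
  /\ (maximal_ideal (ker_Lambda k p1) /\
      forall I : set (J -> J), maximal_ideal I -> I = ker_Lambda k p1)
  /\ (forall T : J -> J, bounded_operator T ->
       (ker_Lambda k p1 T <-> ~ fixes_copy J T)).
Proof.
move=> J G.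
have kW : ker_Lambda k p1 = wcg_operators J.
  by apply/seteqP; split; [exact: ker_wcg_operators | exact: wcg_operators_ker].
have kF : ker_Lambda k p1 = factoring_span J G.
  by apply/seteqP; split; [exact: ker_factoring_span | exact: factoring_span_ker].
have kC : ker_Lambda k p1 = compressible J.
  by apply/seteqP; split; [exact: ker_compressible | exact: compressible_ker].
have kM : not_factoring_identity J = ker_Lambda k p1 := not_factoring_ker k p1.
split; first by rewrite -kW -kF -kC kM; split.
split; first by split; [exact: ker_Lambda_maximal | exact: maximal_ideal_ker].
move=> T bT; split; first exact: ker_singular.
move=> nf; split; first exact: bT.
by apply/eqP/negPn/negP => z0; apply: nf; exact: nonker_fixes_copy.
Qed.
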